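(* There exist a constant $\epsilon\in(0,1]$ and an infinite family of finite bipartite graphs (with arbitrarily many vertices), each of which is a bipartite $\epsilon$-expander and admits a $3$-pushdown book embedding.
   Context: For $\epsilon\in(0,1]$, a bipartite graph $G$ with bipartition $V(G)=A\cup B$ is a bipartite $\epsilon$-expander if $|A|=|B|$ and $|N(S)|\geq(1+\epsilon)|S|$ for every subset $S\subset A$ with $|S|\leq |A|/2$, where $N(S)$ is the set of vertices adjacent to some vertex of $S$. A $k$-page book embedding of a graph $G$ consists of a linear order $(u_1,\dots,u_n)$ of $V(G)$ and a partition $E_1,\dots,E_k$ of $E(G)$ such that for each $i$ there are no edges $u_au_b,u_cu_d\in E_i$ with $a<c<b<d$. It is $k$-pushdown if additionally each $E_i$ is a matching. *)

(* Defs.v *)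
From mathcomp Require Import all_boot all_order all_algebra.
Set Implicit Arguments. Unset Strict Implicit. Unset Printing Implicit Defensive.
Import Order.TTheory GRing.Theory Num.Theory.

(* A finite bipartite graph with bipartition A ∪ B is given by two finite
   types A, B (the two sides) and an adjacency relation adj : A -> B -> bool;
   the vertex set is the disjoint union A + B, the edges are the pairs
   (a, b) with adj a b. *)

Section Bip.
Variables (A B : finType) (adj : A -> B -> bool).

Definition nbhd (S : {set A}) : {set B} := [set b | [exists a in S, adj a b]].

Definition bip_expander (eps : rat) : Prop :=
  #|A| = #|B| /\
  forall S : {set A}, (#|S|%:R <= #|A|%:R / 2 :> rat)%R ->
    ((1 + eps) * #|S|%:R <= #|nbhd S|%:R :> rat)%R.

Definition vtx : finType := (A + B)%type.

Definition vA (a : A) : vtx := inl a.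
Definition vB (b : B) : vtx := inr b.

(* k-page book embedding: a linear order of V(G), given as a bijection
   pos : V -> 'I_|V| (u_i is the vertex at position i), and a partition of
   E(G) into pages E_0..E_{k-1}, given by page : A -> B -> 'I_k
   (E_i = {(a,b) | adj a b && page a b == i}); no two edges in the same
   page cross: positions p < q and r < s with p < r < q < s. *)
Definition lo (pos : vtx -> nat) (a : A) (b : B) := minn (pos (vA a)) (pos (vB b)).
Definition hi (pos : vtx -> nat) (a : A) (b : B) := maxn (pos (vA a)) (pos (vB b)).

Definition book_embedding (k : nat) (pos : vtx -> 'I_#|vtx|) (page : A -> B -> 'I_k) : Prop :=
  injective pos /\
  forall a1 b1 a2 b2, adj a1 b1 -> adj a2 b2 -> page a1 b1 = page a2 b2 ->
    ~ [/\ lo pos a1 b1 < lo pos a2 b2, lo pos a2 b2 < hi pos a1 b1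
        & hi pos a1 b1 < hi pos a2 b2]%N.

Definition pushdown_embedding (k : nat) (pos : vtx -> 'I_#|vtx|) (page : A -> B -> 'I_k) : Prop :=
  book_embedding pos page /\
  forall a1 b1 a2 b2, adj a1 b1 -> adj a2 b2 -> page a1 b1 = page a2 b2 ->
    (a1, b1) <> (a2, b2) -> a1 <> a2 /\ b1 <> b2.

Definition has_pushdown (k : nat) : Prop :=
  exists (pos : vtx -> 'I_#|vtx|) (page : A -> B -> 'I_k), pushdown_embedding pos page.

End Bip.

(* Main.v *)
(** It suffices to find boundedly many partial increasing maps of arbitrarily large
    intervals ['I_N] which together expand every set of density between 1/20 and 3/5:
    d layers, joined by rungs (x in a layer to its copy), by shelves (x to its copy in
    the next layer) and by slants (x to its image under the map of the layer), form a
    3-pushdown graph, and deleting one maximal non-expanding small set makes that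
    graph expand at all scales.

    The maps are permutations with a small set of exceptions, built by towers.  From
    permutations phi_i of ['I_N], pass to ['I_(N * n)] with n = N, i.e. to pairs (x, v),
    by (x, v) |-> (phi_i x, v + s_i x mod n), with s_i x random in an interval much
    shorter than n: the order is preserved except where v + s_i x wraps around.  A
    Fourier transform in v turns the averaging operator into the averaging operator of
    the phi_i, twisted by the characters of s_i.  For every frequency that s_i mixes,
    all cuts of the twisted operator are small with positive probability (a union
    bound over connected sets, Hoeffding's inequality for large ones, and sparsity of
    the graph on small ones), and decomposing functions into the level sets of their
    binary digits bounds its norm, as in the converse expander mixing lemma of Bilu
    and Linial.  The other frequencies only see a window of binary digits of x.

    The windows of two towers, with different ratios of log N to the window length,
    can be made disjoint, so a function fixed by both averages lives on the coarsest
    digits, where rotations of the interval average it out.  Hence one of three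
    averaging operators contracts each function of mean zero. *)
Require Import Defs.
From HB Require Import structures.
From mathcomp Require Import all_boot all_order all_algebra.
From mathcomp Require Import zify ring lra.
From mathcomp Require Import Rstruct boolp reals sequences exp trigo.
Set Implicit Arguments. Unset Strict Implicit. Unset Printing Implicit Defensive.
Import Order.TTheory GRing.Theory Num.Theory.

(** The density range is what the two reductions leave over. Deletion removes a set X of at most a
    tenth of one side and then needs expansion of unions of X with sets of at most half the size,
    hence 3/5. A set of density at least 1/10 in the layered graph either has density at least 1/20
    in its smallest layer or varies so much between layers that the shelves expand it.

    The main obstacle is to keep the degree D fixed while N grows. The union bound over connected
    sets pays a factor polynomial in N, so it can only start at sizes proportional to log N, and
    below that size the graph has to be known to be sparse. A random lift doubles the size up to
    which sparsity holds, and taking n = N doubles log N: the two stay in proportion for ever, with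
    the same D.

    Each step adds to the exceptional set the fraction of wrapped points, which at least halves from
    step to step; the total stays small compared with 1 / D. Its price is that translations short
    compared with n cannot mix low frequencies, so the invariant of a tower is not a norm bound but
    an inequality with the energies of the unmixed digits as error terms. *)

Section Components.
Local Open Scope nat_scope.
Variables (I V : finType) (tau : I -> V -> V).
Hypothesis tauK : forall i, involutive (tau i).

(** The vertices met by the walk from [v] that follows the colours in [w]. Connected sets are
    encoded by such words because words of a given length are easy to count. *)
Fixpoint visited (v : V) (w : seq I) : {set V} :=
  v |: (if w is i :: w' then visited (tau i v) w' else set0).

Lemma visited_head v w : v \in visited v w.
Proof. by case: w => *; rewrite /= setU11. Qed.

(** At the first visit of [v] the excursion [[:: i; i]] is spliced in: [tau i] is an involution, so
    the walk is back at [v] after two steps and goes on as before. *)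
Lemma visited_insert v0 w v i : v \in visited v0 w ->
  exists w', visited v0 w' = tau i v |: visited v0 w /\ size w' = (size w).+2.
Proof.
elim: w v0 => [|j w IH] v0.
  rewrite /= setU0 inE => /eqP ->; exists [:: i; i]; split=> //=.
  by rewrite tauK setU0 setUCA setUid.
have [-> _|nv] := eqVneq v v0.
  exists (i :: i :: j :: w); split=> //=.
  by rewrite tauK setUCA; congr (_ |: _); rewrite setUA setUid.
rewrite /= inE in_set1 (negbTE nv) /= => /IH [w' [e s]].
by exists (j :: w'); rewrite /= e s setUCA.
Qed.

Definition closed_in (S C : {set V}) :=
  forall i v, v \in C -> tau i v \in S -> tau i v \in C.

(** Neighbours inside [S] are added one at a time until none is missing. Each costs an excursion of
    two letters, as in a traversal of a spanning tree. *)
Lemma component (S : {set V}) v0 : v0 \in S -> exists C w,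
  [/\ C = visited v0 w, C \subset S, closed_in S C & size w = (#|C|.-1).*2].
Proof.
move=> v0S.
suff: forall k (C : {set V}) w, C = visited v0 w -> C \subset S -> size w = (#|C|.-1).*2 ->
    #|S| - #|C| <= k ->
  exists C w, [/\ C = visited v0 w, C \subset S, closed_in S C & size w = (#|C|.-1).*2].
  move=> /(_ _ [set v0] [::] _ _ _ (leqnn _)); apply.
  - by rewrite /= setU0.
  - by rewrite sub1set.
  - by rewrite cards1.
elim=> [|k IH] C w eC CS sw hk.
  exists C, w; split=> //.
  have -> : C = S by apply/eqP; rewrite eqEcard CS /= -subn_eq0 -leqn0.
  by [].
have [cl|] := pselect (closed_in S C); first by exists C, w.
move=> /existsNP [i /existsNP [v /not_implyP [vC /not_implyP [tS /negP tC]]]].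
have vw : v \in visited v0 w by rewrite -eC.
have [w' [e s]] := visited_insert i vw.
have C0 : 0 < #|C| by apply/card_gt0P; exists v.
apply: (IH (tau i v |: C) w').
- by rewrite e eC.
- by rewrite subUset sub1set tS.
- by rewrite s sw cardsU1 tC /=; move: C0; case: #|C|.
- by rewrite cardsU1 tC /=; lia.
Qed.

End Components.

(** * Exponential moments and large deviations, in counting form *)

Section Tails.
Local Open Scope ring_scope.
Variable R : realType.

Lemma expR_le_quadratic (x : R) : `|x| <= 1 / 2 -> expR x <= 1 + x + 2 * x ^+ 2.
Proof.
rewrite ler_norml => /andP[x1 x2].
have h : 1 - x <= expR (- x) by have := @expR_ge1Dx R (- x).
have p : 0 < expR x by exact: expR_gt0.
have e : expR x * expR (- x) = 1 by rewrite -expRD subrr expR0.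
have k : expR x * (1 - x) <= 1 by have := ler_wpM2l (ltW p) h; rewrite e.
have x0 : 0 < 1 - x by lra.
rewrite -(ler_pM2r x0); apply: le_trans k _.
have -> : (1 + x + 2 * x ^+ 2) * (1 - x) = 1 + x ^+ 2 * (1 - 2 * x) by ring.
rewrite lerDl.
by apply: mulr_ge0; [exact: sqr_ge0|lra].
Qed.

Lemma card_le_sum (T : finType) (P : pred T) (g : T -> R) :
  (forall t, 0 <= g t) -> (forall t, P t -> 1 <= g t) ->
  #|[set t | P t]|%:R <= \sum_t g t.
Proof.
move=> g0 g1; rewrite -sum1_card natr_sum big_mkcond /=.
apply: ler_sum => t _; rewrite inE; case: ifP => // /g1; exact.
Qed.

Lemma geometric_tail (sigma : nat) (r : R) n : 0 <= r <= 1 / 2 ->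
  \sum_(k < n) (if (sigma < k)%N then r ^+ k else 0) <= r ^+ sigma.
Proof.
move=> /andP[r0 r1].
(* The subtracted term makes the induction work: as [r <= 1 / 2], twice [r ^+ n] is at most
   [r ^+ n.-1]. *)
suff H : \sum_(k < n) (if (sigma < k)%N then r ^+ k else 0) <=
    (if (sigma < n)%N then r ^+ sigma - r ^+ n.-1 else 0).
  apply: le_trans H _; case: ifP => _; last exact: exprn_ge0.
  by rewrite gerBl exprn_ge0.
elim: n => [|n IH]; first by rewrite big_ord0.
rewrite big_ord_recr /=; apply: le_trans (lerD IH (lexx _)) _.
have [sn|ns] := ltnP sigma n; last first.
  rewrite addr0; case: ifP => // h; have -> : sigma = n by lia.
  by rewrite subrr.
rewrite (ltn_trans sn (ltnSn n)); case: n sn {IH} => // n sn /=.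
have := exprn_ge0 n r0; rewrite exprS => h.
have := ler_wpM2r h r1; lra.
Qed.

Variables (E : finType) (m : nat).

Lemma sum_ffun_prod (g : E -> 'I_m -> R) :
  \sum_(s : {ffun E -> 'I_m}) \prod_e g e (s e) = \prod_e \sum_j g e j.
Proof. by rewrite bigA_distr_bigA. Qed.

(** Chernoff's method, with numbers of functions in place of probabilities: the exponential moment
    factors over the coordinates, and those outside [F] contribute exactly [m]. *)
Lemma hoeffding_count (F : {set E}) (om : 'I_m -> R) (M : nat) (y lam eta : R) :
  (#|F| <= M)%N -> 0 <= lam <= 1 / 2 -> 0 <= eta ->
  (forall j, `|om j| <= 1) -> \sum_j om j <= eta * m%:R ->
  #|[set s : {ffun E -> 'I_m} | y <= \sum_(e in F) om (s e)]|%:R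
    <= m%:R ^+ #|E| * expR (- (lam * y) + (lam * eta + 2 * lam ^+ 2) * M%:R).
Proof.
move=> FM /andP[l0 l1] eta0 om1 ommean.
pose g e j := if e \in F then expR (lam * om j) else 1 : R.
have bound : \sum_(s : {ffun E -> 'I_m}) \prod_e g e (s e)
   <= m%:R ^+ #|E| * expR ((lam * eta + 2 * lam ^+ 2) * M%:R).
  rewrite sum_ffun_prod.
  have -> : m%:R ^+ #|E| * expR ((lam * eta + 2 * lam ^+ 2) * M%:R) =
     (\prod_(e : E) m%:R) * expR ((lam * eta + 2 * lam ^+ 2) * M%:R) :> R.
    by rewrite prodr_const.
  have c0 : 0 <= lam * eta + 2 * lam ^+ 2.
    by apply: addr_ge0; [exact: mulr_ge0|apply: mulr_ge0 => //; exact: sqr_ge0].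
  apply: (@le_trans _ _ (\prod_e (m%:R * (if e \in F then expR (lam * eta + 2 * lam ^+ 2) else 1)))).
    apply: ler_prod => e _; apply/andP; split.
      by apply: sumr_ge0 => j _; rewrite /g; case: ifP => _ //; exact: expR_ge0.
    rewrite /g; case: ifP => eF; last by rewrite sumr_const card_ord mulr1.
    apply: (@le_trans _ _ (\sum_(j < m) (1 + lam * om j + 2 * lam ^+ 2))).
      apply: ler_sum => j _.
      have o := om1 j.
      apply: (le_trans (expR_le_quadratic _)).
        rewrite normrM (ger0_norm l0); apply: le_trans (_ : lam * 1 <= _).
          exact: ler_wpM2l.
        by rewrite mulr1.
      rewrite lerD2l exprMn; apply: ler_wpM2l => //.
      rewrite ler_piMr ?sqr_ge0 // -[X in X <= _]real_normK ?num_real //.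
      by rewrite expr_le1.
    rewrite !big_split /= !sumr_const card_ord -mulr_sumr.
    apply: (@le_trans _ _ (m%:R * (1 + (lam * eta + 2 * lam ^+ 2)))).
      rewrite -mulr_natl mulr1 -[(2 * lam ^+ 2) *+ m]mulr_natl.
      have := ler_wpM2l l0 ommean; lra.
    by rewrite ler_wpM2l ?ler0n // expR_ge1Dx.
  rewrite big_split /=; apply: ler_wpM2l; first by apply: prodr_ge0.
  rewrite -big_mkcond /= prodr_const -expRM_natr.
  rewrite ler_expR; apply: ler_wpM2l => //; by rewrite ler_nat.
rewrite expRD mulrCA expRN mulrC ler_pdivlMr ?expR_gt0 //.
apply: le_trans bound.
rewrite -sum1_card natr_sum mulr_suml big_mkcond /=.
apply: ler_sum => s _; rewrite inE.
case: ifP => h; last by apply: prodr_ge0 => e _; rewrite /g; case: ifP => // _; exact: expR_ge0.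
rewrite mul1r /g -big_mkcond /= -expR_sum ler_expR -mulr_sumr.
exact: ler_wpM2l.
Qed.

End Tails.

(** * Edge sums over connected sets of the bipartite double cover *)

Section Cut.
Local Open Scope ring_scope.
Variable R : realType.

(** Cauchy-Schwarz for the vectors (sqrt a, sqrt c) and (sqrt b, sqrt d). *)
Lemma sqrt_superadditive (a b c d : nat) :
  Num.sqrt (a * b)%:R + Num.sqrt (c * d)%:R <= Num.sqrt ((a + c) * (b + d))%:R :> R.
Proof.
have E x y : Num.sqrt (x * y)%:R = Num.sqrt x%:R * Num.sqrt y%:R :> R.
  by rewrite natrM sqrtrM ?ler0n.
rewrite !E.
have [[pa sa] [pb sb] [pc sc] [pd sd]] :
  [/\ 0 <= Num.sqrt a%:R :> R /\ Num.sqrt a%:R ^+ 2 = a%:R :> R,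
      0 <= Num.sqrt b%:R :> R /\ Num.sqrt b%:R ^+ 2 = b%:R :> R,
      0 <= Num.sqrt c%:R :> R /\ Num.sqrt c%:R ^+ 2 = c%:R :> R &
      0 <= Num.sqrt d%:R :> R /\ Num.sqrt d%:R ^+ 2 = d%:R :> R].
  by split; (split; [exact: sqrtr_ge0|rewrite sqr_sqrtr ?ler0n]).
set p := Num.sqrt a%:R in pa sa *; set q := Num.sqrt b%:R in pb sb *.
set r := Num.sqrt c%:R in pc sc *; set t := Num.sqrt d%:R in pd sd *.
have h0 : 0 <= p * q + r * t by apply: addr_ge0; apply: mulr_ge0.
rewrite -sqrtrM ?ler0n // -(ger0_norm h0) -sqrtr_sqr ler_sqrt; last first.
  by rewrite -natrM ler0n.
rewrite !natrD -sa -sb -sc -sd.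
have := sqr_ge0 (p * t - r * q); lra.
Qed.

Lemma sum_indicator_ge1 (T : finType) (g : T -> R) t0 :
  (forall t, 0 <= g t) -> 1 <= g t0 -> 1 <= \sum_t g t.
Proof.
move=> g0 h; rewrite (bigD1 t0) //=; apply: le_trans h _.
by rewrite lerDl; apply: sumr_ge0.
Qed.

Variables (D : nat) (X : finType) (phi : 'I_D -> X -> X).
Hypothesis phi_inj : forall i, injective (phi i).

(* [flip i] moves along the edge of colour [i] in the bipartite double cover
   joining [(false, x)] to [(true, phi i x)]. *)
Definition flip (i : 'I_D) (v : bool * X) : bool * X :=
  if v.1 then (false, invF (@phi_inj i) v.2) else (true, phi i v.2).

Lemma flipK i : involutive (flip i).
Proof. by case=> [[] x]; rewrite /flip /= ?f_invF ?invF_f. Qed.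

Definition side (S : {set bool * X}) b : {set X} := [set x | (b, x) \in S].

Definition edges (S : {set bool * X}) : {set 'I_D * X} :=
  [set e | ((false, e.2) \in S) && ((true, phi e.1 e.2) \in S)].

Lemma card_sides (S : {set bool * X}) : #|S| = (#|side S true| + #|side S false|)%N.
Proof.
rewrite -sum1_card (eq_bigr (fun p => (fun _ _ => 1)%N p.1 p.2)) //=.
rewrite (eq_bigl (fun p => predT p.1 && ((p.1, p.2) \in S))); last by case.
rewrite -(pair_big_dep predT (fun b x => (b, x) \in S) (fun _ _ => 1%N)) /= big_bool /=.
by rewrite -!sum1_card; congr (_ + _)%N; apply: eq_bigl => x; rewrite inE.
Qed.

Lemma card_edges_l S : (#|edges S| <= D * #|side S false|)%N.
Proof.
have -> : (D * #|side S false| = #|setX [set: 'I_D] (side S false)|)%N.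
  by rewrite cardsX cardsT card_ord.
apply: subset_leq_card; apply/subsetP => -[i x].
by rewrite !inE /= => /andP[].
Qed.

Lemma card_edges_r S : (#|edges S| <= D * #|side S true|)%N.
Proof.
have -> : (D * #|side S true| = #|setX [set: 'I_D] (side S true)|)%N.
  by rewrite cardsX cardsT card_ord.
rewrite -(card_imset (f := fun e : 'I_D * X => (e.1, phi e.1 e.2))); last first.
  by move=> [i x] [j y] /= [-> /phi_inj ->].
apply: subset_leq_card; apply/subsetP => _ /imsetP[[i x] ex ->].
by move: ex; rewrite !inE /= => /andP[].
Qed.

(** A closed part of [S] has no edge to the rest of [S]. *)
Lemma sum_edges_split (c : 'I_D * X -> R) (S C : {set bool * X}) :
  C \subset S -> closed_in flip S C ->
  \sum_(e in edges S) c e = \sum_(e in edges C) c e + \sum_(e in edges (S :\: C)) c e.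
Proof.
move=> /subsetP CS cl; rewrite (bigID (mem (edges C))) /=; congr (_ + _).
  apply: eq_bigl => e; rewrite !inE andb_idl // => /andP[h1 h2].
  by rewrite (CS _ h1) (CS _ h2).
apply: eq_bigl => -[i x]; rewrite !inE /=.
have E : (false, x) \in S -> (true, phi i x) \in S ->
    ((false, x) \in C) = ((true, phi i x) \in C).
  move=> h1 h2; apply/idP/idP => h.
    by have := cl i _ h; rewrite /flip /=; apply.
  by have := cl i _ h; rewrite /flip /= invF_f; apply.
move: E; case: ((false, x) \in S); case: ((true, phi i x) \in S); case: ((false, x) \in C);
  case: ((true, phi i x) \in C) => //= E; by have := E isT isT.
Qed.

(* Since sqrt (a b) is superadditive, a cut bound need only be checked on connected
   sets. Connected sets of size k are traced by words of length 2 (k - 1), so there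
   are at most 2 #|X| D ^ (2 (k - 1)) of them, which a union bound can afford. *)
Lemma cut_bound_of_walks (c : 'I_D * X -> R) (K : R) : 0 <= K ->
  (forall C v0 w, C = visited flip v0 w -> size w = (#|C|.-1).*2 ->
     `|\sum_(e in edges C) c e| <= K * Num.sqrt (#|side C true| * #|side C false|)%:R) ->
  forall S, `|\sum_(e in edges S) c e| <= K * Num.sqrt (#|side S true| * #|side S false|)%:R.
Proof.
move=> K0 walks S; have [n] := ubnP #|S|; elim: n S => // n IH S Sn.
have [->|[v0 v0S]] := set_0Vmem S.
  rewrite big1 ?normr0 ?mulr_ge0 ?sqrtr_ge0 // => e; by rewrite !inE.
have [C [w [eC CS cl sw]]] := component flipK v0S.
rewrite (sum_edges_split c CS cl).
apply: le_trans (ler_normD _ _) _.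
have v0C : v0 \in C by rewrite eC visited_head.
have IHd : `|\sum_(e in edges (S :\: C)) c e| <=
    K * Num.sqrt (#|side (S :\: C) true| * #|side (S :\: C) false|)%:R.
  apply: IH; rewrite cardsD (setIidPr CS).
  rewrite ltnS in Sn; apply: leq_trans Sn; rewrite ltn_subrL.
  by apply/andP; split; apply/card_gt0P; exists v0.
apply: le_trans (lerD (walks _ _ _ eC sw) IHd) _.
rewrite -mulrDr; apply: ler_wpM2l => //.
apply: le_trans (sqrt_superadditive _ _ _ _) _.
have E b : (#|side C b| + #|side (S :\: C) b|)%N = #|side S b|.
  have <- : side S b :&: side C b = side C b.
    by apply/setIidPr/subsetP => x; rewrite !inE => /(subsetP CS).
  have -> : side (S :\: C) b = side S b :\: side C b.
    by apply/setP => x; rewrite !inE.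
  exact: cardsID.
by rewrite !E.
Qed.

End Cut.

(** * Cut bounds for random edge weights *)

Section RandomCut.
Local Open Scope ring_scope.
Variable R : realType.
Variables (D m sigma B : nat) (X : finType) (phi : 'I_D -> X -> X).
Hypothesis phi_inj : forall i, injective (phi i).
Variables (W : finType) (om : W -> 'I_m -> R) (alpha r : R).
Hypothesis alpha_gt0 : 0 < alpha.
Hypothesis alpha_le1 : alpha <= 1.
Hypothesis om_le1 : forall w j, `|om w j| <= 1.
Hypothesis om_mean : forall w, `|\sum_j om w j| <= alpha / 4 * m%:R.
Hypothesis sparse : forall S : {set X}, (#|S| <= sigma)%N ->
  (#|[set e : 'I_D * X | (e.2 \in S) && (phi e.1 e.2 \in S)]| <= B * #|S|)%N.
Hypothesis B_small : 2 * B%:R <= alpha ^+ 2 * D%:R.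

Let cut (S : {set bool * X}) : R := Num.sqrt (#|side S true| * #|side S false|)%:R.
Let c (s : {ffun 'I_D * X -> 'I_m}) w e := om w (s e).

(** These sets need no randomness. If one side is smaller than alpha^2 times the other, the degree
    bound from the smaller side suffices. If the sides a, b are comparable and [C] is small,
    sparsity gives B (a + b), which is at most 2 B sqrt (a b) / alpha, and [B_small] absorbs
    this. *)
Lemma cut_bound_sparse s w (C : {set bool * X}) :
  (#|C| <= sigma)%N || ~~ ((alpha ^+ 2 * #|side C true|%:R <= #|side C false|%:R)
      && (alpha ^+ 2 * #|side C false|%:R <= #|side C true|%:R)) ->
  `|\sum_(e in edges phi C) c s w e| <= alpha * D%:R * cut C.
Proof.
move=> h.
have card_le : `|\sum_(e in edges phi C) c s w e| <= #|edges phi C|%:R.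
  apply: le_trans (ler_norm_sum _ _ _) _.
  rewrite -sum1_card natr_sum; apply: ler_sum => e _; exact: om_le1.
apply: le_trans card_le _.
have hl : #|edges phi C|%:R <= D%:R * #|side C false|%:R :> R.
  by rewrite -natrM ler_nat card_edges_l.
have hr : #|edges phi C|%:R <= D%:R * #|side C true|%:R :> R.
  by rewrite -natrM ler_nat (card_edges_r phi_inj).
have hs : (#|C| <= sigma)%N -> #|edges phi C|%:R <= B%:R * (#|side C true| + #|side C false|)%:R :> R.
  move=> Cs; rewrite -natrM ler_nat -card_sides.
  have U : (#|side C true :|: side C false| <= #|C|)%N.
    by rewrite (card_sides C) cardsU leq_subr.
  apply: leq_trans (leq_trans (sparse (leq_trans U Cs)) (leq_mul (leqnn B) U)).
  apply: subset_leq_card; apply/subsetP => -[i x]; rewrite !inE /= => /andP[-> ->].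
  by rewrite orbT.
rewrite /cut natrM sqrtrM ?ler0n //.
move: h hl hr hs; set a := #|side C true|; set b := #|side C false|.
have [pa sa] : 0 <= Num.sqrt a%:R :> R /\ Num.sqrt a%:R ^+ 2 = a%:R :> R.
  by split; [exact: sqrtr_ge0|rewrite sqr_sqrtr ?ler0n].
have [pb sb] : 0 <= Num.sqrt b%:R :> R /\ Num.sqrt b%:R ^+ 2 = b%:R :> R.
  by split; [exact: sqrtr_ge0|rewrite sqr_sqrtr ?ler0n].
move: pa sa pb sb; move: (Num.sqrt a%:R) (Num.sqrt b%:R) => p q pa sa pb sb.
rewrite natrD -sa -sb.
set e := #|edges phi C|%:R => h hl hr hs.
have D0 : 0 <= D%:R :> R by rewrite ler0n.
have sq (x y : R) : 0 <= x -> 0 <= y -> (x ^+ 2 <= y ^+ 2) = (x <= y).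
  by move=> x0 y0; rewrite ler_pXn2r.
have [qp|/negP qp] := boolP (q <= alpha * p).
  apply: le_trans hl _.
  have h1 : q ^+ 2 <= alpha * p * q by rewrite expr2; apply: ler_wpM2r.
  have -> : alpha * D%:R * (p * q) = D%:R * (alpha * p * q) by ring.
  exact: ler_wpM2l.
have [pq|/negP pq] := boolP (p <= alpha * q).
  apply: le_trans hr _.
  have h1 : p ^+ 2 <= alpha * q * p by rewrite expr2; apply: ler_wpM2r.
  have -> : alpha * D%:R * (p * q) = D%:R * (alpha * q * p) by ring.
  exact: ler_wpM2l.
move/negP: qp; rewrite -ltNge => qp; move/negP: pq; rewrite -ltNge => pq.
move: h; rewrite -!exprMn !sq ?mulr_ge0 ?(ltW alpha_gt0) //.
rewrite (ltW qp) (ltW pq) /= orbF => /hs hh; apply: le_trans hh _.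
have h1 : alpha * p ^+ 2 <= p * q.
  have := ler_wpM2r pa (ltW qp); lra.
have h2 : alpha * q ^+ 2 <= p * q.
  have := ler_wpM2r pb (ltW pq); lra.
rewrite -(ler_pM2l alpha_gt0).
apply: (@le_trans _ _ (B%:R * (2 * (p * q)))).
  by rewrite mulrCA; apply: ler_wpM2l; rewrite ?ler0n //; lra.
have -> : alpha * (alpha * D%:R * (p * q)) = alpha ^+ 2 * D%:R * (p * q) by ring.
rewrite mulrA [B%:R * 2]mulrC; apply: ler_wpM2r => //; exact: mulr_ge0.
Qed.

Let event (C : {set bool * X}) w (sg : bool) (s : {ffun 'I_D * X -> 'I_m}) :=
  alpha * D%:R * cut C <= \sum_(e in edges phi C) (-1) ^+ sg * c s w e.

(** With Chernoff parameter alpha / 8 the error terms add up to alpha^2 M / 16, half of the gain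
    alpha^2 M / 8. Since the sides are comparable, [M] is at least of order alpha^2 D times the size
    of [C], which makes the bound exponentially small in that size. *)
Lemma event_count C w sg :
  alpha ^+ 2 * #|side C true|%:R <= #|side C false|%:R ->
  alpha ^+ 2 * #|side C false|%:R <= #|side C true|%:R ->
  #|[set s | event C w sg s]|%:R <=
    m%:R ^+ #|{: 'I_D * X}| * expR (- (D%:R * alpha ^+ 4 / 32)) ^+ #|C|.
Proof.
move=> hab hba.
pose M := (D * minn #|side C true| #|side C false|)%N.
have FM : (#|edges phi C| <= M)%N.
  rewrite /M /minn; case: ifP => _; [exact: (card_edges_r phi_inj)|exact: card_edges_l].
have om1 j : `|(-1) ^+ sg * om w j| <= 1 by rewrite normrM normr_sign mul1r.
have omm : \sum_j (-1) ^+ sg * om w j <= alpha / 4 * m%:R.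
  rewrite -mulr_sumr; apply: le_trans (ler_norm _) _.
  by rewrite normrM normr_sign mul1r.
have l01 : 0 <= alpha / 8 <= 1 / 2.
  by have := alpha_gt0; have := alpha_le1; move=> *; apply/andP; split; lra.
have e0 : 0 <= alpha / 4 by have := alpha_gt0; lra.
have H := hoeffding_count (alpha * D%:R * cut C) FM l01 e0 om1 omm.
apply: (le_trans H).
apply: ler_wpM2l; first by apply: exprn_ge0; rewrite ler0n.
rewrite -expRM_natr ler_expR card_sides /M /cut natrM sqrtrM ?ler0n // !natrM natrD.
move: hab hba; set a := #|side C true|; set b := #|side C false|.
have -> : (minn a b)%:R = Num.min a%:R b%:R :> R.
  by rewrite natr_min.
move=> hab hba.
have hmin : alpha ^+ 2 * (a%:R + b%:R) <= 2 * Num.min a%:R b%:R.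
  have a1 : alpha ^+ 2 <= 1 by rewrite expr_le1 // ltW.
  have A0 : 0 <= a%:R :> R by rewrite ler0n.
  have B0 : 0 <= b%:R :> R by rewrite ler0n.
  have A1 := ler_wpM2r A0 a1; have B1 := ler_wpM2r B0 a1.
  by rewrite minEle; case: ifP => _; lra.
have hcut : Num.min a%:R b%:R <= Num.sqrt a%:R * Num.sqrt b%:R :> R.
  have A0 : 0 <= a%:R :> R by rewrite ler0n.
  have B0 : 0 <= b%:R :> R by rewrite ler0n.
  rewrite -sqrtrM // minEle; case: ifP => ab.
    by rewrite -{1}(ger0_norm A0) -sqrtr_sqr ler_sqrt ?mulr_ge0 // expr2; apply: ler_wpM2l.
  have ba : b%:R <= a%:R :> R by rewrite leNgt; apply/negP => /ltW; rewrite ab.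
  by rewrite -{1}(ger0_norm B0) -sqrtr_sqr ler_sqrt ?mulr_ge0 // expr2; apply: ler_wpM2r.
set mn := Num.min _ _ in hmin hcut *.
have D0 : 0 <= D%:R :> R by rewrite ler0n.
have a0 := alpha_gt0.
have k1 : alpha ^+ 2 * (D%:R * mn) <= alpha ^+ 2 * (D%:R * (Num.sqrt a%:R * Num.sqrt b%:R)).
  by apply: ler_wpM2l; [exact: sqr_ge0|exact: ler_wpM2l].
have k2 : (D%:R * alpha ^+ 2) * (alpha ^+ 2 * (a%:R + b%:R)) <= (D%:R * alpha ^+ 2) * (2 * mn).
  by apply: ler_wpM2l => //; apply: mulr_ge0 => //; exact: sqr_ge0.
set X1 := alpha ^+ 2 * (D%:R * (Num.sqrt a%:R * Num.sqrt b%:R)) in k1 *.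
have -> : - (alpha / 8 * (alpha * D%:R * (Num.sqrt a%:R * Num.sqrt b%:R))) = - X1 / 8 by rewrite /X1; field.
have -> : (alpha / 8 * (alpha / 4) + 2 * (alpha / 8) ^+ 2) * (D%:R * mn) = alpha ^+ 2 * (D%:R * mn) / 16 by field.
have -> : - (D%:R * alpha ^+ 4 / 32) * (a%:R + b%:R) = - (D%:R * alpha ^+ 2 * (alpha ^+ 2 * (a%:R + b%:R))) / 32 by field.
lra.
Qed.

(** Union bound over weights, signs, starting points and words. The words for size k number at most
    D^(2k), so each size costs at most r^k; only sizes above [sigma] occur, and the 2 signs and 2
    #|X| starting points lead to a total of 4 #|W| #|X| r^sigma, at most a quarter. *)
Theorem random_cut : (0 < D)%N -> 0 <= r <= 1 / 2 ->
  D%:R ^+ 2 * expR (- (D%:R * alpha ^+ 4 / 32)) <= r ->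
  16 * #|W|%:R * #|X|%:R * r ^+ sigma <= 1 ->
  #|[set s : {ffun 'I_D * X -> 'I_m} | ~~ `[< forall w S,
       `|\sum_(e in edges phi S) om w (s e)| <=
         alpha * D%:R * Num.sqrt (#|side S true| * #|side S false|)%:R >] ]|%:R
  <= m%:R ^+ #|{: 'I_D * X}| / 4 :> R.
Proof.
move=> D0 rb hr htot.
pose x := expR (- (D%:R * alpha ^+ 4 / 32)) : R.
pose n := #|{: bool * X}|.
pose P w sg v0 (k : 'I_n.+1) (t : (k.-1).*2.-tuple 'I_D) (s : {ffun 'I_D * X -> 'I_m}) :=
  let C := visited (flip phi_inj) v0 t in
  [&& #|C| == k, (sigma < k)%N, alpha ^+ 2 * #|side C true|%:R <= #|side C false|%:R,
     alpha ^+ 2 * #|side C false|%:R <= #|side C true|%:R & event C w sg s].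
pose G s : R := \sum_w \sum_sg \sum_v0 \sum_k \sum_t (@P w sg v0 k t s)%:R.
have G0 s : 0 <= G s.
  by apply: sumr_ge0 => w _; apply: sumr_ge0 => sg _; apply: sumr_ge0 => v0 _;
    apply: sumr_ge0 => k _; apply: sumr_ge0 => t _; exact: ler0n.
apply: (@le_trans _ _ (\sum_s G s)).
  apply: card_le_sum => // s /asboolPn /existsNP [w /existsNP [S /negP viol]].
  have : ~ (forall C v0 w', C = visited (flip phi_inj) v0 w' -> size w' = (#|C|.-1).*2 ->
     `|\sum_(e in edges phi C) c s w e| <= alpha * D%:R * cut C).
    move=> h; move/negP: viol; apply.
    by apply: (cut_bound_of_walks (phi_inj := phi_inj)) => //; apply: mulr_ge0; [exact: ltW|exact: ler0n].
  move=> /existsNP [C /existsNP [v0 /existsNP [w' /not_implyP [eC /not_implyP [sw /negP]]]]].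
  rewrite -ltNge => big.
  have : ~~ ((#|C| <= sigma)%N || ~~ ((alpha ^+ 2 * #|side C true|%:R <= #|side C false|%:R)
      && (alpha ^+ 2 * #|side C false|%:R <= #|side C true|%:R))).
    by apply/negP => /(cut_bound_sparse s w); rewrite leNgt big.
  rewrite negb_or negbK -ltnNge => /and3P[sC hab hba].
  have Cn : (#|C| < n.+1)%N by rewrite ltnS max_card.
  pose k := Ordinal Cn.
  have tsz : size w' == (k.-1).*2 by rewrite sw.
  pose sg := \sum_(e in edges phi C) c s w e < 0.
  apply: (@sum_indicator_ge1 _ _ _ w); first by move=> ?; do 4![apply: sumr_ge0 => ? _].
  apply: (@sum_indicator_ge1 _ _ _ sg); first by move=> ?; do 3![apply: sumr_ge0 => ? _].
  apply: (@sum_indicator_ge1 _ _ _ v0); first by move=> ?; do 2![apply: sumr_ge0 => ? _].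
  apply: (@sum_indicator_ge1 _ _ _ k); first by move=> ?; apply: sumr_ge0.
  apply: (@sum_indicator_ge1 _ _ _ (Tuple tsz)) => //.
  suff -> : @P w sg v0 k (Tuple tsz) s by [].
  rewrite /P /= -eC eqxx sC hab hba /=.
  rewrite /event -mulr_sumr; apply: ltW; apply: lt_le_trans big _.
  rewrite /sg; case: ltP => h; first by rewrite ltr0_norm // expr1 mulN1r.
  by rewrite expr0 mul1r ger0_norm.
have x0 : 0 <= x by exact: expR_ge0.
have M0 : 0 <= m%:R ^+ #|{: 'I_D * X}| :> R by apply: exprn_ge0; rewrite ler0n.
pose bnd (k : 'I_n.+1) : R := m%:R ^+ #|{: 'I_D * X}| * (if (sigma < k)%N then r ^+ k else 0).
have Pk w sg v0 k : \sum_s \sum_t (@P w sg v0 k t s)%:R <= bnd k.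
  rewrite exchange_big /= /bnd.
  case: ltnP => sk; last first.
    rewrite mulr0 big1 // => t _; rewrite big1 // => s _.
    by rewrite /P (ltnNge sigma) sk /= andbF.
  apply: (@le_trans _ _ (\sum_(t : (k.-1).*2.-tuple 'I_D) m%:R ^+ #|{: 'I_D * X}| * x ^+ k)).
    apply: ler_sum => t _; set C := visited (flip phi_inj) v0 t.
    have [h|h] := boolP [&& #|C| == k, alpha ^+ 2 * #|side C true|%:R <= #|side C false|%:R &
       alpha ^+ 2 * #|side C false|%:R <= #|side C true|%:R].
      case/and3P: h => /eqP hk hab hba.
      apply: (@le_trans _ _ #|[set s | event C w sg s]|%:R).
        rewrite -sum1_card natr_sum [leRHS]big_mkcond /=; apply: ler_sum => s _.
        rewrite inE /P -/C; case: (event C w sg s); rewrite ?andbF //= ?mulr0n //.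
        by case: (_ && _).
      by rewrite -hk; exact: event_count.
    rewrite big1; first by apply: mulr_ge0 => //; exact: exprn_ge0.
    move=> s _; rewrite /P -/C; apply/eqP; rewrite pnatr_eq0 eqb0; apply: contra h.
    by case/and5P => -> _ -> -> _.
  rewrite sumr_const card_tuple card_ord -[_ *+ (D ^ _)]mulr_natl mulrCA.
  apply: ler_wpM2l => //; rewrite natrX.
  have D1 : 1 <= D%:R :> R by rewrite ler1n.
  apply: (@le_trans _ _ ((D%:R ^+ 2) ^+ k * x ^+ k)).
    apply: ler_wpM2r; first exact: exprn_ge0.
    rewrite -exprM; apply: ler_weXn2l => //; rewrite mul2n leq_double; exact: leq_pred.
  rewrite -exprMn; apply: lerXn2r => //; rewrite nnegrE ?mulr_ge0 ?exprn_ge0 //.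
  by case/andP: rb.
rewrite /G exchange_big /=.
apply: (@le_trans _ _ (\sum_(w : W) \sum_(sg : bool) \sum_(v0 : bool * X) \sum_(k < n.+1) bnd k)).
  apply: ler_sum => w _; rewrite exchange_big; apply: ler_sum => sg _.
  rewrite exchange_big; apply: ler_sum => v0 _.
  by rewrite exchange_big; apply: ler_sum => k _; exact: Pk.
have tail : \sum_(k < n.+1) bnd k <= m%:R ^+ #|{: 'I_D * X}| * r ^+ sigma.
  by rewrite -mulr_sumr; apply: ler_wpM2l => //; exact: geometric_tail.
have c1 : #|{: bool * X}| = (2 * #|X|)%N by rewrite card_prod card_bool.
have E (Y : R) : \sum_(w : W) \sum_(sg : bool) \sum_(v0 : bool * X) Y =
    (2 * #|X|%:R) * (2 * #|W|%:R) * Y.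
  rewrite !sumr_const -!mulrnA -[LHS]mulr_natl; congr (_ * _).
  rewrite -!natrM; congr (_%:R).
  transitivity (#|{: bool * X}| * (#|{: bool}| * #|W|))%N; first by [].
  by rewrite c1 card_bool.
rewrite E.
have Q0 : 0 <= (2 * #|X|%:R) * (2 * #|W|%:R) :> R by rewrite !mulr_ge0 ?ler0n.
apply: le_trans (ler_wpM2l Q0 tail) _.
have := ler_wpM2l M0 htot; lra.
Qed.

End RandomCut.

(** * Pairs as leading and trailing digits, and lifts of maps *)

Section Digits.
Local Open Scope nat_scope.
Variables (N n : nat).

Lemma hi_subproof (y : 'I_(N * n)) : y %/ n < N.
Proof. by rewrite ltn_divLR ?ltn_ord //; case: n y => [|//] [y]; rewrite muln0. Qed.
Lemma lo_subproof (y : 'I_(N * n)) : y %% n < n.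
Proof. by rewrite ltn_mod; case: n y => [|//] [y]; rewrite muln0. Qed.
Lemma join_subproof (x : 'I_N) (v : 'I_n) : x * n + v < N * n.
Proof.
apply: (@leq_trans (x * n + n)); first by rewrite ltn_add2l.
by rewrite -mulSnr leq_mul2r ltn_ord orbT.
Qed.
(* A point of ['I_(N * n)] is a pair (x, v) in lexicographic order, [x] being the
   leading digit. *)
Definition hdig y : 'I_N := Ordinal (hi_subproof y).
Definition ldig y : 'I_n := Ordinal (lo_subproof y).
Definition join x v : 'I_(N * n) := Ordinal (join_subproof x v).

Lemma hi_join x v : hdig (join x v) = x.
Proof.
have n0 : 0 < n by apply: leq_ltn_trans (ltn_ord v).
by apply/val_inj; rewrite /= divnMDl // divn_small ?addn0.
Qed.
Lemma lo_join x v : ldig (join x v) = v.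
Proof. by apply/val_inj; rewrite /= modnMDl modn_small. Qed.
Lemma join_hi_lo y : join (hdig y) (ldig y) = y.
Proof. by apply/val_inj; rewrite /= -divn_eq. Qed.
Lemma join_inj x v x' v' : join x v = join x' v' -> x = x' /\ v = v'.
Proof. by move=> e; have := congr1 hdig e; have := congr1 ldig e; rewrite !hi_join !lo_join. Qed.

Lemma big_join (T : Type) (idx : T) (op : Monoid.com_law idx) (F : 'I_(N * n) -> T) :
  \big[op/idx]_y F y = \big[op/idx]_x \big[op/idx]_v F (join x v).
Proof.
rewrite pair_bigA /= (reindex (fun p : 'I_N * 'I_n => join p.1 p.2)) //=.
exists (fun y => (hdig y, ldig y)) => [[x v] _|y _] /=; last exact: join_hi_lo.
by rewrite hi_join lo_join.
Qed.

Lemma sumn_join (F : 'I_(N * n) -> nat) : \sum_y F y = \sum_x \sum_v F (join x v).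
Proof. exact: big_join. Qed.

Lemma sumr_join (R : nmodType) (F : 'I_(N * n) -> R) :
  (\sum_y F y = \sum_x \sum_v F (join x v))%R.
Proof. exact: big_join. Qed.

Lemma shift_subproof (v : 'I_n) d : (v + d) %% n < n.
Proof. by rewrite ltn_mod; apply: leq_ltn_trans (ltn_ord v). Qed.
Definition shift d v : 'I_n := Ordinal (shift_subproof v d).

Lemma shift_inj d : injective (shift d).
Proof.
move=> u v /(congr1 val) /= /eqP; rewrite eqn_modDr !modn_small // => /eqP.
exact: val_inj.
Qed.

Variables (D m : nat) (phi : 'I_D -> 'I_N -> 'I_N).
Definition lift_map (s : 'I_D * 'I_N -> 'I_m) (i : 'I_D) (y : 'I_(N * n)) :=
  join (phi i (hdig y)) (shift (s (i, hdig y)) (ldig y)).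

Lemma lift_map_join s i x v : lift_map s i (join x v) = join (phi i x) (shift (s (i, x)) v).
Proof. by rewrite /lift_map hi_join lo_join. Qed.

Lemma lift_map_inj s i : injective (phi i) -> injective (lift_map s i).
Proof.
move=> phi_inj y z; rewrite -(join_hi_lo y) -(join_hi_lo z) !lift_map_join.
by move=> /join_inj [/phi_inj -> /shift_inj ->].
Qed.

End Digits.

(** * Where a dense set of a lifted graph must come from *)

Section Sparse.
Local Open Scope nat_scope.

Definition sparse_upto D (X : finType) (phi : 'I_D -> X -> X) (B sigma : nat) :=
  forall S : {set X}, #|S| <= sigma ->
  #|[set e : 'I_D * X | (e.2 \in S) && (phi e.1 e.2 \in S)]| <= B * #|S|.

Lemma sum_ltn_ord M k : \sum_(t < M) (t < k : nat) = minn M k.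
Proof. by elim: M => [|M IH]; rewrite ?big_ord0 ?min0n // big_ord_recr /= IH; lia. Qed.

Variables (N n D m B sigma : nat) (phi : 'I_D -> 'I_N -> 'I_N).
Hypothesis phi_inj : forall i, injective (phi i).
Hypothesis phi_sparse : sparse_upto phi B sigma.

Definition base (S : {set 'I_(N * n)}) : {set 'I_N} := [set hdig y | y in S].

Definition hit (S : {set 'I_(N * n)}) (e : 'I_D * 'I_N) (d : nat) :=
  [exists v : 'I_n, (join e.2 v \in S) && (join (phi e.1 e.2) (shift d v) \in S)].

Definition hits (S : {set 'I_(N * n)}) (s : 'I_D * 'I_N -> 'I_m) : {set 'I_D * 'I_N} :=
  [set e | hit S e (s e)].

(** Layer-cake argument. Let [w x] be the number of points of [S] above [x], and [U t] the set where
    it exceeds [t]. Above the edge (i, x) there are at most min (w x, w (phi i x)) edges inside [S],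
    so these are counted level by level. For positive [t], [U t] has at most half as many points as
    [S], and sparsity of [phi] applies; all the excess therefore sits at level 0, that is, in the
    base. *)
Lemma dense_lift (S : {set 'I_(N * n)}) (s : 'I_D * 'I_N -> 'I_m) :
  #|S| <= sigma.*2 ->
  B * #|S| < #|[set e : 'I_D * 'I_(N * n) | (e.2 \in S) && (lift_map phi s e.1 e.2 \in S)]| ->
  sigma < #|base S| /\ B * #|base S| < #|hits S s|.
Proof.
move=> S2 dense.
pose w x := #|[set v : 'I_n | join x v \in S]|.
pose U t := [set x | t < w x].
have w_le x : w x <= #|S|.
  rewrite /w -(card_imset (f := join x)); last by move=> u v /join_inj [].
  by apply: subset_leq_card; apply/subsetP => _ /imsetP[v + ->]; rewrite inE.
have sumw : \sum_x w x = #|S|.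
  rewrite -[RHS]sum1_card [RHS]big_mkcond sumn_join; apply: eq_bigr => x _ /=.
  by rewrite /w -sum1_card big_mkcond; apply: eq_bigr => v _; rewrite inE.
have wsum x : w x = \sum_(t < #|S|) (t < w x).
  by rewrite sum_ltn_ord; apply/esym/minn_idPr.
have baseE : base S = U 0.
  apply/setP => x; rewrite inE; apply/imsetP/card_gt0P => [[y yS ->]|[v]].
    by exists (ldig y); rewrite inE join_hi_lo.
  by rewrite inE => h; exists (join x v); rewrite ?hi_join.
have sumU : \sum_(t < #|S|) #|U t| = #|S|.
  rewrite -[RHS]sumw (eq_bigr (fun t : 'I__ => \sum_x (t < w x))); last first.
    by move=> t _; rewrite -sum1_card big_mkcond; apply: eq_bigr => x _; rewrite inE.
  by rewrite exchange_big; apply: eq_bigr => x _; rewrite -wsum.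
have U_small (t : nat) : 0 < t -> #|U t| <= sigma.
  move=> t0; suff : 2 * #|U t| <= #|S| by lia.
  rewrite -sumw (bigID (mem (U t))) /= -[leqLHS]addn0; apply: leq_add => //.
  rewrite mulnC -sum_nat_const; apply: leq_sum => x; rewrite inE; lia.
pose mu i x := #|[set v : 'I_n | (join x v \in S) && (lift_map phi s i (join x v) \in S)]|.
have muE : #|[set e : 'I_D * 'I_(N * n) | (e.2 \in S) && (lift_map phi s e.1 e.2 \in S)]| =
    \sum_(e : 'I_D * 'I_N) mu e.1 e.2.
  rewrite -sum1_card big_mkcond /= -(pair_bigA _ (fun i x => mu i x)) /=.
  rewrite (eq_bigr (fun e : 'I_D * 'I_(N * n) =>
     (fun i y => ((y \in S) && (lift_map phi s i y \in S) : nat)) e.1 e.2)); last first.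
    by move=> e _; rewrite inE; case: ifP.
  rewrite -(pair_bigA _ (fun i y => ((y \in S) && (lift_map phi s i y \in S) : nat))) /=.
  apply: eq_bigr => i _; rewrite [LHS]sumn_join. apply: eq_bigr => x _.
  by rewrite /mu -sum1_card [RHS]big_mkcond; apply: eq_bigr => v _; rewrite inE; case: ifP.
have mu_le e : mu e.1 e.2 <= \sum_(t < #|S|) [&& t < w e.2, t < w (phi e.1 e.2) & e \in hits S s].
  case: e => i x /=; case: (boolP ((i, x) \in hits S s)) => [h|]; last first.
    rewrite inE => /existsPn h; rewrite [mu _ _]eq_card0 // => v; rewrite !inE.
    by rewrite lift_map_join; apply/negbTE; exact: h.
  have l1 : mu i x <= w x.
    by apply: subset_leq_card; apply/subsetP => v; rewrite !inE => /andP[].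
  have l2 : mu i x <= w (phi i x).
    rewrite /mu -(card_imset (f := shift (s (i, x)))); last exact: shift_inj.
    apply: subset_leq_card; apply/subsetP => _ /imsetP[v + ->].
    by rewrite !inE lift_map_join => /andP[].
  have [l|l] := leqP (w x) (w (phi i x)).
    apply: leq_trans l1 _; rewrite {1}wsum; apply: leq_sum => t _.
    by case: ltnP => // h1; rewrite (leq_trans h1 l).
  apply: leq_trans l2 _; rewrite {1}wsum; apply: leq_sum => t _.
  by case: (ltnP t (w (phi i x))) => h1; rewrite ?andbF // (ltn_trans h1 l).
have level (t : nat) : \sum_e ([&& t < w e.2, t < w (phi e.1 e.2) & e \in hits S s] : nat)
    <= #|[set e : 'I_D * 'I_N | (e.2 \in U t) && (phi e.1 e.2 \in U t)]|.
  rewrite -sum1_card [leqRHS]big_mkcond; apply: leq_sum => e _; rewrite !inE.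
  by case: (t < w e.2); case: (t < w (phi e.1 e.2)); case: (hit S e (s e)).
have level0 : \sum_e ([&& 0 < w e.2, 0 < w (phi e.1 e.2) & e \in hits S s] : nat)
    <= #|hits S s|.
  rewrite -sum1_card [leqRHS]big_mkcond; apply: leq_sum => e _.
  by case: (0 < w e.2); case: (0 < w (phi e.1 e.2)); case: (e \in hits S s).
have upper : #|[set e : 'I_D * 'I_(N * n) | (e.2 \in S) && (lift_map phi s e.1 e.2 \in S)]|
   <= \sum_(t < #|S|) \sum_e ([&& t < w e.2, t < w (phi e.1 e.2) & e \in hits S s] : nat).
  by rewrite muE exchange_big; apply: leq_sum => e _; exact: mu_le.
have higher (t : nat) : 0 < t ->
   \sum_e ([&& t < w e.2, t < w (phi e.1 e.2) & e \in hits S s] : nat) <= B * #|U t|.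
  move=> t0; apply: leq_trans (level t) _; exact/phi_sparse/U_small.
rewrite baseE.
have S0 : 0 < #|S|.
  rewrite lt0n; apply/eqP => S0; move: dense; rewrite muE S0 muln0.
  rewrite big1 // => e _; have := mu_le e; rewrite S0 big_ord0; lia.
have [k Sk] : exists k, #|S| = k.+1 by exists #|S|.-1; rewrite prednK.
have lt1 : B * #|S| < \sum_e ([&& 0 < w e.2, 0 < w (phi e.1 e.2) & e \in hits S s] : nat)
      + \sum_(t < k) B * #|U t.+1|.
  apply: leq_trans dense _; apply: leq_trans upper _.
  rewrite Sk big_ord_recl leq_add2l; apply: leq_sum => t _; exact: higher.
have eqU : #|S| = #|U 0| + \sum_(t < k) #|U t.+1| by rewrite -[LHS]sumU Sk big_ord_recl.
move: lt1; rewrite {1}eqU mulnDr big_distrr /= ltn_add2r => lt1.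
split; last exact: leq_trans lt1 level0.
rewrite ltnNge; apply/negP => U0s.
have := leq_trans lt1 (leq_trans (level 0) (phi_sparse U0s)).
by rewrite ltnn.
Qed.

End Sparse.

(** * A random lift doubles the range of sparsity *)

Section RandomSparse.
Local Open Scope nat_scope.
Variables (R : realType) (N n D m B sigma K : nat) (phi : 'I_D -> 'I_N -> 'I_N).
Hypothesis phi_inj : forall i, injective (phi i).
Hypothesis phi_sparse : sparse_upto phi B sigma.
Hypothesis m_le_n : m <= n.
Hypothesis K_gt0 : 0 < K.
Hypothesis K_m : (2 * sigma) ^ 2 * K <= m.

(** Since [m <= n], two points of [S] above the ends of [e] determine the translation. *)
Lemma card_hit (S : {set 'I_(N * n)}) e :
  #|[set d : 'I_m | hit phi S e d]| <= #|S| ^ 2.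
Proof.
apply: (@leq_trans (\sum_(d < m) \sum_(v < n)
    ((join e.2 v \in S) && (join (phi e.1 e.2) (shift d v) \in S)))).
  rewrite -sum1_card big_mkcond; apply: leq_sum => d _; rewrite inE.
  case: ifP => // /existsP [v hv]; by rewrite (bigD1 v) //= hv.
rewrite exchange_big /=.
have inner (v : 'I_n) x : \sum_(d < m) (join x (shift d v) \in S) <= #|S|.
  have inj : injective (fun d : 'I_m => join x (shift d v)).
    move=> d d' /join_inj [_ /(congr1 val) /= /eqP].
    rewrite eqn_modDl !modn_small => [/eqP /val_inj //||]; exact: leq_trans (ltn_ord _) m_le_n.
  rewrite -[leqLHS](_ : #|[set d : 'I_m | join x (shift d v) \in S]| = _); last first.
    by rewrite -sum1_card big_mkcond; apply: eq_bigr => d _; rewrite inE; case: ifP.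
  rewrite -(card_imset _ inj); apply: subset_leq_card; apply/subsetP => _ /imsetP[d + ->].
  by rewrite inE.
apply: (@leq_trans (\sum_(v < n) (join e.2 v \in S) * #|S|)).
  apply: leq_sum => v _; case: (join e.2 v \in S) => /=; last by rewrite big1.
  by rewrite mul1n; exact: inner.
rewrite -big_distrl /= -mulnn leq_mul2r; apply/orP; right.
rewrite -[leqLHS](_ : #|[set v : 'I_n | join e.2 v \in S]| = _); last first.
  by rewrite -sum1_card big_mkcond; apply: eq_bigr => d _; rewrite inE; case: ifP.
rewrite -(card_imset (f := join e.2)); last by move=> u v /join_inj [].
by apply: subset_leq_card; apply/subsetP => _ /imsetP[v + ->]; rewrite inE.
Qed.

(** Markov's inequality for [K] to the number of hits. An edge that starts in the base is hit by at
    most m / K of the translations, so its factor has mean at most 2; any other edge is never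
    hit. *)
Lemma count_hits (S : {set 'I_(N * n)}) : #|S| <= 2 * sigma ->
  #|[set s : {ffun 'I_D * 'I_N -> 'I_m} | B * #|base S| < #|hits phi S s|]| * K ^ (B * #|base S|)
   <= m ^ #|{: 'I_D * 'I_N}| * 2 ^ (D * #|base S|).
Proof.
move=> S2; set u := #|base S|.
pose g e (j : 'I_m) := if hit phi S e j then K else 1.
apply: (@leq_trans (\sum_(s : {ffun 'I_D * 'I_N -> 'I_m}) \prod_e g e (s e))).
  rewrite -sum1_card big_distrl big_mkcond /=; apply: leq_sum => s _; rewrite inE.
  case: ifP => // h; rewrite mul1n /g -big_mkcond /= prod_nat_const.
  apply: leq_pexp2l => //; apply: ltnW; apply: leq_trans h _.
  by apply: subset_leq_card; apply/subsetP => e; rewrite inE.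
rewrite -bigA_distr_bigA /=.
apply: (@leq_trans (\prod_(e : 'I_D * 'I_N) (m * (if e.2 \in base S then 2 else 1)))).
  apply: leq_prod => e _.
  have split_g : \sum_j g e j <= m + #|[set d : 'I_m | hit phi S e d]| * K.
    rewrite -[X in X + _]card_ord -sum1_card -sum1_card big_distrl /=.
    rewrite [X in _ + X]big_mkcond /= -big_split /=; apply: leq_sum => j _.
    by rewrite inE /g; case: ifP => _; lia.
  case: ifP => [_|/negP eb].
    apply: leq_trans split_g _.
    have : #|[set d : 'I_m | hit phi S e d]| * K <= m.
      apply: leq_trans K_m; rewrite leq_mul2r; apply/orP; right.
      apply: leq_trans (card_hit S e) _; by rewrite leq_exp2r.
    lia.
  rewrite muln1 -[leqRHS]card_ord -sum1_card; apply: leq_sum => j _.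
  rewrite /g; case: ifP => // /existsP [v /andP[h _]]; case: eb.
  by apply/imsetP; exists (join e.2 v); rewrite ?hi_join.
rewrite big_split /= prod_nat_const; apply: leq_mul => //.
rewrite -big_mkcond /= prod_nat_const; apply: leq_pexp2l => //.
have -> : D * u = #|setX [set: 'I_D] (base S)| by rewrite cardsX cardsT card_ord.
by apply: subset_leq_card; apply/subsetP => -[i x]; rewrite !inE.
Qed.

(** By [dense_lift] a bad set has a base of size u above [sigma], hence fewer than 2 u points, and
    is the image of one of the (N n)^(2u) functions [h]. The hypothesis leaves at most 64^(-u) for
    each u. *)
Theorem random_sparse : 64 * ((N * n) ^ 2 * 2 ^ D) <= K ^ B ->
  (#|[set s : {ffun 'I_D * 'I_N -> 'I_m} |
     ~~ `[< sparse_upto (@lift_map N n D m phi s) B sigma.*2 >] ]|%:R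
  <= m%:R ^+ #|{: 'I_D * 'I_N}| / 4 :> R)%R.
Proof.
move=> KB.
pose P (u : 'I_(sigma.*2.+1)) (h : {ffun 'I_(u.*2) -> 'I_(N * n)}) (s : {ffun 'I_D * 'I_N -> 'I_m}) :=
  let S := [set h j | j in 'I_(u.*2)] in
  [&& sigma < u, #|S| <= 2 * sigma, #|base S| == u & B * #|base S| < #|hits phi S s|].
pose G s : R := (\sum_u \sum_h (@P u h s)%:R)%R.
apply: (@le_trans _ _ (\sum_s G s)%R).
  apply: card_le_sum => [s|s /asboolPn]; first by apply: sumr_ge0 => u _; apply: sumr_ge0 => h _; rewrite ler0n.
  move=> /existsNP [S /not_implyP [S2 /negP]]; rewrite -ltnNge => dense.
  have [su hu] := dense_lift phi_sparse S2 dense.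
  have uS : #|base S| <= #|S| by exact: leq_imset_card.
  have ub : #|base S| < sigma.*2.+1 by lia.
  have S0 : 0 < #|S| by lia.
  have [y0 y0S] : exists y0, y0 \in S by apply/card_gt0P.
  pose u := Ordinal ub.
  (* The default value [y0], itself in [S], pads the enumeration of [S] to length 2 u. *)
  pose h : {ffun 'I_(u.*2) -> 'I_(N * n)} := [ffun j : 'I_(u.*2) => nth y0 (enum S) j].
  have hS : [set h j | j in 'I_(u.*2)] = S.
    apply/setP => y; apply/imsetP/idP => [[j _ ->]|yS].
      rewrite ffunE; have [js|js] := ltnP j (size (enum S)); last by rewrite nth_default.
      by rewrite -mem_enum mem_nth.
    have yE : y \in enum S by rewrite mem_enum.
    have iu : index y (enum S) < u.*2.
      apply: (@leq_trans #|S|); first by rewrite cardE index_mem.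
      by apply: leq_trans S2 _; rewrite leq_double; exact: ltnW.
    by exists (Ordinal iu); rewrite // ffunE /= nth_index.
  apply: (@sum_indicator_ge1 _ _ _ u); first by move=> ?; apply: sumr_ge0 => ? _; rewrite ler0n.
  apply: (@sum_indicator_ge1 _ _ _ h); first by move=> ?; rewrite ler0n.
  suff -> : P u h s by [].
  by rewrite /P hS /= su hu eqxx mul2n S2.
rewrite exchange_big /=.
have M0 : (0 <= m%:R ^+ #|{: 'I_D * 'I_N}| :> R)%R by apply: exprn_ge0; rewrite ler0n.
apply: (@le_trans _ _ (\sum_(u < sigma.*2.+1) m%:R ^+ #|{: 'I_D * 'I_N}| *
    (if (0 < u)%N then (1 / 8 * (1 / 8) ^+ u) else 0))%R).
  apply: ler_sum => u _; rewrite exchange_big /=.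
  case: (posnP u) => u0.
    rewrite mulr0 big1 // => h _; rewrite big1 // => s _.
    have E : (sigma < u) = false by rewrite u0.
    by rewrite /P E.
  apply: (@le_trans _ _ (\sum_(h : {ffun 'I_(u.*2) -> 'I_(N * n)})
      m%:R ^+ #|{: 'I_D * 'I_N}| / (64 ^ u * (N * n) ^ u.*2)%:R)%R).
    apply: ler_sum => h _; set S := [set h j | j in 'I_(u.*2)].
    have NN : 0 < N * n by apply: leq_ltn_trans (ltn_ord (h (Ordinal (_ : 0 < u.*2)))); lia.
    have den : (0 < (64 ^ u * (N * n) ^ u.*2)%:R :> R)%R.
      by rewrite ltr0n muln_gt0 !expn_gt0 NN.
    rewrite ler_pdivlMr //.
    have [/andP[S2 /eqP eu]|hS] := boolP ((#|S| <= 2 * sigma) && (#|base S| == u)); last first.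
      rewrite big1 ?mul0r // => s _; rewrite /P -/S.
      by move: hS; rewrite negb_and => /orP[/negbTE ->|/negbTE ->]; rewrite ?andbF.
    apply: (@le_trans _ _ (#|[set s : {ffun 'I_D * 'I_N -> 'I_m} | (B * #|base S| < #|hits phi S s|)%N]|%:R
        * (64 ^ u * (N * n) ^ u.*2)%:R)%R).
      apply: ler_wpM2r; first exact: ltW.
      rewrite -sum1_card natr_sum [leRHS]big_mkcond /=; apply: ler_sum => s _.
      rewrite inE /P -/S; case: (B * _ < _) => /=; rewrite ?andbF ?ler0n //.
      by rewrite ler_nat leq_b1.
    rewrite -natrX -natrM ler_nat.
    have := count_hits S2; rewrite eu; set cnt := #|_|.
    have p2 : 0 < 2 ^ (D * u) by rewrite expn_gt0.
    move=> hc; rewrite -(leq_pmul2r p2); apply: leq_trans hc.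
    rewrite -mulnA leq_mul2l; apply/orP; right.
    move: KB; rewrite -(leq_exp2r _ _ u0) => KB.
    rewrite (expnM K); apply: (leq_trans _ KB).
    by rewrite !expnMn -!expnM -(addnn u) !expnD !mulnA.
  rewrite sumr_const card_ffun !card_ord -[(_ *+ _)%R]mulr_natl mulrCA.
  apply: ler_wpM2l => //.
  have [NN|NN] := posnP ((N * n) ^ u.*2).
    by rewrite NN mul0r; apply: mulr_ge0; rewrite ?exprn_ge0 // divr_ge0.
  rewrite natrM invfM mulrCA divff ?mulr1; last by rewrite pnatr_eq0 -lt0n.
  have -> : ((64 ^ u)%N%:R = 8 ^+ u * 8 ^+ u :> R)%R.
    by rewrite natrX -exprMn; congr (_ ^+ _)%R; rewrite -natrM.
  rewrite invfM !mul1r -!exprVn; apply: ler_wpM2r; first by rewrite exprn_ge0 // invr_ge0.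
  case: (nat_of_ord u) u0 => // k _; rewrite exprS ler_piMr ?invr_ge0 //.
  by rewrite exprn_ile1 ?invr_ge0 // invf_le1 ?ler1n.
rewrite -mulr_sumr; apply: ler_wpM2l => //.
have := @geometric_tail R 0 (1 / 8)%R sigma.*2.+1.
have -> : (\sum_(k < sigma.*2.+1) (if (0 < k)%N then (1 / 8) * (1 / 8) ^+ k else 0))%R =
   ((1 / 8) * \sum_(k < sigma.*2.+1) (if (0 < k)%N then (1 / 8) ^+ k else 0))%R :> R.
  by rewrite mulr_sumr; apply: eq_bigr => k _; case: ifP; rewrite ?mulr0.
have h8 : ((0 : R) <= 1 / 8)%R /\ ((1 / 8 : R) <= 1 / 2)%R by split; lra.
case: h8 => h8 h2; rewrite expr0 h8 h2 => /(_ isT); lra.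
Qed.

End RandomSparse.

(** * Binary expansions *)

Section BinaryDigits.
Local Open Scope nat_scope.

Definition bit j k := odd (k %/ 2 ^ j).

Lemma binary_expansion J k : k < 2 ^ J -> \sum_(j < J) bit j k * 2 ^ j = k.
Proof.
elim: J k => [|J IH] k; first by rewrite big_ord0 expn0; case: k.
move=> kJ; rewrite big_ord_recl expn0 muln1 /bit expn0 divn1.
rewrite (eq_bigr (fun j : 'I_J => 2 * (bit j k./2 * 2 ^ j))); last first.
  by move=> j _; rewrite lift0 /bit expnS divnMA divn2; lia.
rewrite -big_distrr /= IH; first by rewrite mul2n odd_double_half.
by move: kJ; rewrite expnS; lia.
Qed.

Lemma sum_pow2_lt J k : \sum_(l < J) (if l < k then 2 ^ l else 0) <= 2 ^ k.
Proof.
suff: \sum_(l < J) (if l < k then 2 ^ l else 0) < 2 ^ (minn J k) + 1.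
  by rewrite addn1 ltnS => /leq_trans; apply; rewrite leq_exp2l // geq_minr.
suff: \sum_(l < J) (if l < k then 2 ^ l else 0) < 2 ^ (minn J k) by lia.
elim: J => [|J IH]; first by rewrite big_ord0 min0n.
rewrite big_ord_recr /=; have [Jk|kJ] := ltnP J k.
  have E1 : minn J.+1 k = J.+1 by apply/minn_idPl.
  have E2 : minn J k = J by apply/minn_idPl/ltnW.
  by move: IH; rewrite E1 E2 expnS mul2n -addnn ltn_add2r.
have E1 : minn J.+1 k = k by apply/minn_idPr/leqW.
have E2 : minn J k = k by apply/minn_idPr.
by move: IH; rewrite E1 E2 addn0.
Qed.

End BinaryDigits.

(** * From cut bounds to bilinear forms *)

Section Norm.
Local Open Scope ring_scope.
Variable R : realType.
Variables (D : nat) (X : finType) (phi : 'I_D -> X -> X).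
Hypothesis phi_inj : forall i, injective (phi i).
Variables (c : 'I_D * X -> R) (alpha : R).
Hypothesis c_le1 : forall e, `|c e| <= 1.
Hypothesis alpha_small : 0 <= alpha <= 1 / 512.
Hypothesis cut_small : forall S : {set bool * X}, `|\sum_(e in edges phi S) c e| <=
  alpha * D%:R * Num.sqrt (#|side S true| * #|side S false|)%:R.

Let form (f g : X -> R) := \sum_e c e * f (phi e.1 e.2) * g e.2.

Let pairset (A B : {set X}) : {set bool * X} := [set p | if p.1 then p.2 \in A else p.2 \in B].

Lemma form_indicators (A B : {set X}) :
  form (fun x => (x \in A)%:R) (fun x => (x \in B)%:R) = \sum_(e in edges phi (pairset A B)) c e.
Proof.
rewrite /form [RHS]big_mkcond; apply: eq_bigr => e _; rewrite !inE /= andbC.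
by case: (_ \in A); case: (_ \in B); rewrite ?mulr0 ?mul0r ?mulr1.
Qed.

Lemma side_pairset A B b : side (pairset A B) b = if b then A else B.
Proof. by apply/setP => x; rewrite !inE /=; case: b. Qed.

(* Digits [j] and [l] at distance at most 6 are compared by the cut bound, distant
   ones by the degree bound D min(#|A|, #|B|), which suffices because of the weights. *)
Lemma form_indicators_le (A B : {set X}) (j l : nat) :
  `|form (fun x => (x \in A)%:R) (fun x => (x \in B)%:R)| * (2 ^ j * 2 ^ l)%:R <=
  D%:R * ((4 ^ j * #|A|)%:R * (if (l < j - 6)%N then 2 ^+ l / 2 ^+ j
                               else if (j < l - 6)%N then 0 else alpha / 2) +
          (4 ^ l * #|B|)%:R * (if (j < l - 6)%N then 2 ^+ j / 2 ^+ l
                               else if (l < j - 6)%N then 0 else alpha / 2)).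
Proof.
have D0 : 0 <= D%:R :> R by rewrite ler0n.
have pow k : 0 < 2 ^+ k :> R by rewrite exprn_gt0.
have p4 k : (4 ^ k)%N%:R = 2 ^+ k * 2 ^+ k :> R by rewrite natrX -exprMn; congr (_ ^+ _); rewrite -natrM.
rewrite form_indicators; set F := `|_|.
have card_le : F <= #|edges phi (pairset A B)|%:R.
  apply: le_trans (ler_norm_sum _ _ _) _.
  by rewrite -sum1_card natr_sum; apply: ler_sum => e _; exact: c_le1.
have hA : F <= D%:R * #|A|%:R.
  apply: le_trans card_le _; rewrite -natrM ler_nat.
  by have := card_edges_r phi_inj (pairset A B); rewrite side_pairset.
have hB : F <= D%:R * #|B|%:R.
  apply: le_trans card_le _; rewrite -natrM ler_nat.
  by have := card_edges_l phi (pairset A B); rewrite side_pairset.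
rewrite !natrM !p4 !natrX.
have [lj|jl] := ltnP l (j - 6).
  have -> : (j < l - 6)%N = false by lia.
  rewrite mulr0 addr0.
  have -> : D%:R * (2 ^+ j * 2 ^+ j * #|A|%:R * (2 ^+ l / 2 ^+ j)) = D%:R * #|A|%:R * (2 ^+ j * 2 ^+ l) :> R.
    by field; rewrite gt_eqF.
  by apply: ler_wpM2r => //; apply: mulr_ge0; exact: ltW.
have [lj|lj] := ltnP j (l - 6).
  rewrite mulr0 add0r.
  have -> : D%:R * (2 ^+ l * 2 ^+ l * #|B|%:R * (2 ^+ j / 2 ^+ l)) = D%:R * #|B|%:R * (2 ^+ j * 2 ^+ l) :> R.
    by field; rewrite gt_eqF.
  by apply: ler_wpM2r => //; apply: mulr_ge0; exact: ltW.
have hcut : F <= alpha * D%:R * (Num.sqrt #|A|%:R * Num.sqrt #|B|%:R).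
  have := cut_small (pairset A B); rewrite !side_pairset natrM sqrtrM ?ler0n //.
have [sa sb] : Num.sqrt #|A|%:R ^+ 2 = #|A|%:R :> R /\ Num.sqrt #|B|%:R ^+ 2 = #|B|%:R :> R.
  by rewrite !sqr_sqrtr ?ler0n.
have pp : 0 <= 2 ^+ j * 2 ^+ l :> R by apply: mulr_ge0; exact: ltW.
apply: (le_trans (ler_wpM2r pp hcut)).
move: sa sb; move: (Num.sqrt #|A|%:R) (Num.sqrt #|B|%:R) => p q <- <-.
have -> : alpha * D%:R * (p * q) * (2 ^+ j * 2 ^+ l) = alpha * D%:R * ((2 ^+ j * p) * (2 ^+ l * q)) by ring.
have -> : D%:R * (2 ^+ j * 2 ^+ j * p ^+ 2 * (alpha / 2) + 2 ^+ l * 2 ^+ l * q ^+ 2 * (alpha / 2)) =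
   alpha * D%:R * (((2 ^+ j * p) ^+ 2 + (2 ^+ l * q) ^+ 2) / 2) by field.
apply: ler_wpM2l; first by apply: mulr_ge0 => //; case/andP: alpha_small.
have := sqr_ge0 (2 ^+ j * p - 2 ^+ l * q); lra.
Qed.

Let wt (j l : nat) : R := if (l < j - 6)%N then 2 ^+ l / 2 ^+ j
   else if (j < l - 6)%N then 0 else alpha / 2.

(** Digits more than 6 below [j] form a geometric series of sum at most 2^(-6). At most 13 digits
    are within distance 6, each of weight at most 1/1024. Both parts are thus at most 1/64. *)
Lemma sum_wt J (j : nat) : \sum_(l < J) wt j l <= 1 / 32.
Proof.
have [a0 a1] := andP alpha_small.
have h1 : \sum_(l < J) (if (l < j - 6)%N then 2 ^+ l / 2 ^+ j else 0) <= 1 / 64 :> R.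
  have [j6|j6] := leqP j 6.
    by rewrite big1 => [|l _]; [lra|case: ltnP => //; lia].
  have p : 0 < 2 ^+ j :> R by rewrite exprn_gt0.
  rewrite (eq_bigr (fun l : 'I_J => (if (l < j - 6)%N then 2 ^ l else 0)%N%:R / 2 ^+ j)); last first.
    by move=> l _; case: ifP; rewrite ?mul0r // natrX.
  rewrite -mulr_suml -natr_sum ler_pdivrMr //.
  apply: (@le_trans _ _ (2 ^ (j - 6))%N%:R); first by rewrite ler_nat sum_pow2_lt.
  have -> : 2 ^+ j = 2 ^+ (j - 6) * 64 :> R.
    by rewrite -{1}(subnK (ltnW j6)) exprD; congr (_ * _); rewrite -natrX.
  by rewrite natrX; lra.
have h2 : \sum_(l < J) (if (j - 6 <= l)%N && (l < j + 7)%N then alpha / 2 else 0) <= 13 * (alpha / 2).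
  rewrite (eq_bigr (fun l : 'I_J => ((l < j + 7) - (l < j - 6))%N%:R * (alpha / 2))); last first.
    move=> l _; rewrite (ltnNge l (j - 6)).
    by case: (j - 6 <= l)%N; case: (l < j + 7)%N; rewrite ?mul1r ?mul0r.
  rewrite -mulr_suml; apply: ler_wpM2r; first lra.
  rewrite -natr_sum ler_nat.
  suff : (\sum_(i < J) ((i < j + 7) - (i < j - 6)) + \sum_(i < J) (i < j - 6 : nat) = minn J (j + 7))%N.
    rewrite sum_ltn_ord; move: (\sum_(i < J) _)%N => S; rewrite /minn; case: ifP; case: ifP; lia.
  rewrite -sum_ltn_ord -big_split; apply: eq_bigr => i _ /=; apply: subnK.
  by case: (ltnP i (j - 6)) => // h; have -> : (i < j + 7)%N by lia.
apply: (@le_trans _ _ (1 / 64 + 13 * (alpha / 2))); last lra.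
apply: le_trans (lerD h1 h2); rewrite -big_split; apply: ler_sum => l _ /=; rewrite /wt.
case: (ltnP l (j - 6)) => [h|h] /=; first by rewrite addr0.
rewrite add0r; case: ltnP => h'; case: ltnP => h'' //; first lra.
lia.
Qed.

(** Binary digits turn [f] and [g] into weighted sums of indicators. Summing the weights over the
    other digit costs 1/32; what remains, the sum of 4^j times the size of the jth digit set, is at
    most the sum of squares, because cross terms of digits are nonnegative. *)
Lemma form_nat (f g : X -> nat) :
  `|form (fun x => (f x)%:R) (fun x => (g x)%:R)| <=
   D%:R / 32 * (\sum_x (f x)%:R ^+ 2 + \sum_x (g x)%:R ^+ 2).
Proof.
have [J Jf Jg] : exists2 J, (forall x, f x < 2 ^ J)%N & (forall x, g x < 2 ^ J)%N.
  exists (\sum_x (f x + g x))%N => x; apply: leq_ltn_trans (ltn_expl _ (ltnSn 1));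
    rewrite (bigD1 x) //=; lia.
pose A (h : X -> nat) j := [set x | bit j (h x)].
have expand h x : (h x < 2 ^ J)%N -> (h x)%:R = \sum_(j < J) (x \in A h j)%:R * (2 ^ j)%N%:R :> R.
  move=> hx; rewrite -{1}(binary_expansion hx) natr_sum; apply: eq_bigr => j _.
  by rewrite natrM inE.
have energy h : (forall x, h x < 2 ^ J)%N ->
    \sum_(j < J) (4 ^ j * #|A h j|)%:R <= \sum_x (h x)%:R ^+ 2 :> R.
  move=> hJ; rewrite (eq_bigr (fun j : 'I_J => \sum_x ((x \in A h j)%:R * (2 ^ j)%N%:R) ^+ 2)); last first.
    move=> j _; rewrite natrM -sum1_card natr_sum mulr_sumr big_mkcond; apply: eq_bigr => x _.
    case: ifP => hx; rewrite ?mul0r ?expr0n // mulr1 mul1r -natrX; congr (_%:R).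
    by rewrite -expnM mulnC expnM.
  rewrite exchange_big; apply: ler_sum => x _ /=; rewrite expand //.
  rewrite [leRHS]expr2 [leRHS]mulr_suml; apply: ler_sum => j _.
  have t0 (i : 'I_J) : 0 <= (x \in A h i)%:R * (2 ^ i)%N%:R :> R by rewrite -natrM ler0n.
  rewrite expr2; apply: ler_wpM2l => //.
  by rewrite (bigD1 j) //= lerDl; apply: sumr_ge0.
have -> : form (fun x => (f x)%:R) (fun x => (g x)%:R) =
   \sum_(j < J) \sum_(l < J) form (fun x => (x \in A f j)%:R) (fun x => (x \in A g l)%:R) * (2 ^ j * 2 ^ l)%:R.
  transitivity (\sum_e \sum_(j < J) \sum_(l < J) c e * (phi e.1 e.2 \in A f j)%:R * (e.2 \in A g l)%:R * (2 ^ j * 2 ^ l)%:R).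
    apply: eq_bigr => e _; rewrite !expand // -mulrA mulr_suml mulr_sumr; apply: eq_bigr => j _.
    by rewrite !mulr_sumr; apply: eq_bigr => l _; rewrite natrM; ring.
  rewrite exchange_big; apply: eq_bigr => j _; rewrite exchange_big; apply: eq_bigr => l _.
  by rewrite /form mulr_suml.
apply: le_trans (ler_norm_sum _ _ _) _.
apply: (@le_trans _ _ (\sum_(j < J) \sum_(l < J) D%:R * ((4 ^ j * #|A f j|)%:R * wt j l + (4 ^ l * #|A g l|)%:R * wt l j))).
  apply: ler_sum => j _; apply: le_trans (ler_norm_sum _ _ _) _; apply: ler_sum => l _.
  by rewrite normrM (ger0_norm (ler0n _ _)); exact: form_indicators_le.
have -> : \sum_(j < J) \sum_(l < J) D%:R * ((4 ^ j * #|A f j|)%:R * wt j l + (4 ^ l * #|A g l|)%:R * wt l j) =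
   D%:R * (\sum_(j < J) (4 ^ j * #|A f j|)%:R * \sum_(l < J) wt j l +
           \sum_(l < J) (4 ^ l * #|A g l|)%:R * \sum_(j < J) wt l j).
  rewrite mulrDr !mulr_sumr.
  rewrite [X in _ = _ + X](eq_bigr (fun l : 'I_J => \sum_(j < J) D%:R * ((4 ^ l * #|A g l|)%:R * wt l j))); last first.
    by move=> l _; rewrite !mulr_sumr.
  rewrite [X in _ = _ + X]exchange_big -big_split; apply: eq_bigr => j _ /=.
  by rewrite !mulr_sumr -big_split; apply: eq_bigr => l _ /=; rewrite mulrDr.
rewrite -mulrA; apply: ler_wpM2l; first exact: ler0n.
rewrite mulrDr; apply: lerD.
  apply: (@le_trans _ _ (\sum_(j < J) (4 ^ j * #|A f j|)%:R * (1 / 32))).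
    by apply: ler_sum => j _; apply: ler_wpM2l; rewrite ?ler0n ?sum_wt.
  by rewrite -mulr_suml mulrC mul1r; apply: ler_wpM2l; [rewrite invr_ge0|exact: energy].
apply: (@le_trans _ _ (\sum_(j < J) (4 ^ j * #|A g j|)%:R * (1 / 32))).
  by apply: ler_sum => j _; apply: ler_wpM2l; rewrite ?ler0n ?sum_wt.
by rewrite -mulr_suml mulrC mul1r; apply: ler_wpM2l; [rewrite invr_ge0|exact: energy].
Qed.

(** The functions K f and K g are rounded down to integers. The rounding error is linear in K and
    the forms are quadratic, so it disappears for large K. *)
Lemma form_nonneg (f g : X -> R) : (forall x, 0 <= f x) -> (forall x, 0 <= g x) ->
  `|form f g| <= D%:R / 32 * (\sum_x f x ^+ 2 + \sum_x g x ^+ 2).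
Proof.
move=> f0 g0; set T := leRHS.
pose M := \sum_(e : 'I_D * X) (f (phi e.1 e.2) + g e.2).
have M0 : 0 <= M by apply: sumr_ge0 => e _; rewrite addr_ge0.
suff step (K : nat) : (0 < K)%N -> `|form f g| <= T + M / K%:R.
  apply/ler_addgt0Pr => e e0.
  have [K hK] : exists K : nat, M / e < K%:R.
    by exists (Num.bound (M / e)); apply: archi_boundP; apply: divr_ge0 => //; exact: ltW.
  have K0 : 0 < K%:R :> R by apply: le_lt_trans hK; apply: divr_ge0 => //; exact: ltW.
  apply: le_trans (step K _) _; first by rewrite -(ltr0n R).
  rewrite lerD2l ler_pdivrMr // mulrC -ler_pdivrMr //; exact: ltW.
move=> K0; have Kr : 0 < K%:R :> R by rewrite ltr0n.
pose fl (h : X -> R) x := Num.truncn (K%:R * h x).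
have flP h x : 0 <= h x -> (fl h x)%:R <= K%:R * h x /\ K%:R * h x <= (fl h x)%:R + 1.
  move=> h0; have /truncn_itv /andP[a b] : 0 <= K%:R * h x by apply: mulr_ge0 => //; exact: ltW.
  by split=> //; apply: ltW; rewrite natr1.
have fl_sq h : (forall x, 0 <= h x) -> \sum_x (fl h x)%:R ^+ 2 <= K%:R ^+ 2 * \sum_x h x ^+ 2 :> R.
  move=> h0; rewrite mulr_sumr; apply: ler_sum => x _; rewrite -exprMn.
  have [a _] := flP _ _ (h0 x).
  by apply: lerXn2r => //; rewrite nnegrE ?ler0n //; apply: mulr_ge0 => //; exact: ltW.
have main := form_nat (fl f) (fl g).
have D0 : 0 <= D%:R / 32 :> R by apply: divr_ge0; rewrite ?ler0n.
have main2 : `|form (fun x => (fl f x)%:R) (fun x => (fl g x)%:R)| <= K%:R ^+ 2 * T.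
  apply: le_trans main _; rewrite /T mulrCA; apply: ler_wpM2l => //.
  by rewrite mulrDr; apply: lerD; exact: fl_sq.
have diff : `|K%:R ^+ 2 * form f g - form (fun x => (fl f x)%:R) (fun x => (fl g x)%:R)| <= K%:R * M.
  rewrite /form mulr_sumr -sumrB /M mulr_sumr; apply: le_trans (ler_norm_sum _ _ _) _.
  apply: ler_sum => e _; have [a1 a2] := flP f (phi e.1 e.2) (f0 _); have [b1 b2] := flP g e.2 (g0 _).
  have -> : K%:R ^+ 2 * (c e * f (phi e.1 e.2) * g e.2) - c e * (fl f (phi e.1 e.2))%:R * (fl g e.2)%:R =
    c e * ((K%:R * f (phi e.1 e.2)) * (K%:R * g e.2) - (fl f (phi e.1 e.2))%:R * (fl g e.2)%:R) by ring.
  have fn : 0 <= (fl f (phi e.1 e.2))%:R :> R by rewrite ler0n.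
  have gn : 0 <= (fl g e.2)%:R :> R by rewrite ler0n.
  rewrite normrM mulrDr.
  apply: (@le_trans _ _ (1 * (K%:R * f (phi e.1 e.2) + K%:R * g e.2))); last by rewrite mul1r.
  apply: ler_pM => //.
  set p := K%:R * f _ in a1 a2 *; set q := K%:R * g _ in b1 b2 *.
  set p' := (fl f _)%:R in a1 a2 fn *; set q' := (fl g _)%:R in b1 b2 gn *.
  have -> : p * q - p' * q' = (p - p') * q + p' * (q - q') by ring.
  have h1 : 0 <= (p - p') * q by apply: mulr_ge0; lra.
  have h2 : 0 <= p' * (q - q') by apply: mulr_ge0; lra.
  rewrite ger0_norm ?addr_ge0 // addrC; apply: lerD.
    by apply: (@le_trans _ _ (p' * 1)); [apply: ler_wpM2l; lra|lra].
  by apply: (@le_trans _ _ (1 * q)); [apply: ler_wpM2r; lra|lra].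
have K2 : 0 < K%:R ^+ 2 :> R by rewrite exprn_gt0.
rewrite -(ler_pM2l K2) mulrDr.
have -> : K%:R ^+ 2 * (M / K%:R) = K%:R * M by field; rewrite gt_eqF.
have -> : K%:R ^+ 2 * `|form f g| = `|K%:R ^+ 2 * form f g| by rewrite normrM (gtr0_norm K2).
apply: (@le_trans _ _ (`|form (fun x => (fl f x)%:R) (fun x => (fl g x)%:R)| +
   `|K%:R ^+ 2 * form f g - form (fun x => (fl f x)%:R) (fun x => (fl g x)%:R)|)).
  by apply: le_trans (ler_normD _ _); rewrite addrC subrK.
exact: lerD.
Qed.

Lemma positive_negative_parts (h : X -> R) : exists p n : X -> R,
  [/\ forall x, 0 <= p x, forall x, 0 <= n x, forall x, h x = p x - n x &
      \sum_x h x ^+ 2 = \sum_x p x ^+ 2 + \sum_x n x ^+ 2].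
Proof.
exists (fun x => Num.max (h x) 0), (fun x => Num.max (- h x) 0).
split=> [x|x|x|]; rewrite ?le_max ?lexx ?orbT //.
  by case: (leP (h x) 0) => h0; [rewrite max_l ?oppr_ge0 // sub0r opprK|
    rewrite max_r ?oppr_le0 ?ltW // subr0].
rewrite -big_split; apply: eq_bigr => x _ /=.
by case: (leP (h x) 0) => h0; [rewrite max_l ?oppr_ge0 // expr0n add0r sqrrN|
    rewrite max_r ?oppr_le0 ?ltW // expr0n addr0].
Qed.

(** Each positive or negative part occurs in two of the four forms, which turns 1/32 into 1/16. *)
Lemma form_real (f g : X -> R) :
  `|form f g| <= D%:R / 16 * (\sum_x f x ^+ 2 + \sum_x g x ^+ 2).
Proof.
have [p [n [p0 n0 fE sf]]] := positive_negative_parts f.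
have [q [k [q0 k0 gE sg]]] := positive_negative_parts g.
have -> : form f g = form p q - form p k - form n q + form n k.
  rewrite /form -!sumrB -big_split; apply: eq_bigr => e _ /=.
  by rewrite fE gE; ring.
rewrite sf sg.
have := form_nonneg p0 q0; have := form_nonneg p0 k0.
have := form_nonneg n0 q0; have := form_nonneg n0 k0.
move: (\sum_x p x ^+ 2) (\sum_x n x ^+ 2) (\sum_x q x ^+ 2) (\sum_x k x ^+ 2) => P N Q K.
move: (form p q) (form p k) (form n q) (form n k) => x1 x2 x3 x4.
rewrite !ler_norml => /andP[a1 a2] /andP[b1 b2] /andP[c1 c2] /andP[d1 d2].
by apply/andP; split; lra.
Qed.

End Norm.

(** * Fourier analysis on the cyclic group, in real coordinates *)

Section Trig.
Local Open Scope ring_scope.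
Variable R : realType.
Implicit Types (t x : R).

Definition csum t (M : nat) := \sum_(d < M) cos (d%:R * t).
Definition ssum t (M : nat) := \sum_(d < M) sin (d%:R * t).

(** Squared modulus of the geometric sum: the terms e^(i d t), d < M, add up to (1 - e^(i M t)) / (1
    - e^(i t)). Real and imaginary parts go through one induction. *)
Lemma csum_ssum_sq t M :
  (csum t M ^+ 2 + ssum t M ^+ 2) * (2 - 2 * cos t) = 2 - 2 * cos (M%:R * t).
Proof.
have [h1 h2] : csum t M * (1 - cos t) + ssum t M * sin t = 1 - cos (M%:R * t) /\
    ssum t M * (1 - cos t) - csum t M * sin t = - sin (M%:R * t).
  elim: M => [|M [IH1 IH2]].
    by rewrite /csum /ssum !big_ord0 !mul0r cos0 sin0 oppr0 !subrr add0r.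
  rewrite /csum /ssum !big_ord_recr /= -/(csum t M) -/(ssum t M).
  rewrite -[M.+1%:R]natr1 (mulrDl _ _ t) mul1r cosD sinD.
  move: IH1 IH2; move: (csum t M) (ssum t M) (cos t) (sin t) (cos (M%:R * t)) (sin (M%:R * t)) => C S c s cM sM h1 h2.
  split.
    have -> : (C + cM) * (1 - c) + (S + sM) * s = (C * (1 - c) + S * s) + cM * (1 - c) + sM * s by ring.
    by rewrite h1; ring.
  have -> : (S + sM) * (1 - c) - (C + cM) * s = (S * (1 - c) - C * s) + sM * (1 - c) - cM * s by ring.
  by rewrite h2; ring.
have e1 := cos2Dsin2 t; have e2 := cos2Dsin2 (M%:R * t).
move: h1 h2 e1 e2; move: (csum t M) (ssum t M) (cos t) (sin t) (cos (M%:R * t)) (sin (M%:R * t)) => C S c s cM sM h1 h2 e1 e2.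
have E : 2 - 2 * c = (1 - c) ^+ 2 + s ^+ 2.
  have -> : (1 - c) ^+ 2 + s ^+ 2 = 1 - 2 * c + (c ^+ 2 + s ^+ 2) by ring.
  by rewrite e1; ring.
have E' : 2 - 2 * cM = (1 - cM) ^+ 2 + sM ^+ 2.
  have -> : (1 - cM) ^+ 2 + sM ^+ 2 = 1 - 2 * cM + (cM ^+ 2 + sM ^+ 2) by ring.
  by rewrite e2; ring.
rewrite E E' -h1 -[sM ^+ 2]sqrrN -h2; ring.
Qed.

Lemma csum_ssum_le t M : csum t M ^+ 2 + ssum t M ^+ 2 <= M%:R ^+ 2.
Proof.
elim: M => [|M IH]; first by rewrite /csum /ssum !big_ord0 expr0n addr0.
rewrite /csum /ssum !big_ord_recr /= -/(csum t M) -/(ssum t M).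
have e := cos2Dsin2 (M%:R * t).
move: IH e; move: (csum t M) (ssum t M) (cos (M%:R * t)) (sin (M%:R * t)) => C S c s IH e.
rewrite -[M.+1%:R]natr1.
have -> : (C + c) ^+ 2 + (S + s) ^+ 2 = (C ^+ 2 + S ^+ 2) + 2 * (C * c + S * s) + (c ^+ 2 + s ^+ 2) by ring.
suff h : C * c + S * s <= M%:R.
  have -> : (M%:R + 1) ^+ 2 = M%:R ^+ 2 + 2 * M%:R + 1 :> R by ring.
  by rewrite e; lra.
apply: le_trans (ler_norm _) _; rewrite -ler_sqr ?nnegrE ?ler0n // real_normK ?num_real //.
apply: le_trans IH; have := sqr_ge0 (C * s - S * c).
have -> : C ^+ 2 + S ^+ 2 = (C ^+ 2 + S ^+ 2) * (c ^+ 2 + s ^+ 2) by rewrite e mulr1.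
move=> h; rewrite -subr_ge0; apply: le_trans h _; rewrite le_eqVlt; apply/orP; left; apply/eqP; ring.
Qed.

Lemma cos_period x (q : nat) : cos (x + pi *+ 2 *+ q) = cos x.
Proof.
by elim: q => [|q IH]; rewrite ?mulr0n ?addr0 // mulrSr addrA cosD cos2pi sin2pi mulr1 mulr0 subr0.
Qed.

Lemma sin_period x (q : nat) : sin (x + pi *+ 2 *+ q) = sin x.
Proof.
by elim: q => [|q IH]; rewrite ?mulr0n ?addr0 // mulrSr addrA sinD cos2pi sin2pi mulr1 mulr0 addr0.
Qed.

Lemma cos_multiple_2pi (q : nat) : cos (pi *+ 2 *+ q) = 1 :> R.
Proof. by rewrite -[_ *+ q]add0r cos_period cos0. Qed.

Variable n : nat.
Hypothesis n_gt0 : (0 < n)%N.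
Let nR : n%:R != 0 :> R. Proof. by rewrite pnatr_eq0 -lt0n. Qed.

Definition freq (k : nat) : R := pi *+ 2 * k%:R / n%:R.

Lemma cos_freq_lt1 j : (0 < j < n)%N -> cos (freq j) < 1.
Proof.
move=> /andP[j0 jn].
have -> : freq j = (pi * j%:R / n%:R) *+ 2 by rewrite /freq mulr2n; field.
rewrite cos_mulr2n -subr_gt0.
have p0 : 0 < pi * j%:R / n%:R :> R.
  by apply: divr_gt0; rewrite ?ltr0n // mulr_gt0 ?pi_gt0 // ltr0n.
have p1 : pi * j%:R / n%:R < pi :> R.
  by rewrite ltr_pdivrMr ?ltr0n // ltr_pM2l ?pi_gt0 // ltr_nat.
have s0 : 0 < sin (pi * j%:R / n%:R : R) by apply: sin_gt0_pi; rewrite p0 p1.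
have := cos2Dsin2 (pi * j%:R / n%:R : R); move: s0; move: (cos _) (sin _) => c s s0 e.
have s2 : 0 < s ^+ 2 by exact: exprn_gt0.
by move: e s2; rewrite mulr2n; move: (c ^+ 2) (s ^+ 2) => x y e; lra.
Qed.

Lemma csum_freq_orthogonal (u v : 'I_n) :
  \sum_(k < n) cos (k%:R * (freq u - freq v)) = (if u == v then n%:R else 0).
Proof.
case: eqP => [->|/eqP uv].
  by rewrite subrr (eq_bigr (fun=> 1)) ?sumr_const ?card_ord // => k _; rewrite mulr0 cos0.
have wlog_lt (a b : 'I_n) : (b < a)%N -> csum (freq a - freq b) n = 0.
  move=> ba; have e : freq a - freq b = freq (a - b).
    by rewrite /freq natrB ?(ltnW ba) //; field.
  have h := csum_ssum_sq (freq a - freq b) n.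
  have z : cos (n%:R * (freq a - freq b)) = 1.
    have -> : n%:R * (freq a - freq b) = pi *+ 2 *+ (a - b).
      by rewrite e /freq -[in RHS]mulr_natr; field.
    exact: cos_multiple_2pi.
  move: h; rewrite z mulr1 subrr => /eqP; rewrite mulf_eq0 => /orP[|].
    by rewrite paddr_eq0 ?sqr_ge0 // !sqrf_eq0 => /andP[/eqP].
  rewrite e => /eqP h; have := @cos_freq_lt1 (a - b); rewrite subn_gt0 ba /=.
  by have -> : (a - b < n)%N by [apply: leq_ltn_trans (leq_subr _ _) (ltn_ord a)]; move=> /(_ isT); lra.
have [vu|uv'|/val_inj e] := ltngtP v u.
- exact: wlog_lt.
- apply: etrans (wlog_lt v u _) => //; rewrite /csum; apply: eq_bigr => k _.
  by rewrite -[LHS]cosN; congr (cos _); ring.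
- by rewrite e eqxx in uv.
Qed.

(** Fourier coefficients are kept as real pairs, because cosines and sines are the real edge weights
    to which the cut bounds apply. A shift rotates the pair. *)
Definition fc (k : nat) (f : 'I_n -> R) := \sum_v f v * cos (k%:R * freq v).
Definition fs (k : nat) (f : 'I_n -> R) := \sum_v f v * sin (k%:R * freq v).

Lemma parseval f : \sum_(k < n) (fc k f ^+ 2 + fs k f ^+ 2) = n%:R * \sum_v f v ^+ 2.
Proof.
transitivity (\sum_(k < n) \sum_u \sum_v f u * f v * cos (k%:R * (freq u - freq v))).
  apply: eq_bigr => k _; rewrite /fc /fs !expr2 !mulr_suml -big_split; apply: eq_bigr => u _ /=.
  rewrite !mulr_sumr -big_split; apply: eq_bigr => v _ /=.
  by rewrite mulrBr cosB; ring.
rewrite exchange_big [RHS]mulr_sumr; apply: eq_bigr => u _ /=.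
rewrite exchange_big /= (bigD1 u) //= [X in _ + X]big1 ?addr0 => [|v vu].
  by rewrite -mulr_sumr csum_freq_orthogonal eqxx mulrC expr2.
by rewrite -mulr_sumr csum_freq_orthogonal eq_sym (negbTE vu) mulr0.
Qed.

Lemma freq_shift (k : nat) (d : nat) (v : 'I_n) :
  (cos (k%:R * freq (shift d v)) = cos (k%:R * freq v + k%:R * freq d)) *
  (sin (k%:R * freq (shift d v)) = sin (k%:R * freq v + k%:R * freq d)).
Proof.
have E : k%:R * freq v + k%:R * freq d = k%:R * freq (shift d v) + pi *+ 2 *+ (k * ((v + d) %/ n)).
  have e : v%:R + d%:R = ((v + d) %/ n)%:R * n%:R + ((v + d) %% n)%:R :> R.
    by rewrite -natrM -!natrD -divn_eq.
  rewrite -mulrDr /freq -mulrDl -mulrDr e -[_ *+ (k * _)]mulr_natr natrM /=.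
  by field.
by rewrite E cos_period sin_period.
Qed.

Lemma fc_shift k d f : fc k f =
  fc k (f \o shift d) * cos (k%:R * freq d) - fs k (f \o shift d) * sin (k%:R * freq d).
Proof.
rewrite /fc (reindex_inj (@shift_inj n d)) /= /fs !mulr_suml -sumrB; apply: eq_bigr => v _.
by rewrite freq_shift cosD /=; ring.
Qed.

Lemma fs_shift k d f : fs k f =
  fs k (f \o shift d) * cos (k%:R * freq d) + fc k (f \o shift d) * sin (k%:R * freq d).
Proof.
rewrite /fs (reindex_inj (@shift_inj n d)) /= /fc !mulr_suml -big_split; apply: eq_bigr => v _.
by rewrite freq_shift sinD /=; ring.
Qed.

Lemma fc_of_shift k d f : fc k (f \o shift d) =
  fc k f * cos (k%:R * freq d) + fs k f * sin (k%:R * freq d).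
Proof.
rewrite (fc_shift k d f) (fs_shift k d f); have := cos2Dsin2 (k%:R * freq d).
move: (fc k _) (fs k _) (cos _) (sin _) => a b c s e.
have -> : (a * c - b * s) * c + (b * c + a * s) * s = a * (c ^+ 2 + s ^+ 2) by ring.
by rewrite e mulr1.
Qed.

Lemma fs_of_shift k d f : fs k (f \o shift d) =
  fs k f * cos (k%:R * freq d) - fc k f * sin (k%:R * freq d).
Proof.
rewrite (fc_shift k d f) (fs_shift k d f); have := cos2Dsin2 (k%:R * freq d).
move: (fc k _) (fs k _) (cos _) (sin _) => a b c s e.
have -> : (b * c + a * s) * c - (a * c - b * s) * s = b * (c ^+ 2 + s ^+ 2) by ring.
by rewrite e mulr1.
Qed.

End Trig.

(** * Moving averages and block averages *)

Section Averages.
Local Open Scope ring_scope.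
Variable R : realType.

Lemma sum_const_natl (T : finType) (x : R) : \sum_(t : T) x = #|T|%:R * x.
Proof. by rewrite sumr_const -[LHS]mulr_natl. Qed.

Lemma sqr_sum_le (T : finType) (x : T -> R) :
  (\sum_t x t) ^+ 2 <= #|T|%:R * \sum_t x t ^+ 2.
Proof.
have h : 0 <= \sum_s \sum_t (x s - x t) ^+ 2.
  by apply: sumr_ge0 => s _; apply: sumr_ge0 => t _; exact: sqr_ge0.
have E : \sum_s \sum_t (x s - x t) ^+ 2 = 2 * (#|T|%:R * \sum_t x t ^+ 2) - 2 * (\sum_t x t) ^+ 2.
  transitivity (\sum_s \sum_t (x s ^+ 2 + x t ^+ 2 - 2 * (x s * x t))).
    by apply: eq_bigr => s _; apply: eq_bigr => t _; ring.
  transitivity (\sum_s (#|T|%:R * x s ^+ 2 + \sum_t x t ^+ 2 - 2 * (x s * \sum_t x t))).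
    apply: eq_bigr => s _; rewrite sumrB big_split /= sum_const_natl.
    by rewrite [in RHS]mulr_sumr [in RHS]mulr_sumr.
  rewrite sumrB big_split /= -mulr_sumr sum_const_natl -mulr_sumr -mulr_suml expr2.
  ring.
by rewrite E in h; lra.
Qed.

Lemma sqr_avg_le (T : finType) (x : T -> R) :
  (#|T|%:R^-1 * \sum_t x t) ^+ 2 <= #|T|%:R^-1 * \sum_t x t ^+ 2.
Proof.
have [T0|T0] := posnP #|T|; first by rewrite T0 invr0 !mul0r expr0n.
have Tr : 0 < #|T|%:R :> R by rewrite ltr0n.
have := sqr_sum_le x; move: (\sum_t x t) (\sum_t x t ^+ 2) => a b h.
rewrite exprMn -(ler_pM2l (exprn_gt0 2 Tr)) mulrA -exprMn divff ?gt_eqF // expr1n mul1r.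
by apply: le_trans h _; rewrite expr2 -!mulrA [X in _ <= _ * X]mulrA divff ?gt_eqF // mul1r.
Qed.

Definition moving_avg n M (F : 'I_n -> R) (v : 'I_n) := M%:R^-1 * \sum_(d < M) F (shift d v).

Lemma moving_avg_contraction n M (F : 'I_n -> R) :
  \sum_v moving_avg M F v ^+ 2 <= \sum_v F v ^+ 2.
Proof.
apply: (@le_trans _ _ (\sum_v M%:R^-1 * \sum_(d < M) F (shift d v) ^+ 2)).
  by apply: ler_sum => v _; have := sqr_avg_le (fun d : 'I_M => F (shift d v)); rewrite card_ord.
rewrite -mulr_sumr exchange_big /=.
rewrite (eq_bigr (fun=> \sum_v F v ^+ 2)); last first.
  by move=> d _; rewrite [RHS](reindex_inj (@shift_inj n d)).
rewrite sum_const_natl card_ord mulrA.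
have [->|M0] := posnP M; first by rewrite mulr0 mul0r; apply: sumr_ge0 => v _; exact: sqr_ge0.
by rewrite mulVf ?mul1r // pnatr_eq0 -lt0n.
Qed.

Section Blocks.
Variables (K L r : nat).
Hypothesis L_gt0 : (0 < L)%N.
Hypothesis r_gt0 : (0 < r)%N.
Let n := (K * L)%N.

(* A window of [r] blocks meets only two blocks partially, and the full ones cancel. *)
Lemma moving_avg_of_balanced (h : 'I_n -> R) : (forall a, \sum_j h (join a j) = 0) ->
  \sum_v moving_avg (r * L) h v ^+ 2 <= 4 / r%:R ^+ 2 * \sum_v h v ^+ 2.
Proof.
move=> bal.
have [n0|n0] := posnP n.
  have E (g : 'I_n -> R) : \sum_v g v = 0.
    by apply: big1 => -[v vn]; exfalso; rewrite n0 in vn.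
  by rewrite !E mulr0.
pose hh (t : nat) := h (Ordinal (ltn_pmod t n0)).
pose P (t : nat) := \sum_(s < t) hh s.
have hhE (v : 'I_n) : hh v = h v.
  by congr h; apply/val_inj; rewrite /= modn_small.
have P_block a : (a <= K)%N -> P (a * L)%N = 0.
  elim: a => [|a IH] aK; first by rewrite /P mul0n big_ord0.
  rewrite /P mulSn addnC big_split_ord /= -/(P (a * L)%N) IH ?(ltnW aK) // add0r.
  rewrite -[RHS](bal (Ordinal aK)); apply: eq_bigr => j _; rewrite -hhE; exact: congr1.
have P_n : P n = 0 by exact: P_block.
have P_add s t : P (s + t)%N = P s + \sum_(d < t) hh (s + d)%N by rewrite /P big_split_ord.
have P_period t : P (t + n)%N = P t.
  rewrite addnC P_add P_n add0r; apply: eq_bigr => d _; congr h.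
  by apply/val_inj; rewrite /= modnDl.
have P_mod t : P t = P (t %% n)%N.
  rewrite {1}(divn_eq t n); elim: (t %/ n)%N => [|q IH]; first by rewrite mul0n.
  by rewrite mulSn -addnA addnC P_period.
pose H (v : 'I_n) := P v.
have avgE v : moving_avg (r * L) h v = (r * L)%:R^-1 * (H (shift (r * L) v) - H v).
  rewrite /moving_avg /H; congr (_ * _).
  by rewrite /= -P_mod P_add addrC addKr; apply: eq_bigr => d _; congr h; apply/val_inj.
have HH : \sum_v H v ^+ 2 <= L%:R ^+ 2 * \sum_v h v ^+ 2.
  rewrite !sumr_join mulr_sumr; apply: ler_sum => a _.
  apply: (@le_trans _ _ (\sum_(b < L) L%:R * \sum_j h (join a j) ^+ 2)); last first.
    by rewrite sum_const_natl card_ord mulrA -expr2.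
  apply: ler_sum => b _.
  have -> : H (join a b) = \sum_(j < L) (if (j < b)%N then h (join a j) else 0).
    rewrite /H /= P_add P_block ?(ltnW (ltn_ord a)) // add0r -big_mkcond /=.
    rewrite (big_ord_widen_cond L predT (fun d => hh (a * L + d)%N)) ?(ltnW (ltn_ord b)) //=.
    by apply: eq_bigr => j _; rewrite -hhE.
  apply: le_trans (sqr_sum_le _) _; rewrite card_ord; apply: ler_wpM2l; first exact: ler0n.
  by apply: ler_sum => j _; case: ifP => _ //; rewrite expr0n sqr_ge0.
have rL : 0 < (r * L)%:R :> R by rewrite ltr0n muln_gt0 r_gt0.
apply: (@le_trans _ _ (\sum_v (r * L)%:R^-1 ^+ 2 * (2 * H (shift (r * L) v) ^+ 2 + 2 * H v ^+ 2))).
  apply: ler_sum => v _; rewrite avgE exprMn; apply: ler_wpM2l; first exact: sqr_ge0.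
  by have := sqr_ge0 (H (shift (r * L) v) + H v); move: (H _) (H _) => a b; lra.
rewrite -mulr_sumr big_split /= -!mulr_sumr.
have -> : \sum_v H (shift (r * L) v) ^+ 2 = \sum_v H v ^+ 2.
  by rewrite [RHS](reindex_inj (@shift_inj n (r * L))).
have i0 : 0 <= (r * L)%:R^-1 ^+ 2 :> R by exact: sqr_ge0.
have := ler_wpM2l i0 HH; set S := \sum_v H v ^+ 2; set T := \sum_v h v ^+ 2 => hST.
have -> : (r * L)%:R^-1 ^+ 2 * (2 * S + 2 * S) = 4 * ((r * L)%:R^-1 ^+ 2 * S) by ring.
have -> : 4 / r%:R ^+ 2 * T = 4 * ((r * L)%:R^-1 ^+ 2 * (L%:R ^+ 2 * T)).
  by rewrite natrM; field; rewrite !pnatr_eq0 -!lt0n L_gt0.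
by rewrite ler_pM2l.
Qed.

(** [F] is split into its block means [A], which the moving average contracts, and the balanced rest
    [h], which it nearly kills. The unequal split (x + y)^2 <= 9/8 x^2 + 9 y^2 keeps the main
    constant close to 1; 36 is 9 times the constant 4 of the balanced case. *)
Lemma moving_avg_le_blocks (F : 'I_n -> R) :
  \sum_v moving_avg (r * L) F v ^+ 2 <=
    9 / 8 * (\sum_a (\sum_j F (join a j)) ^+ 2 / L%:R) + 36 / r%:R ^+ 2 * \sum_v F v ^+ 2.
Proof.
have Lr : 0 < L%:R :> R by rewrite ltr0n.
pose A (v : 'I_n) := L%:R^-1 * \sum_j F (join (hdig v) j).
pose h v := F v - A v.
have AE a j : A (join a j) = L%:R^-1 * \sum_j F (join a j) by rewrite /A hi_join.
have bal a : \sum_j h (join a j) = 0.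
  rewrite sumrB [X in _ - X](eq_bigr (fun=> L%:R^-1 * \sum_j F (join a j))) //.
  by rewrite sum_const_natl card_ord mulrA divff ?gt_eqF // mul1r subrr.
have sumA : \sum_v A v ^+ 2 = \sum_a (\sum_j F (join a j)) ^+ 2 / L%:R.
  rewrite sumr_join; apply: eq_bigr => a _.
  rewrite (eq_bigr (fun=> (L%:R^-1 * \sum_j F (join a j)) ^+ 2)); last by move=> j _; rewrite AE.
  by rewrite sum_const_natl card_ord; move: (\sum_j _) => x; field; rewrite gt_eqF.
have sumh : \sum_v h v ^+ 2 <= \sum_v F v ^+ 2.
  rewrite !sumr_join; apply: ler_sum => a _.
  set x := L%:R^-1 * \sum_j F (join a j).
  have -> : \sum_j h (join a j) ^+ 2 = \sum_j F (join a j) ^+ 2 - L%:R * x ^+ 2.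
    rewrite (eq_bigr (fun j => F (join a j) ^+ 2 - 2 * x * F (join a j) + x ^+ 2)); last first.
      by move=> j _; rewrite /h AE -/x; ring.
    rewrite big_split sumrB /= -mulr_sumr sum_const_natl card_ord.
    have -> : \sum_j F (join a j) = L%:R * x by rewrite /x mulrA divff ?gt_eqF // mul1r.
    ring.
  by rewrite gerBl; apply: mulr_ge0; [exact: ltW|exact: sqr_ge0].
have rr : 0 <= 4 / r%:R ^+ 2 :> R by apply: divr_ge0 => //; exact: sqr_ge0.
have hb := le_trans (moving_avg_of_balanced bal) (ler_wpM2l rr sumh).
have ha := moving_avg_contraction (r * L) A; rewrite sumA in ha.
apply: (@le_trans _ _ (\sum_v (9 / 8 * moving_avg (r * L) A v ^+ 2 + 9 * moving_avg (r * L) h v ^+ 2))).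
  apply: ler_sum => v _.
  have -> : moving_avg (r * L) F v = moving_avg (r * L) A v + moving_avg (r * L) h v.
    rewrite /moving_avg -mulrDr -big_split; congr (_ * _); apply: eq_bigr => d _ /=.
    by rewrite /h addrC subrK.
  move: (moving_avg _ A _) (moving_avg _ h _) => x y; have := sqr_ge0 (x - 8 * y); lra.
rewrite big_split /= -!mulr_sumr.
have -> : 36 / r%:R ^+ 2 * \sum_v F v ^+ 2 = 9 * (4 / r%:R ^+ 2 * \sum_v F v ^+ 2) by ring.
by apply: lerD; (apply: ler_wpM2l; first lra).
Qed.

End Blocks.
End Averages.

(** * Averaging operators twisted by unit complex weights *)

Section Twisted.
Local Open Scope ring_scope.
Variable R : realType.
Variables (D : nat) (X : finType) (phi : 'I_D -> X -> X).
Hypothesis phi_inj : forall i, injective (phi i).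
Hypothesis D_gt0 : (0 < D)%N.
Variables (c s : 'I_D * X -> R).
Hypothesis cs1 : forall e, c e ^+ 2 + s e ^+ 2 = 1.
Variables a b : X -> R.

(** [A + i B] is the mean over the maps of [a + i b] at the image point times the conjugate of
    [c + i s]. *)
Let A x := D%:R^-1 * \sum_i (a (phi i x) * c (i, x) + b (phi i x) * s (i, x)).
Let B x := D%:R^-1 * \sum_i (b (phi i x) * c (i, x) - a (phi i x) * s (i, x)).

Lemma twisted_contraction : \sum_x (A x ^+ 2 + B x ^+ 2) <= \sum_x (a x ^+ 2 + b x ^+ 2).
Proof.
have h x : A x ^+ 2 + B x ^+ 2 <= D%:R^-1 * \sum_i (a (phi i x) ^+ 2 + b (phi i x) ^+ 2).
  have h1 := sqr_avg_le (fun i => a (phi i x) * c (i, x) + b (phi i x) * s (i, x)).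
  have h2 := sqr_avg_le (fun i => b (phi i x) * c (i, x) - a (phi i x) * s (i, x)).
  rewrite card_ord in h1 h2; apply: le_trans (lerD h1 h2) _.
  rewrite -mulrDr -big_split le_eqVlt; apply/orP; left; apply/eqP; congr (_ * _).
  apply: eq_bigr => i _ /=.
  rewrite -[RHS]mulr1 -(cs1 (i, x)); ring.
apply: le_trans (ler_sum _ (fun x _ => h x)) _.
rewrite -mulr_sumr exchange_big /=.
rewrite (eq_bigr (fun=> \sum_x (a x ^+ 2 + b x ^+ 2))); last first.
  by move=> i _; rewrite [RHS](reindex_inj (@phi_inj i)).
by rewrite sum_const_natl card_ord mulrA mulVf ?mul1r // pnatr_eq0 -lt0n.
Qed.

Hypothesis cut_c : forall S : {set bool * X}, `|\sum_(e in edges phi S) c e| <=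
  (1 / 512) * D%:R * Num.sqrt (#|side S true| * #|side S false|)%:R.
Hypothesis cut_s : forall S : {set bool * X}, `|\sum_(e in edges phi S) s e| <=
  (1 / 512) * D%:R * Num.sqrt (#|side S true| * #|side S false|)%:R.

(** The operator is tested against 4 times its own output. With T the energy of the input and U that
    of the output, [form_real] gives 4 D U <= D / 16 (2 T + 32 U), that is, U <= T / 16. *)
Lemma twisted_strong : \sum_x (A x ^+ 2 + B x ^+ 2) <= 1 / 16 * \sum_x (a x ^+ 2 + b x ^+ 2).
Proof.
have Dr : 0 < D%:R :> R by rewrite ltr0n.
have le1 (x y : R) : x ^+ 2 + y ^+ 2 = 1 -> `|x| <= 1.
  by move=> e; rewrite -(@expr_le1 _ 2) // real_normK ?num_real // -e lerDl sqr_ge0.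
have c1 e : `|c e| <= 1 by exact: le1 (cs1 e).
have s1 e : `|s e| <= 1 by apply: (le1 _ (c e)); rewrite addrC cs1.
have al : 0 <= (1 / 512 : R) <= 1 / 512 by rewrite lexx andbT; apply: divr_ge0.
have FC f g := ler_normlP _ _ (form_real phi_inj c1 al cut_c f g).
have FS f g := ler_normlP _ _ (form_real phi_inj s1 al cut_s f g).
pose frm (w : 'I_D * X -> R) (f g : X -> R) := \sum_e w e * f (phi e.1 e.2) * g e.2.
pose A4 x := 4 * A x; pose B4 x := 4 * B x.
have [_ h1] := FC a A4; have [_ h2] := FS b A4; have [_ h3] := FC b B4; have [h4 _] := FS a B4.
have E : frm c a A4 + frm s b A4 + frm c b B4 - frm s a B4 = 4 * D%:R * \sum_x (A x ^+ 2 + B x ^+ 2).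
  have EA x : D%:R * A x = \sum_i (a (phi i x) * c (i, x) + b (phi i x) * s (i, x)).
    by rewrite /A mulrA divff ?gt_eqF // mul1r.
  have EB x : D%:R * B x = \sum_i (b (phi i x) * c (i, x) - a (phi i x) * s (i, x)).
    by rewrite /B mulrA divff ?gt_eqF // mul1r.
  rewrite -mulrA mulr_sumr mulr_sumr.
  rewrite (eq_bigr (fun x => \sum_i (c (i, x) * a (phi i x) * A4 x + s (i, x) * b (phi i x) * A4 x +
    c (i, x) * b (phi i x) * B4 x - s (i, x) * a (phi i x) * B4 x))); last first.
    move=> x _.
    have -> : 4 * (D%:R * (A x ^+ 2 + B x ^+ 2)) = (D%:R * A x) * A4 x + (D%:R * B x) * B4 x.
      by rewrite /A4 /B4; ring.
    rewrite EA EB !mulr_suml -big_split; apply: eq_bigr => i _ /=; ring.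
  rewrite exchange_big pair_bigA /= /frm -!big_split -sumrB /=.
  by apply: eq_bigr => -[i x] _.
have sq4 (h : X -> R) : \sum_x (4 * h x) ^+ 2 = 16 * \sum_x h x ^+ 2.
  by rewrite mulr_sumr; apply: eq_bigr => x _; ring.
rewrite /frm in E; move: h1 h2 h3 h4 E; rewrite /A4 /B4 !sq4 !big_split /=.
move: (\sum_x A x ^+ 2) (\sum_x B x ^+ 2) (\sum_x a x ^+ 2) (\sum_x b x ^+ 2) => SA SB Sa Sb.
move: (\sum_e c e * a _ * _) (\sum_e s e * b _ * _) (\sum_e c e * b _ * _) (\sum_e s e * a _ * _) => f1 f2 f3 f4 h1 h2 h3 h4 E.
have : 4 * D%:R * (SA + SB) <= D%:R / 16 * (2 * (Sa + Sb) + 32 * (SA + SB)) by rewrite -E; lra.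
rewrite -[4 * D%:R * _]mulrA -[D%:R / 16 * _]mulrA mulrCA ler_pM2l //; lra.
Qed.

End Twisted.

(** * Contraction by a single lift *)

Section LevelInequality.
Local Open Scope ring_scope.
Variable R : realType.

Lemma freqC n (k d : nat) : k%:R * freq R n d = d%:R * freq R n k.
Proof. by rewrite /freq; ring. Qed.

Definition avg_op D (X : Type) (phi : 'I_D -> X -> X) (f : X -> R) x :=
  D%:R^-1 * \sum_i f (phi i x).

(* The frequencies [k] that random translations by less than [m] mix, where [m] is a
   large multiple of [M]; the others are controlled by averages over windows [M]. *)
Definition is_high n (M : nat) (k : nat) := (1 / (4 * M%:R)) ^+ 2 <= 2 - 2 * cos (freq R n k).

Section MovingFourier.
Variables (n M : nat) (F : 'I_n -> R).
Hypothesis n_gt0 : (0 < n)%N.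
Hypothesis M_gt0 : (0 < M)%N.

Lemma fc_moving_avg k : fc k (moving_avg M F) =
  M%:R^-1 * (fc k F * csum (freq R n k) M + fs k F * ssum (freq R n k) M).
Proof.
transitivity (M%:R^-1 * \sum_(d < M) fc k (F \o shift d)).
  rewrite /fc /moving_avg exchange_big mulr_sumr; apply: eq_bigr => v _ /=.
  by rewrite -mulrA mulr_suml.
congr (_ * _); rewrite /csum /ssum !mulr_sumr -big_split; apply: eq_bigr => d _ /=.
by rewrite fc_of_shift // freqC.
Qed.

Lemma fs_moving_avg k : fs k (moving_avg M F) =
  M%:R^-1 * (fs k F * csum (freq R n k) M - fc k F * ssum (freq R n k) M).
Proof.
transitivity (M%:R^-1 * \sum_(d < M) fs k (F \o shift d)).
  rewrite /fs /moving_avg exchange_big mulr_sumr; apply: eq_bigr => v _ /=.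
  by rewrite -mulrA mulr_suml.
congr (_ * _); rewrite /csum /ssum !mulr_sumr -sumrB; apply: eq_bigr => d _ /=.
by rewrite fs_of_shift // freqC.
Qed.

(** For a low frequency t and d < M, 2 - 2 cos (d t) is at most 1/16, so all these cosines are at
    least 31/32; the moving average keeps (31/32)^2 >= 8/9 of the squared coefficient. *)
Lemma low_moving_avg k : ~~ is_high n M k ->
  fc k F ^+ 2 + fs k F ^+ 2 <= 9 / 8 * (fc k (moving_avg M F) ^+ 2 + fs k (moving_avg M F) ^+ 2).
Proof.
rewrite /is_high -ltNge => low.
have Mr : 0 < M%:R :> R by rewrite ltr0n.
have C_big : 31 / 32 * M%:R <= csum (freq R n k) M.
  have -> : 31 / 32 * M%:R = \sum_(d < M) (31 / 32) :> R by rewrite sum_const_natl card_ord mulrC.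
  apply: ler_sum => d _.
  have h := csum_ssum_sq (freq R n k) d.
  have h2 := csum_ssum_le (freq R n k) d.
  have c0 : 0 <= 2 - 2 * cos (freq R n k) by have := cos_le1 (freq R n k); lra.
  have h3 := ler_wpM2r c0 h2; rewrite h in h3.
  have dM : d%:R ^+ 2 <= M%:R ^+ 2 :> R.
    by apply: lerXn2r; rewrite ?nnegrE ?ler0n // ler_nat ltnW.
  have h4 : d%:R ^+ 2 * (2 - 2 * cos (freq R n k)) <= M%:R ^+ 2 * (1 / (4 * M%:R)) ^+ 2.
    by apply: ler_pM => //; [exact: sqr_ge0|exact: ltW].
  have e : M%:R ^+ 2 * (1 / (4 * M%:R)) ^+ 2 = 1 / 16 :> R by field; rewrite gt_eqF.
  by rewrite e in h4; lra.
have E : fc k (moving_avg M F) ^+ 2 + fs k (moving_avg M F) ^+ 2 =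
   (fc k F ^+ 2 + fs k F ^+ 2) * ((csum (freq R n k) M ^+ 2 + ssum (freq R n k) M ^+ 2) / M%:R ^+ 2).
  by rewrite fc_moving_avg fs_moving_avg; field; rewrite gt_eqF.
rewrite E mulrCA -[leLHS]mulr1; apply: ler_wpM2l; first by rewrite addr_ge0 ?sqr_ge0.
rewrite mulrA ler_pdivlMr ?exprn_gt0 // mul1r.
have C2 : (31 / 32 * M%:R) ^+ 2 <= csum (freq R n k) M ^+ 2.
  by apply: lerXn2r => //; rewrite nnegrE; [apply: mulr_ge0; lra|apply: le_trans C_big; apply: mulr_ge0; lra].
have := sqr_ge0 (ssum (freq R n k) M); have := exprn_gt0 2 Mr; move: C2; rewrite exprMn.
move: (csum _ _ ^+ 2) (ssum _ _ ^+ 2) (M%:R ^+ 2) => x y z; lra.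
Qed.
End MovingFourier.

(** Functions constant on fibres and functions of mean zero on each fibre form orthogonal subspaces
    that the lifted operator preserves; on the first it acts as the operator of [phi]. *)
Lemma lift_split N n D m (phi : 'I_D -> 'I_N -> 'I_N) (s : 'I_D * 'I_N -> 'I_m)
    (f : 'I_(N * n) -> R) (g : 'I_N -> R) :
  (forall x, \sum_v f (join x v) = n%:R * g x) ->
  exists F : 'I_(N * n) -> R,
  [/\ forall x v, F (join x v) = f (join x v) - g x,
      forall x, \sum_v F (join x v) = 0,
      \sum_y avg_op (lift_map phi s) f y ^+ 2 =
        n%:R * \sum_x avg_op phi g x ^+ 2 + \sum_y avg_op (lift_map phi s) F y ^+ 2 &
      \sum_y F y ^+ 2 = \sum_y f y ^+ 2 - n%:R * \sum_x g x ^+ 2].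
Proof.
move=> gE; pose P h := avg_op (lift_map phi s) (h : 'I_(N * n) -> R).
pose F y := f y - g (hdig y).
have FE x v : F (join x v) = f (join x v) - g x by rewrite /F hi_join.
have bal x : \sum_v F (join x v) = 0.
  rewrite (eq_bigr (fun v => f (join x v) - g x)); last by move=> v _; exact: FE.
  by rewrite sumrB gE sum_const_natl card_ord subrr.
have PE x v : P f (join x v) = avg_op phi g x + P F (join x v).
  rewrite /P /avg_op -mulrDr -big_split; congr (_ * _); apply: eq_bigr => i _ /=.
  by rewrite lift_map_join FE addrC subrK.
have Pbal x : \sum_v P F (join x v) = 0.
  rewrite /P /avg_op -mulr_sumr exchange_big big1 ?mulr0 // => i _ /=.
  rewrite (eq_bigr (fun v => F (join (phi i x) (shift (s (i, x)) v)))); last first.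
    by move=> v _; rewrite lift_map_join.
  rewrite -[RHS](bal (phi i x)); apply/esym.
  by rewrite (reindex_inj (@shift_inj n (s (i, x)))).
exists F; split=> //.
  rewrite !sumr_join mulr_sumr -big_split; apply: eq_bigr => x _ /=.
  rewrite (eq_bigr (fun v => avg_op phi g x ^+ 2 + 2 * avg_op phi g x * P F (join x v) + P F (join x v) ^+ 2)); last first.
    by move=> v _; rewrite -/(P f _) PE; ring.
  by rewrite !big_split /= sum_const_natl card_ord -mulr_sumr Pbal mulr0 addr0.
rewrite !sumr_join mulr_sumr -sumrB; apply: eq_bigr => x _ /=.
rewrite (eq_bigr (fun v => f (join x v) ^+ 2 - 2 * g x * f (join x v) + g x ^+ 2)); last first.
  by move=> v _; rewrite FE; ring.
by rewrite big_split sumrB /= sum_const_natl card_ord -mulr_sumr gE; ring.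
Qed.

Variables (N K L D m : nat) (phi : 'I_D -> 'I_N -> 'I_N) (s : 'I_D * 'I_N -> 'I_m).
Let n := (K * L)%N.
Let M := (64 * L)%N.
Hypothesis phi_inj : forall i, injective (phi i).
Hypothesis D_gt0 : (0 < D)%N.
Hypothesis L_gt0 : (0 < L)%N.
Hypothesis n_gt0 : (0 < n)%N.

Definition good_cut (w : 'I_m -> R) := forall S : {set bool * 'I_N},
  `|\sum_(e in edges phi S) w (s e)| <=
  (1 / 512) * D%:R * Num.sqrt (#|side S true| * #|side S false|)%:R.

Hypothesis cuts : forall k : 'I_n, is_high n M k ->
  good_cut (fun j => cos (j%:R * freq R n k)) /\ good_cut (fun j => sin (j%:R * freq R n k)).

Let P (f : 'I_(N * n) -> R) := avg_op (lift_map phi s) f.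

(** A Fourier transform along the fibres splits the operator into twisted operators on 'I_N. High
    frequencies contract by the cut bounds; low ones are controlled by moving averages over windows
    of 64 blocks. The constants are 81/64 = (9/8)^2 and 1/16 + 9/8 * 9/1024 <= 1/12. *)
Lemma lift_mean_zero (F : 'I_(N * n) -> R) : (forall x, \sum_v F (join x v) = 0) ->
  \sum_y P F y ^+ 2 <= 1 / 12 * \sum_y F y ^+ 2 +
    81 / 64 * (\sum_x \sum_a (\sum_j F (join x (join a j))) ^+ 2 / L%:R).
Proof.
move=> bal.
pose Fx x v := F (join x v).
have nr : 0 < n%:R :> R by rewrite ltr0n.
have M0 : (0 < M)%N by rewrite muln_gt0.
pose e k := \sum_x (fc k (Fx x) ^+ 2 + fs k (Fx x) ^+ 2).
pose q k := \sum_x (fc k (moving_avg M (Fx x)) ^+ 2 + fs k (moving_avg M (Fx x)) ^+ 2).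
pose p k := \sum_x (fc k (fun v => P F (join x v)) ^+ 2 + fs k (fun v => P F (join x v)) ^+ 2).
have e0 k : 0 <= e k by apply: sumr_ge0 => x _; rewrite addr_ge0 ?sqr_ge0.
have q0 k : 0 <= q k by apply: sumr_ge0 => x _; rewrite addr_ge0 ?sqr_ge0.
pose c k (t : 'I_D * 'I_N) := cos ((s t)%:R * freq R n k).
pose sn k (t : 'I_D * 'I_N) := sin ((s t)%:R * freq R n k).
have fcP k x : fc k (fun v => P F (join x v)) =
    D%:R^-1 * \sum_i (fc k (Fx (phi i x)) * c k (i, x) + fs k (Fx (phi i x)) * sn k (i, x)).
  transitivity (D%:R^-1 * \sum_i fc k (Fx (phi i x) \o shift (s (i, x)))).
    rewrite /fc exchange_big mulr_sumr; apply: eq_bigr => v _ /=.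
    rewrite /P /avg_op -mulrA mulr_suml; congr (_ * _); apply: eq_bigr => i _.
    by rewrite lift_map_join.
  by congr (_ * _); apply: eq_bigr => i _; rewrite fc_of_shift // freqC.
have fsP k x : fs k (fun v => P F (join x v)) =
    D%:R^-1 * \sum_i (fs k (Fx (phi i x)) * c k (i, x) - fc k (Fx (phi i x)) * sn k (i, x)).
  transitivity (D%:R^-1 * \sum_i fs k (Fx (phi i x) \o shift (s (i, x)))).
    rewrite /fs exchange_big mulr_sumr; apply: eq_bigr => v _ /=.
    rewrite /P /avg_op -mulrA mulr_suml; congr (_ * _); apply: eq_bigr => i _.
    by rewrite lift_map_join.
  by congr (_ * _); apply: eq_bigr => i _; rewrite fs_of_shift // freqC.
have cs1 k t : c k t ^+ 2 + sn k t ^+ 2 = 1 by exact: cos2Dsin2.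
have pE k : p k = \sum_x ((D%:R^-1 * \sum_i (fc k (Fx (phi i x)) * c k (i, x) + fs k (Fx (phi i x)) * sn k (i, x))) ^+ 2 +
   (D%:R^-1 * \sum_i (fs k (Fx (phi i x)) * c k (i, x) - fc k (Fx (phi i x)) * sn k (i, x))) ^+ 2).
  by apply: eq_bigr => x _; rewrite fcP fsP.
(* One weakened inequality for both kinds of frequency, so that it can be summed over all of them by
   Parseval. *)
have pk (k : 'I_n) : p k <= 1 / 16 * e k + 9 / 8 * q k.
  have [h|l] := boolP (is_high n M k).
    have [h1 h2] := cuts h.
    have : p k <= 1 / 16 * e k.
      by rewrite pE; exact: (twisted_strong phi_inj D_gt0 (cs1 k) (fun x => fc k (Fx x)) (fun x => fs k (Fx x)) h1 h2).
    by have := q0 k; lra.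
  have : p k <= e k.
    by rewrite pE; exact: (twisted_contraction phi_inj D_gt0 (cs1 k) (fun x => fc k (Fx x)) (fun x => fs k (Fx x))).
  suff : e k <= 9 / 8 * q k by have := e0 k; lra.
  by rewrite mulr_sumr; apply: ler_sum => x _; exact: low_moving_avg.
have sum_e : \sum_(k < n) e k = n%:R * \sum_y F y ^+ 2.
  rewrite exchange_big sumr_join mulr_sumr; apply: eq_bigr => x _; exact: parseval.
have sum_q : \sum_(k < n) q k = n%:R * \sum_x \sum_v moving_avg M (Fx x) v ^+ 2.
  rewrite exchange_big mulr_sumr; apply: eq_bigr => x _; exact: parseval.
have sum_p : \sum_(k < n) p k = n%:R * \sum_y P F y ^+ 2.
  rewrite exchange_big sumr_join mulr_sumr; apply: eq_bigr => x _; exact: parseval.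
have main : \sum_(k < n) p k <= 1 / 16 * \sum_(k < n) e k + 9 / 8 * \sum_(k < n) q k.
  by rewrite !mulr_sumr -big_split; apply: ler_sum.
rewrite sum_p sum_e sum_q in main.
have blk : \sum_x \sum_v moving_avg M (Fx x) v ^+ 2 <=
   9 / 8 * (\sum_x \sum_a (\sum_j F (join x (join a j))) ^+ 2 / L%:R) + 36 / 64 ^+ 2 * \sum_y F y ^+ 2.
  rewrite sumr_join !mulr_sumr -big_split; apply: ler_sum => x _.
  exact: (moving_avg_le_blocks L_gt0 (isT : (0 < 64)%N) (Fx x)).
rewrite -(ler_pM2l nr); apply: le_trans main _.
have F0 : 0 <= \sum_y F y ^+ 2 by apply: sumr_ge0 => y _; exact: sqr_ge0.
rewrite [9 / 8 * _]mulrCA [1 / 16 * _]mulrCA -mulrDr ler_pM2l //.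
move: blk F0; move: (\sum_y F y ^+ 2) (\sum_x \sum_v moving_avg _ _ _ ^+ 2) (\sum_x \sum_a _ / _) => x y z.
have -> : 36 / 64 ^+ 2 = 9 / 1024 :> R by field.
lra.
Qed.

(** The last bracket is the energy that the blocks of length [L] see beyond the fibre means: the
    window of digits which the lift leaves uncontrolled. *)
Lemma level_inequality (f : 'I_(N * n) -> R) (g : 'I_N -> R) :
  (forall x, \sum_v f (join x v) = n%:R * g x) ->
  \sum_y P f y ^+ 2 <= n%:R * \sum_x avg_op phi g x ^+ 2
    + 1 / 12 * (\sum_y f y ^+ 2 - n%:R * \sum_x g x ^+ 2)
    + 81 / 64 * (\sum_x \sum_a (\sum_j f (join x (join a j))) ^+ 2 / L%:R - n%:R * \sum_x g x ^+ 2).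
Proof.
move=> gE.
have Lr : 0 < L%:R :> R by rewrite ltr0n.
have [F [FE bal e1 e2]] := lift_split phi s gE.
have h := lift_mean_zero bal.
have e3 : \sum_x \sum_a (\sum_j F (join x (join a j))) ^+ 2 / L%:R =
   \sum_x \sum_a (\sum_j f (join x (join a j))) ^+ 2 / L%:R - n%:R * \sum_x g x ^+ 2.
  rewrite mulr_sumr -sumrB; apply: eq_bigr => x _ /=.
  rewrite (eq_bigr (fun a : 'I_K => (\sum_j f (join x (join a j))) ^+ 2 / L%:R -
     2 * g x * (\sum_j f (join x (join a j))) + L%:R * g x ^+ 2)); last first.
    move=> a _; rewrite (eq_bigr (fun j : 'I_L => f (join x (join a j)) - g x)); last by move=> j _; exact: FE.
    rewrite sumrB sum_const_natl card_ord; move: (\sum_j _) => y; field; rewrite gt_eqF //.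
  rewrite big_split sumrB /= sum_const_natl card_ord -mulr_sumr.
  have -> : \sum_(a < K) \sum_(j < L) f (join x (join a j)) = n%:R * g x by rewrite -gE sumr_join.
  by rewrite /n natrM; ring.
by rewrite e1 -addrA lerD2l -e2 -e3.
Qed.

End LevelInequality.

(** * Existence of a lift that is sparse and has small cuts *)

Section ExistsLift.
Local Open Scope ring_scope.
Variable R : realType.
Variables (N K L D m B sigma kappa : nat) (phi : 'I_D -> 'I_N -> 'I_N) (r : R).
Hypothesis phi_inj : forall i, injective (phi i).
Hypothesis phi_sparse : sparse_upto phi B sigma.
Hypotheses (D_gt0 : (0 < D)%N) (L_gt0 : (0 < L)%N).
Hypothesis B_small : 2 * B%:R <= (1 / 512) ^+ 2 * D%:R :> R.
Hypothesis r01 : 0 <= r <= 1 / 2.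
Hypothesis r_tail : D%:R ^+ 2 * expR (- (D%:R * (1 / 512) ^+ 4 / 32)) <= r.
Hypothesis r_total : 32 * (K * L)%:R * N%:R * r ^+ sigma <= 1.
Hypothesis m_big : 1024 * 1024 * L%:R <= m%:R :> R.
Hypothesis m_le : (m <= K * L)%N.
Hypothesis kappa_gt0 : (0 < kappa)%N.
Hypothesis kappa_m : ((2 * sigma) ^ 2 * kappa <= m)%N.
Hypothesis kappa_big : (64 * ((N * (K * L)) ^ 2 * 2 ^ D) <= kappa ^ B)%N.

(** The squared modulus of the geometric sum is at most 4 / (2 - 2 cos t), which for a high
    frequency is at most (512 L)^2. The factor 1024 * 1024 in [m_big] makes 512 L at most m /
    2048. *)
Lemma high_frequency_mean k : is_high R (K * L) (64 * L) k ->
  `|csum (freq R (K * L) k) m| <= 1 / 512 / 4 * m%:R /\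
  `|ssum (freq R (K * L) k) m| <= 1 / 512 / 4 * m%:R.
Proof.
rewrite /is_high; set t := freq R _ _ => high.
have Lr : 0 < L%:R :> R by rewrite ltr0n.
have h := csum_ssum_sq t m.
have c1 := cos_geN1 (m%:R * t).
have main : csum t m ^+ 2 + ssum t m ^+ 2 <= (512 * L%:R) ^+ 2.
  have q0 : 0 < (1 / (4 * (64 * L)%:R)) ^+ 2 :> R.
    by rewrite exprn_gt0 // divr_gt0 // mulr_gt0 // ltr0n muln_gt0.
  rewrite -(ler_pM2r q0).
  apply: (@le_trans _ _ ((csum t m ^+ 2 + ssum t m ^+ 2) * (2 - 2 * cos t))).
    by apply: ler_wpM2l => //; rewrite addr_ge0 ?sqr_ge0.
  rewrite h.
  have -> : (512 * L%:R) ^+ 2 * (1 / (4 * (64 * L)%:R)) ^+ 2 = 4 :> R.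
    by rewrite natrM; field; rewrite gt_eqF.
  lra.
have L0 : 0 <= 512 * L%:R :> R by apply: mulr_ge0; rewrite ?ler0n.
have fin (x : R) : x ^+ 2 <= (512 * L%:R) ^+ 2 -> `|x| <= 1 / 512 / 4 * m%:R.
  move=> hx; apply: (@le_trans _ _ (512 * L%:R)); last by have := m_big; lra.
  by rewrite -(@ler_pXn2r _ 2) // ?nnegrE // real_normK ?num_real.
by split; apply: fin; apply: le_trans main; rewrite ?lerDl ?lerDr sqr_ge0.
Qed.

Lemma exists_lift : exists s : {ffun 'I_D * 'I_N -> 'I_m},
  sparse_upto (@lift_map N (K * L) D m phi s) B sigma.*2 /\
  forall k : 'I_(K * L), is_high R (K * L) (64 * L) k ->
    good_cut phi s (fun j => cos (j%:R * freq R (K * L) k)) /\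
    good_cut phi s (fun j => sin (j%:R * freq R (K * L) k)).
Proof.
(* Low frequencies receive the weight 0, so that the mean bound holds for every index; the boolean
   selects cosine or sine. *)
pose om (w : 'I_(K * L) * bool) (j : 'I_m) : R :=
  if is_high R (K * L) (64 * L) w.1
  then (if w.2 then cos else sin) (j%:R * freq R (K * L) w.1) else 0.
have om1 w j : `|om w j| <= 1.
  rewrite /om; case: ifP => _; last by rewrite normr0.
  by case: w.2; [exact: cos_max|exact: sin_max].
have omm w : `|\sum_j om w j| <= 1 / 512 / 4 * m%:R.
  rewrite /om; case: w => k [] /=; case: (boolP (is_high R _ _ k)) => h.
  - by case: (high_frequency_mean h).
  - by rewrite big1 // normr0; apply: mulr_ge0; rewrite ?ler0n //; lra.
  - by case: (high_frequency_mean h).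
  - by rewrite big1 // normr0; apply: mulr_ge0; rewrite ?ler0n //; lra.
have total : 16 * #|{: 'I_(K * L) * bool}|%:R * #|'I_N|%:R * r ^+ sigma <= 1.
  rewrite card_prod card_bool !card_ord natrM.
  have -> : 16 * ((K * L)%:R * 2) * N%:R * r ^+ sigma = 32 * (K * L)%:R * N%:R * r ^+ sigma :> R by ring.
  exact: r_total.
have a0 : 0 < 1 / 512 :> R by lra.
have a1 : 1 / 512 <= 1 :> R by lra.
have c1 := random_cut phi_inj a0 a1 om1 omm phi_sparse B_small D_gt0 r01 r_tail total.
have c2 := random_sparse R phi_sparse m_le kappa_gt0 kappa_m kappa_big.
set b1 := [set s | _] in c1; set b2 := [set s | _] in c2.
have m_gt0 : 0 < m%:R :> R.
  by apply: lt_le_trans m_big; rewrite !mulr_gt0 // ltr0n.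
have mE : 0 < m%:R ^+ #|{: 'I_D * 'I_N}| :> R by exact: exprn_gt0.
have [s] : exists s, s \notin b1 :|: b2.
  apply/existsP; apply: contraT; rewrite negb_exists => /forallP all_bad.
  have : [set: {ffun 'I_D * 'I_N -> 'I_m}] \subset b1 :|: b2.
    by apply/subsetP => s _; have := all_bad s; rewrite negbK.
  move=> /subset_leq_card; rewrite cardsT card_ffun card_ord => le1.
  have := leq_trans le1 (leq_card_setU b1 b2).
  rewrite -(ler_nat R) natrX natrD; lra.
rewrite !inE negb_or !negbK => /andP[/asboolP h1 /asboolP h2].
exists s; split=> // k hk; split=> S.
  have := h1 (k, true) S; rewrite (eq_bigr (fun e => cos ((s e)%:R * freq R (K * L) k))) //.
  by move=> e _; rewrite /om /= hk.
have := h1 (k, false) S; rewrite (eq_bigr (fun e => sin ((s e)%:R * freq R (K * L) k))) //.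
by move=> e _; rewrite /om /= hk.
Qed.

End ExistsLift.

(** * Monotonicity of lifts *)

Section Increasing.
Local Open Scope nat_scope.

Definition increasing_on N (h : 'I_N -> 'I_N) (G : {set 'I_N}) :=
  forall x y : 'I_N, x \in G -> y \in G -> x < y -> h x < h y.

(** Points with the same leading digit are translated by the same amount, and otherwise the leading
    digits decide. Only wraparound breaks the order, at no more than [q] points of a fibre. *)
Lemma lift_increasing N n D m (phi : 'I_D -> 'I_N -> 'I_N) (s : 'I_D * 'I_N -> 'I_m) i q G :
  (forall x, s (i, x) <= q) -> increasing_on (phi i) G ->
  exists2 G' : {set 'I_(N * n)}, increasing_on (lift_map phi s i) G' &
    #|~: G'| <= #|~: G| * n + N * q.
Proof.
move=> s_le incG; exists [set y : 'I_(N * n) | (hdig y \in G) && (ldig y + s (i, hdig y) < n)].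
  move=> x y; rewrite !inE => /andP[hx lx] /andP[hy ly] xy.
  have valE (z : 'I_(N * n)) : ldig z + s (i, hdig z) < n ->
      lift_map phi s i z = phi i (hdig z) * n + (ldig z + s (i, hdig z)) :> nat.
    by move=> /modn_small; rewrite /lift_map /= => ->.
  rewrite !valE //.
  have [h|h|/val_inj h] := ltngtP (hdig x) (hdig y).
  - have hlt := incG _ _ hx hy h.
    apply: (@leq_trans ((phi i (hdig x)).+1 * n)).
      by rewrite mulSn addnC ltn_add2r.
    by apply: leq_trans (leq_addr _ _); rewrite leq_mul2r hlt orbT.
  - exfalso; move: xy; rewrite -(join_hi_lo x) -(join_hi_lo y) ltnNge => /negP; apply => /=.
    apply: (@leq_trans ((hdig y).+1 * n)).
      by rewrite mulSn addnC leq_add2r; exact: (ltnW (ltn_ord (ldig y))).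
    by apply: leq_trans (leq_addr _ _); rewrite leq_mul2r h orbT.
  - rewrite h ltn_add2l ltn_add2r.
    move: (congr1 val h) xy => /= E.
    by rewrite {1}(divn_eq x n) {1}(divn_eq y n) E ltn_add2l.
have cardE (S : {set 'I_(N * n)}) : #|S| = \sum_x \sum_v (join x v \in S).
  by rewrite -sum1_card big_mkcond sumn_join; apply: eq_bigr => x _; apply: eq_bigr => v _; case: ifP.
have e1 : #|~: G| * n = \sum_x (if x \in G then 0 else n).
  by rewrite -sum_nat_const big_mkcond; apply: eq_bigr => x _; rewrite inE; case: (x \in G).
have e2 : N * q = \sum_(x < N) q by rewrite sum_nat_const card_ord.
rewrite cardE e1 e2 -big_split /=; apply: leq_sum => x _.
have [xG|xG] := boolP (x \in G) => /=; last first.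
  apply: (@leq_trans n); last exact: leq_addr.
  by rewrite -[leqRHS]card_ord -sum1_card; apply: leq_sum => v _; exact: leq_b1.
rewrite add0n; apply: (@leq_trans (\sum_(v < n) (n - q <= v))).
  apply: leq_sum => v _; have /= loE := congr1 val (lo_join x v).
  rewrite in_setC in_set hi_join xG loE /= -leqNgt.
  by have := s_le x; case: (leqP (n - q) v) => //; clear; lia.
suff : \sum_(v < n) (n - q <= v) + \sum_(v < n) (v < n - q : nat) = n.
  by rewrite sum_ltn_ord; move: (\sum_(v < _) _) => S; rewrite (minn_idPr (leq_subr _ _)); clear; lia.
rewrite -big_split /= -[RHS]card_ord -sum1_card; apply: eq_bigr => v _.
by rewrite ltnNge; case: (_ <= v).
Qed.

End Increasing.

(** * Energies of block averages at dyadic scales *)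

Section Energy.
Local Open Scope ring_scope.
Variable R : realType.

(** The squared norm of the function that replaces [f] by its mean on each of [K] consecutive blocks
    of length [w]. Taking [f] on nat avoids casts between equal interval lengths. *)
Definition energy (K w : nat) (f : nat -> R) :=
  \sum_(a < K) (\sum_(j < w) f (a * w + j)%N) ^+ 2 / w%:R.

Definition fiber_mean (n : nat) (f : nat -> R) (x : nat) := n%:R^-1 * \sum_(v < n) f (x * n + v)%N.

Lemma energy1 K f : energy K 1 f = \sum_(x < K) f x ^+ 2.
Proof.
by apply: eq_bigr => a _; rewrite big_ord1 divr1 muln1 addn0.
Qed.

Lemma energy_ge0 K w f : 0 <= energy K w f.
Proof. by apply: sumr_ge0 => a _; rewrite divr_ge0 ?sqr_ge0. Qed.

Lemma energy_fiber_mean K w n f : (0 < n)%N -> (0 < w)%N ->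
  n%:R * energy K w (fiber_mean n f) = energy K (w * n) f.
Proof.
move=> n0 w0; rewrite /energy mulr_sumr; apply: eq_bigr => a _.
have -> : \sum_(j < w) fiber_mean n f (a * w + j)%N = n%:R^-1 * \sum_(i < w * n) f (a * (w * n) + i)%N.
  rewrite -mulr_sumr; congr (_ * _); rewrite sumr_join; apply: eq_bigr => j _.
  by apply: eq_bigr => v _ /=; congr f; lia.
by rewrite natrM; move: (\sum_(i < _) _) => x; field; rewrite !pnatr_eq0 -!lt0n n0.
Qed.

Lemma energy_mono K p w f : (0 < w)%N -> (0 < p)%N ->
  energy K (p * w) f <= energy (K * p) w f.
Proof.
move=> w0 p0; rewrite /energy sumr_join; apply: ler_sum => a _.
have -> : \sum_(j < p * w) f (a * (p * w) + j)%N = \sum_(b < p) \sum_(j < w) f ((a * p + b) * w + j)%N.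
  rewrite sumr_join; apply: eq_bigr => b _; apply: eq_bigr => j _ /=; congr f; lia.
have wr : 0 < w%:R :> R by rewrite ltr0n.
have pr : 0 < p%:R :> R by rewrite ltr0n.
apply: (@le_trans _ _ ((\sum_(b < p) (\sum_(j < w) f ((a * p + b) * w + j)%N) ^+ 2) / w%:R)); last by rewrite mulr_suml.
have := sqr_sum_le (fun b : 'I_p => \sum_(j < w) f ((a * p + b) * w + j)%N).
rewrite card_ord natrM invfM mulrA; move: (\sum_(b < p) _) (\sum_(b < p) _ ^+ 2) => x y h.
by apply: ler_wpM2r; [rewrite invr_ge0 ltW|rewrite ler_pdivrMr // mulrC].
Qed.

Lemma avg_op_contraction D (X : finType) (phi : 'I_D -> X -> X) (f : X -> R) :
  (0 < D)%N -> (forall i, injective (phi i)) ->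
  \sum_x avg_op phi f x ^+ 2 <= \sum_x f x ^+ 2.
Proof.
move=> D0 inj.
apply: (@le_trans _ _ (\sum_x D%:R^-1 * \sum_i f (phi i x) ^+ 2)).
  by apply: ler_sum => x _; have := sqr_avg_le (fun i => f (phi i x)); rewrite card_ord.
rewrite -mulr_sumr exchange_big /=.
rewrite (eq_bigr (fun=> \sum_x f x ^+ 2)); last by move=> i _; rewrite [RHS](reindex_inj (@inj i)).
by rewrite sum_const_natl card_ord mulrA mulVf ?mul1r // pnatr_eq0 -lt0n.
Qed.

Definition dyadic_energy (J : nat) (f : nat -> R) (b : nat) := energy (2 ^ b) (2 ^ (J - b)) f.

Lemma dyadic_energy_mono J f b b' : (b <= b' <= J)%N -> dyadic_energy J f b <= dyadic_energy J f b'.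
Proof.
move=> /andP[bb bJ]; rewrite /dyadic_energy.
have -> : (2 ^ (J - b) = 2 ^ (b' - b) * 2 ^ (J - b'))%N by rewrite -expnD; congr (_ ^ _)%N; lia.
have -> : (2 ^ b' = 2 ^ b * 2 ^ (b' - b))%N by rewrite -expnD subnKC.
by apply: energy_mono; rewrite expn_gt0.
Qed.

Lemma dyadic_energy_full J f : dyadic_energy J f J = \sum_(x < 2 ^ J) f x ^+ 2.
Proof. by rewrite /dyadic_energy subnn expn0 energy1. Qed.

Lemma dyadic_energy_fiber_mean J k f b : (b <= J)%N ->
  (2 ^ k)%:R * dyadic_energy J (fiber_mean (2 ^ k) f) b = dyadic_energy (J + k) f b.
Proof.
move=> bJ; rewrite /dyadic_energy energy_fiber_mean ?expn_gt0 //.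
by rewrite -expnD addnC addnBA // addnC.
Qed.

End Energy.

(** * Iterated lifts of fixed degree *)

Section Tower.
Local Open Scope ring_scope.
Variable R : realType.
Variables (B Q D Qm w c : nat).
Hypothesis B_big : (31 <= B)%N.
Hypothesis Q_big : 2 * 512 ^+ 2 <= Q%:R :> R.
Hypothesis DE : D = (Q * B)%N.
Hypothesis Qm_big : 1024 * 1024 <= Qm%:R :> R.
Hypothesis Qm_le : (Qm <= 2 ^ D)%N.
Hypothesis w_big : (12 * Q + 5 <= w)%N.
Hypothesis tail : D%:R ^+ 2 * expR (- (D%:R * (1 / 512) ^+ 4 / 32)) <= (1 / 2) ^+ w :> R.
Hypothesis c_bounds : (4 <= c <= 6)%N.

(** Twice the ratio Qm / 2^D of translation range to fibre length in the first lift. Step [t] adds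
    at most eta0 / 2^(t + 1) to the exceptional fraction, so the total remains below 2 eta0. *)
Definition eta0 : R := 2 * Qm%:R / 2 ^+ D.

(* [c] is the ratio between the number of binary digits of [N] and the degree
   [D * 2 ^ t] of localization: the [u]th step is only sensitive to the binary digits
   of index between [c * D * 2 ^ u] and [c.+1 * D * 2 ^ u]. *)
Definition tower_level (t N : nat) (phi : 'I_D -> 'I_N -> 'I_N) :=
  [/\ N = (2 ^ (c * (D * 2 ^ t)))%N,
      forall i, injective (phi i),
      sparse_upto phi B (B * 2 ^ t),
      forall i, exists2 G : {set 'I_N}, increasing_on (phi i) G &
        #|~: G|%:R <= eta0 * (2 - (1 / 2) ^+ t) * N%:R &
      forall f : nat -> R, \sum_x avg_op phi (fun y : 'I_N => f y) x ^+ 2 <=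
        dyadic_energy (c * (D * 2 ^ t)) f (c * D) + 1 / 12 * \sum_(x < N) f x ^+ 2 +
        81 / 64 * \sum_(u < t) (dyadic_energy (c * (D * 2 ^ t)) f (c.+1 * (D * 2 ^ u)) -
                                dyadic_energy (c * (D * 2 ^ t)) f (c * (D * 2 ^ u)))].

Let Q_gt0 : (0 < Q)%N.
Proof. by rewrite -(ltr0n R); apply: lt_le_trans Q_big; rewrite mulr_gt0 // exprn_gt0. Qed.
Let B_gt0 : (0 < B)%N. Proof. exact: leq_trans B_big. Qed.
Let D_gt0 : (0 < D)%N. Proof. by rewrite DE muln_gt0 Q_gt0. Qed.
Let B_le_D : (B <= D)%N. Proof. by rewrite DE leq_pmull. Qed.

(** Translations by less than [D] start the tower. Two points determine the translation between
    them, so a set of at most [B] points is sparse; and since all c D digits count as coarse, plain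
    contraction is enough. *)
Lemma tower_base : exists N (phi : 'I_D -> 'I_N -> 'I_N), tower_level 0 phi.
Proof.
pose N := (2 ^ (c * D))%N.
have DN : (D <= N)%N.
  apply: ltnW; apply: leq_trans (ltn_expl D (ltnSn 1)) _.
  by rewrite leq_exp2l // leq_pmull //; case/andP: c_bounds; clear; lia.
have N0 : (0 < N)%N by rewrite expn_gt0.
exists N, (fun i x => shift i x); split.
- by rewrite /N expn0 muln1.
- by move=> i; exact: shift_inj.
- move=> S; rewrite expn0 muln1 => SB.
  apply: (@leq_trans (#|S| * #|S|)); last by rewrite leq_mul2r SB orbT.
  rewrite -cardsX -(card_imset (f := fun e : 'I_D * 'I_N => (e.2, shift e.1 e.2))); last first.
    move=> [i x] [j y] /= [<- /eqP]; rewrite eqn_modDl !modn_small ?(leq_trans (ltn_ord _)) //.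
    by move=> /eqP /val_inj ->.
  apply: subset_leq_card; apply/subsetP => _ /imsetP[e + ->].
  by rewrite !inE.
- move=> i; exists [set x : 'I_N | (x + i < N)%N].
    by move=> x y; rewrite !inE => xi yi xy; rewrite /= !modn_small // ltn_add2r.
  have h : (#|~: [set x : 'I_N | (x + i < N)%N]| <= i)%N.
    rewrite -[leqRHS]card_ord.
    pose h (x : 'I_N) : nat := (x + i - N)%N.
    (* The wrapped points are injected into 'I_i by their excess over [N]; [i = 0] is treated apart,
       since [inord] needs a nonempty target. *)
    rewrite -(card_in_imset (f := fun x : 'I_N => (inord (x + i - N) : 'I_(i.-1.+1)))); last first.
      move=> x y; rewrite !inE -!leqNgt => xi yi /(congr1 val) /=.
      rewrite !inordK; [|move: yi (ltn_ord y); clear; lia|move: xi (ltn_ord x); clear; lia].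
      by move=> e; apply/val_inj => /=; move: xi yi e; clear; lia.
    have [i0|i0] := posnP i; last by rewrite -[X in (_ <= #|'I_X|)%N](prednK i0) max_card.
    rewrite [X in (X <= _)%N](_ : _ = 0%N) //; apply/eqP; rewrite cards_eq0; apply/eqP/setP => z.
    rewrite !inE; apply/imsetP => -[x + _]; rewrite !inE -leqNgt => xN.
    by move: (ltn_ord x); rewrite ltnNge; move: xN; rewrite i0 addn0 => ->.
  apply: (@le_trans _ _ D%:R); first by rewrite ler_nat (leq_trans h) // ltnW.
  rewrite expr0 /eta0.
  have D2 : D%:R <= 2 ^+ D :> R by rewrite -natrX ler_nat ltnW // ltn_expl.
  have p : 0 < 2 ^+ D :> R by rewrite exprn_gt0.
  have NE : N%:R = 2 ^+ D * (2 ^ (c.-1 * D))%:R :> R.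
    by rewrite -natrX -natrM -expnD /N -mulSn; congr ((2 ^ (_ * _))%:R); case/andP: c_bounds; clear; lia.
  have [k1 k2] : 1 <= Qm%:R :> R /\ (D%:R <= (2 ^ (c.-1 * D))%:R :> R).
    split; first by have := Qm_big; lra.
    rewrite ler_nat; apply: ltnW; apply: leq_trans (ltn_expl D (ltnSn 1)) _.
    by rewrite leq_exp2l // leq_pmull //; case/andP: c_bounds; clear; lia.
  have -> : 2 * Qm%:R / 2 ^+ D * (2 - 1) * N%:R = 2 * (Qm%:R * (2 ^ (c.-1 * D))%:R) :> R.
    by rewrite NE; field; rewrite gt_eqF.
  have Dr : 0 <= D%:R :> R by rewrite ler0n.
  have : 1 * D%:R <= Qm%:R * (2 ^ (c.-1 * D))%:R :> R by apply: ler_pM.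
  lra.
- move=> f; rewrite big_ord0 mulr0 addr0 expn0 muln1 dyadic_energy_full.
  apply: le_trans (avg_op_contraction _ D_gt0 _) _; first by move=> i; exact: shift_inj.
  by rewrite lerDl; apply: mulr_ge0; [lra|apply: sumr_ge0 => x _; exact: sqr_ge0].
Qed.

(** With e = D 2^t, the c e digits of a fibre are split into e leading ones, the new window, and (c
    - 1) e trailing ones, a block of length [L]; translations reach over [Qm] blocks. *)
Lemma tower_step t N (phi : 'I_D -> 'I_N -> 'I_N) : tower_level t phi ->
  exists N' (phi' : 'I_D -> 'I_N' -> 'I_N'), tower_level t.+1 phi'.
Proof.
case=> NE phi_inj phi_sparse phi_mono phi_spec.
have [e eE] : exists e, e = (D * 2 ^ t)%N by eexists.
have [sigma sE] : exists s, s = (B * 2 ^ t)%N by eexists.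
have [K KE] : exists K, K = (2 ^ e)%N by eexists.
have [L LE] : exists L, L = (2 ^ (c.-1 * e))%N by eexists.
have [m mE] : exists m, m = (Qm * L)%N by eexists.
rewrite -eE in NE phi_spec; rewrite -sE in phi_sparse.
have [c4 c6] := andP c_bounds.
have cE : (c = c.-1.+1)%N by move: c4; case: (c).
have nE : (K * L = 2 ^ (c * e))%N by rewrite KE LE -expnD -mulSn -cE.
have De : (D <= e)%N by rewrite eE leq_pmulr // expn_gt0.
have se : (sigma <= e)%N by rewrite sE eE leq_mul2r B_le_D orbT.
have eQ : e = (Q * sigma)%N by rewrite eE sE DE mulnA.
have s0 : (0 < sigma)%N by rewrite sE muln_gt0 B_gt0 expn_gt0.
have e0 : (0 < e)%N by rewrite eQ muln_gt0 Q_gt0.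
have L0 : (0 < L)%N by rewrite LE expn_gt0.
have K0 : (0 < K)%N by rewrite KE expn_gt0.
have Lr : 0 < L%:R :> R by rewrite ltr0n.
have B_small : 2 * B%:R <= (1 / 512) ^+ 2 * D%:R :> R.
  have h : 2 * 512 ^+ 2 * B%:R <= D%:R :> R.
    by rewrite DE natrM; apply: ler_wpM2r Q_big; rewrite ler0n.
  have p : 0 <= (1 / 512) ^+ 2 :> R by exact: sqr_ge0.
  apply: le_trans (ler_wpM2l p h); rewrite le_eqVlt; apply/orP; left; apply/eqP.
  by field.
have r01 : 0 <= (1 / 2 : R) ^+ w <= 1 / 2.
  have w0 : (0 < w)%N by apply: leq_trans w_big; rewrite addn_gt0 orbT.
  have h0 : 0 <= (1 / 2 : R) by lra.
  rewrite exprn_ge0 //= -(prednK w0) exprS -[leRHS]mulr1; apply: ler_wpM2l => //.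
  by apply: exprn_ile1 => //; lra.
(* In binary exponents, 5 + 2 c e <= (12 Q + 5) sigma, by c <= 6 and e = Q sigma. The rate [w] is
   thus bounded below in terms of [Q] alone. *)
have r_total : 32 * (K * L)%:R * N%:R * ((1 / 2) ^+ w) ^+ sigma <= 1 :> R.
  rewrite nE NE -exprM div1r exprVn ler_pdivrMr ?exprn_gt0 // mul1r.
  have -> : 32 = (2 ^ 5)%N%:R :> R by [].
  rewrite -!natrM -natrX ler_nat -!expnD leq_exp2l //.
  have h1 : (c * e <= 6 * e)%N by rewrite leq_mul2r c6 orbT.
  have h2 : ((12 * Q + 5) * sigma <= w * sigma)%N by rewrite leq_mul2r w_big orbT.
  apply: leq_trans h2; rewrite mulnDl -mulnA -eQ; clear -h1 s0; lia.
have m_big : 1024 * 1024 * L%:R <= m%:R :> R.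
  by rewrite mE natrM; apply: ler_wpM2r; [exact: ltW|exact: Qm_big].
have m_le : (m <= K * L)%N.
  by rewrite mE leq_mul2r; apply/orP; right; apply: leq_trans Qm_le _; rewrite KE leq_exp2l.
have Qm4 : (4 <= Qm)%N.
  by rewrite -(ler_nat R); apply: le_trans Qm_big; lra.
(* Here c >= 4 is used: (2 sigma)^2 K is at most 4 * 2^(3 e), to be compared with Qm * 2^((c - 1)
   e). *)
have kappa_m : ((2 * sigma) ^ 2 * K <= m)%N.
  have h1 : (sigma <= 2 ^ e)%N by apply: leq_trans se _; apply: ltnW; exact: ltn_expl.
  have h2 : ((2 * sigma) ^ 2 <= 4 * (2 ^ e * 2 ^ e))%N.
    by rewrite -mulnn mulnACA; apply: leq_mul => //; exact: leq_mul.
  apply: (@leq_trans (4 * (2 ^ e * 2 ^ e) * K)); first by rewrite leq_mul2r h2 orbT.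
  rewrite -mulnA mE; apply: leq_mul Qm4 _.
  rewrite KE LE -!expnD leq_exp2l //.
  have : (3 * e <= c.-1 * e)%N by rewrite leq_mul2r -ltnS -cE c4 orbT.
  by clear; lia.
(* In binary exponents, 6 + 4 c e + D <= 31 e <= B e, which is the origin of the bound 31. *)
have kappa_big : (64 * ((N * (K * L)) ^ 2 * 2 ^ D) <= K ^ B)%N.
  rewrite nE NE -expnD -expnM KE -expnM -expnD.
  have -> : (64 = 2 ^ 6)%N by [].
  rewrite -expnD leq_exp2l //.
  have h1 : (c * e <= 6 * e)%N by rewrite leq_mul2r c6 orbT.
  have h2 : (e * 31 <= e * B)%N by rewrite leq_mul2l B_big orbT.
  by clear -h1 h2 De e0; lia.
have [s [s_sparse s_cuts]] := exists_lift phi_inj phi_sparse D_gt0 L0 B_small r01 tail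
  r_total m_big m_le K0 kappa_m kappa_big.
exists (N * (K * L))%N, (lift_map phi s); split.
- by rewrite nE NE -expnD expnS (mulnCA D) -eE; congr (2 ^ _)%N; clear; lia.
- by move=> i; exact: lift_map_inj.
- have s2 : (sigma.*2 = B * 2 ^ t.+1)%N by rewrite sE expnS mulnCA mul2n.
  by rewrite -s2.
- move=> i; have [G incG bigG] := phi_mono i.
  have s_le x : (s (i, x) <= m)%N by exact: ltnW.
  have [G' incG' bad] := @lift_increasing N (K * L) D m phi s i m G s_le incG.
  exists G' => //.
  have bad_real : #|~: G'|%:R <=
     #|~: G|%:R * (K * L)%:R + N%:R * m%:R :> R by rewrite -!natrM -natrD ler_nat.
  apply: le_trans bad_real _.
  have KLr : 0 < (K * L)%:R :> R by rewrite ltr0n muln_gt0 K0.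
  have mK : m%:R <= eta0 * (1 / 2) ^+ t.+1 * (K * L)%:R :> R.
    have h1 : (D + t <= e)%N.
      rewrite eE; have h : (t.+1 <= 2 ^ t)%N by exact: ltn_expl.
      apply: (@leq_trans (D * t.+1)); last by rewrite leq_mul2l h orbT.
      by rewrite mulnS leq_add2l leq_pmull.
    have h2 : 2 ^+ D * 2 ^+ t <= K%:R :> R by rewrite -exprD KE natrX ler_weXn2l // ler1n.
    have p1 : 0 < 2 ^+ D :> R by rewrite exprn_gt0.
    have p2 : 0 < 2 ^+ t :> R by rewrite exprn_gt0.
    have -> : eta0 * (1 / 2) ^+ t.+1 * (K * L)%:R = m%:R * (K%:R / (2 ^+ D * 2 ^+ t)) :> R.
      by rewrite /eta0 mE !natrM div1r exprVn exprS; field; rewrite !gt_eqF.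
    rewrite -[leLHS]mulr1; apply: ler_wpM2l; first by rewrite ler0n.
    by rewrite ler_pdivlMr ?mul1r // mulr_gt0.
  have Nr : 0 <= N%:R :> R by rewrite ler0n.
  have g1 := ler_wpM2r (ltW KLr) bigG.
  have g2 := ler_wpM2l Nr mK.
  apply: le_trans (lerD g1 g2) _.
  rewrite (natrM _ N) le_eqVlt; apply/orP; left; apply/eqP.
  by rewrite exprS; move: ((1 / 2) ^+ t) => q; field.
move=> f; have [b bE] : exists b, b = (c * e)%N by eexists.
have n0 : (0 < K * L)%N by rewrite muln_gt0 K0.
pose g := fiber_mean (K * L) f.
have gE (x : 'I_N) : \sum_(v < K * L) f (join x v) = (K * L)%:R * g x.
  by rewrite /g /fiber_mean mulrA divff ?mul1r // pnatr_eq0 -lt0n.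
have lev := level_inequality phi_inj D_gt0 L0 n0 s_cuts (f := fun y : 'I_(N * (K * L)) => f y) (g := fun x : 'I_N => g x) gE.
apply: (le_trans lev) => {lev}.
have J2 : (c * (D * 2 ^ t.+1) = b + b)%N by rewrite bE expnS (mulnCA D) -eE; clear; lia.
have specg := phi_spec g; rewrite -bE in specg.
have KLn : (K * L = 2 ^ b)%N by rewrite nE bE.
have E1 : (K * L)%:R * \sum_(x < N) g x ^+ 2 = dyadic_energy (b + b) f b.
  have -> : \sum_(x < N) g x ^+ 2 = dyadic_energy b g b.
    by rewrite dyadic_energy_full bE -NE.
  by rewrite /g KLn dyadic_energy_fiber_mean.
have E2 : \sum_(x < N) \sum_(a < K) (\sum_(j < L) f (join x (join a j))) ^+ 2 / L%:R =
    dyadic_energy (b + b) f (c.+1 * e).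
  have -> : dyadic_energy (b + b) f (c.+1 * e) = energy (N * K) L f.
    rewrite /dyadic_energy LE KE NE -expnD mulSnr -bE; congr (energy _ _ f).
    have bb : b = (c.-1 * e + e)%N by rewrite bE {1}cE mulSnr.
    by congr (2 ^ _)%N; rewrite bb; move: (c.-1 * e)%N; clear; lia.
  rewrite /energy sumr_join; apply: eq_bigr => x _; apply: eq_bigr => a _.
  congr (_ ^+ 2 / _); apply: eq_bigr => j _; congr f => /=; clear; lia.
have KLr : 0 <= (K * L)%:R :> R by rewrite ler0n.
have sg := ler_wpM2l KLr specg.
have cDb : (c * D <= b)%N by rewrite bE leq_mul2l De orbT.
have E3 : (K * L)%:R * dyadic_energy b g (c * D) = dyadic_energy (b + b) f (c * D).
  by rewrite /g KLn dyadic_energy_fiber_mean.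
have E4 : (K * L)%:R * \sum_(u < t) (dyadic_energy b g (c.+1 * (D * 2 ^ u)) - dyadic_energy b g (c * (D * 2 ^ u))) =
   \sum_(u < t) (dyadic_energy (b + b) f (c.+1 * (D * 2 ^ u)) - dyadic_energy (b + b) f (c * (D * 2 ^ u))).
  rewrite mulr_sumr; apply: eq_bigr => u _; rewrite mulrBr /g KLn.
  have u1 : (2 * (D * 2 ^ u) <= e)%N.
    by rewrite mulnCA -expnS eE leq_mul2l leq_exp2l // ltn_ord orbT.
  rewrite !dyadic_energy_fiber_mean //.
    by rewrite bE leq_mul2l; apply/orP; right; clear -u1; lia.
  apply: (@leq_trans (c * (2 * (D * 2 ^ u)))); last by rewrite bE leq_mul2l u1 orbT.
  by rewrite (mulnA c 2) leq_mul2r; apply/orP; right; clear -c4; lia.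
(* The new bracket is the summand [u = t], and the terms 1/12 times the energy of the first c e
   digits, one from each inequality, cancel. *)
rewrite J2 big_ord_recr /= -eE -bE -E2.
move: sg; rewrite 2!mulrDr E3 [_ * (81 / 64 * _)]mulrCA E4 [_ * (1 / 12 * _)]mulrCA E1.
set S1 := \sum_(u < t) _; set S2 := \sum_x \sum_a _; set A := dyadic_energy _ _ (c * D); set C := dyadic_energy _ _ b.
set T := \sum_x avg_op _ _ _ ^+ 2; set U := \sum_y _ ^+ 2.
move: ((K * L)%:R * T) => T'; lra.
Qed.

Lemma tower_exists t : exists N (phi : 'I_D -> 'I_N -> 'I_N), tower_level t phi.
Proof.
elim: t => [|t [N [phi h]]]; first exact: tower_base.
exact: tower_step h.
Qed.

(** Appends [k] digits on which the maps act trivially, in order to bring towers with different [c]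
    to a common size. Nothing contracts there, so the whole energy of these digits enters the
    bound. *)
Lemma tower_passive t (k : nat) N (phi : 'I_D -> 'I_N -> 'I_N) (J := (c * (D * 2 ^ t) + k)%N) :
  tower_level t phi ->
  exists N' (phi' : 'I_D -> 'I_N' -> 'I_N'),
  [/\ N' = (2 ^ J)%N, forall i, injective (phi' i),
      forall i, exists2 G : {set 'I_N'}, increasing_on (phi' i) G &
        #|~: G|%:R <= 2 * eta0 * N'%:R &
      forall f : nat -> R, \sum_x avg_op phi' (fun y : 'I_N' => f y) x ^+ 2 <=
        dyadic_energy J f (c * D) + 1 / 12 * \sum_(x < N') f x ^+ 2 +
        81 / 64 * (\sum_(u < t) (dyadic_energy J f (c.+1 * (D * 2 ^ u)) -
                                 dyadic_energy J f (c * (D * 2 ^ u)))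
                   + (dyadic_energy J f J - dyadic_energy J f (c * (D * 2 ^ t))))].
Proof.
case=> NE phi_inj _ phi_mono phi_spec.
have [b bE] : exists b, b = (c * (D * 2 ^ t))%N by eexists.
rewrite /J {J} -bE; rewrite -bE in NE phi_spec.
have [n nE] : exists n, n = (2 ^ k)%N by eexists.
have n0 : (0 < n)%N by rewrite nE expn_gt0.
have nr : 0 < n%:R :> R by rewrite ltr0n.
pose s (_ : 'I_D * 'I_N) : 'I_1 := ord0.
have phi'_inj i : injective (@lift_map N n D 1 phi s i) by exact: lift_map_inj.
have NnE : (N * n = 2 ^ (b + k))%N by rewrite NE nE expnD.
exists (N * n)%N, (lift_map phi s); split=> //.
  move=> i; have [G incG bigG] := phi_mono i.
  have [G' incG' bad] := @lift_increasing N n D 1 phi s i 0 G (fun x => leqnn 0) incG.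
  exists G' => //; rewrite muln0 addn0 in bad.
  apply: (@le_trans _ _ (#|~: G|%:R * n%:R)); first by rewrite -natrM ler_nat.
  rewrite natrM mulrA; apply: ler_wpM2r; first exact: ltW.
  apply: le_trans bigG _; apply: ler_wpM2r; first by rewrite ler0n.
  have e0 : 0 <= eta0 by rewrite /eta0 divr_ge0 ?exprn_ge0 // mulr_ge0 // ltW.
  have q0 : 0 <= (1 / 2 : R) ^+ t by rewrite exprn_ge0 // divr_ge0.
  have := mulr_ge0 e0 q0; lra.
move=> f; pose g := fiber_mean n f.
have gE (x : 'I_N) : \sum_(v < n) f (join x v) = n%:R * g x.
  by rewrite /g /fiber_mean mulrA divff ?mul1r // pnatr_eq0 -lt0n.
have [F [_ _ e1 e2]] := lift_split phi s (f := fun y : 'I_(N * n) => f y) (g := fun x : 'I_N => g x) gE.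
have contr := avg_op_contraction F D_gt0 phi'_inj.
rewrite e1; rewrite e2 in contr.
have sg := ler_wpM2l (ltW nr) (phi_spec g).
have E1 : n%:R * \sum_(x < N) g x ^+ 2 = dyadic_energy (b + k) f b.
  have -> : \sum_(x < N) g x ^+ 2 = dyadic_energy b g b by rewrite dyadic_energy_full -NE.
  by rewrite /g nE dyadic_energy_fiber_mean.
have [c4 c6] := andP c_bounds.
have E3 : n%:R * dyadic_energy b g (c * D) = dyadic_energy (b + k) f (c * D).
  by rewrite /g nE dyadic_energy_fiber_mean // bE leq_mul2l leq_pmulr ?orbT // expn_gt0.
have E4 : n%:R * \sum_(u < t) (dyadic_energy b g (c.+1 * (D * 2 ^ u)) - dyadic_energy b g (c * (D * 2 ^ u))) =
   \sum_(u < t) (dyadic_energy (b + k) f (c.+1 * (D * 2 ^ u)) - dyadic_energy (b + k) f (c * (D * 2 ^ u))).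
  rewrite mulr_sumr; apply: eq_bigr => u _; rewrite mulrBr /g nE.
  have u1 : (2 * (D * 2 ^ u) <= D * 2 ^ t)%N.
    by rewrite mulnCA -expnS leq_mul2l leq_exp2l // ltn_ord orbT.
  rewrite !dyadic_energy_fiber_mean //.
    by rewrite bE leq_mul2l; apply/orP; right; clear -u1; lia.
  apply: (@leq_trans (c * (2 * (D * 2 ^ u)))); last by rewrite bE leq_mul2l u1 orbT.
  by rewrite (mulnA c 2) leq_mul2r; apply/orP; right; clear -c4; lia.
have E5 : dyadic_energy (b + k) f (b + k) = \sum_(x < N * n) f x ^+ 2.
  by rewrite dyadic_energy_full NnE.
move: sg contr; rewrite 2!mulrDr E3 [_ * (81 / 64 * _)]mulrCA E4 [_ * (1 / 12 * _)]mulrCA E1 E5.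
set S1 := \sum_(u < t) _; set A := dyadic_energy _ _ (c * D); set C := dyadic_energy _ _ b.
have U0 : 0 <= \sum_y avg_op (lift_map phi s) F y ^+ 2 by apply: sumr_ge0 => y _; exact: sqr_ge0.
by move: U0; set U := \sum_y avg_op _ F y ^+ 2; set W := \sum_(x < N * n) f x ^+ 2; set T := \sum_x _; lra.
Qed.

End Tower.

(** * Rotations by multiples of a block length *)

Section Rotations.
Local Open Scope ring_scope.
Variable R : realType.
Variables (M wd : nat).
Hypothesis M_gt0 : (0 < M)%N.
Hypothesis wd_gt0 : (0 < wd)%N.

Definition rotation (j : 'I_M) (y : 'I_(M * wd)) := shift (j * wd) y.

Lemma rotation_join j a b : rotation j (join a b) = join (shift j a) b.
Proof.
apply/val_inj => /=; have -> : (a * wd + b + j * wd = (a + j) * wd + b)%N by rewrite mulnDl addnAC.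
rewrite {1}(divn_eq (a + j) M) mulnDl -mulnA -addnA modnMDl modn_small //.
by have := ltn_ord (join (shift j a) b).
Qed.

Lemma shift_injl n (v : 'I_n) : injective (fun j : 'I_n => shift j v).
Proof.
move=> i j /(congr1 val) /= /eqP; rewrite eqn_modDl !modn_small // => /eqP; exact: val_inj.
Qed.

(** Averaging over all rotations leaves a function of the position inside a block. The block means
    sum to zero and can be subtracted first; convexity does the rest. *)
Lemma rotation_average (f : nat -> R) : \sum_(x < M * wd) f x = 0 ->
  \sum_x avg_op rotation (fun y : 'I_(M * wd) => f y) x ^+ 2 <=
  \sum_(x < M * wd) f x ^+ 2 - energy M wd f.
Proof.
move=> f0; have Mr : 0 < M%:R :> R by rewrite ltr0n.
have wr : 0 < wd%:R :> R by rewrite ltr0n.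
pose mu (a : 'I_M) := wd%:R^-1 * \sum_(b < wd) f (join a b).
pose F (a : 'I_M) (b : 'I_wd) := f (join a b) - mu a.
have mu0 : \sum_a mu a = 0 by rewrite -mulr_sumr -(sumr_join (fun y : 'I_(M * wd) => f y)) f0 mulr0.
have opE a b : avg_op rotation (fun y : 'I_(M * wd) => f y) (join a b) = M%:R^-1 * \sum_c F c b.
  rewrite /avg_op sumrB mu0 subr0; congr (_ * _).
  rewrite [RHS](reindex_inj (@shift_injl M a)); apply: eq_bigr => j _.
  by rewrite rotation_join.
rewrite sumr_join.
apply: (@le_trans _ _ (\sum_(a < M) \sum_b M%:R^-1 * \sum_c F c b ^+ 2)).
  apply: ler_sum => a _; apply: ler_sum => b _; rewrite opE.
  by have := sqr_avg_le (fun c : 'I_M => F c b); rewrite card_ord.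
rewrite sum_const_natl card_ord -mulr_sumr mulrA divff ?gt_eqF // mul1r exchange_big /=.
rewrite (sumr_join (fun y : 'I_(M * wd) => f y ^+ 2)) /energy -sumrB le_eqVlt; apply/orP; left; apply/eqP.
apply: eq_bigr => a _.
rewrite (eq_bigr (fun b => f (join a b) ^+ 2 - 2 * mu a * f (join a b) + mu a ^+ 2)); last by move=> b _; rewrite /F; ring.
rewrite big_split sumrB /= sum_const_natl card_ord -mulr_sumr /mu /=.
by move: (\sum_(b < wd) f _) => x; field; rewrite gt_eqF.
Qed.

Lemma rotation_inj j : injective (rotation j).
Proof. exact: shift_inj. Qed.

(** The boolean separates the points that wrap around from the others. Both parts are kept, so
    rotations have no exceptional points. *)
Lemma rotation_increasing j (b : bool) :
  increasing_on (rotation j) [set y : 'I_(M * wd) | (y + j * wd < M * wd)%N == b].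
Proof.
move=> x y; rewrite !inE /rotation /= => /eqP hx /eqP hy xy.
have jM : (j * wd < M * wd)%N by rewrite ltn_pmul2r.
case: b hx hy => hx hy; first by rewrite !modn_small // ltn_add2r.
have wrap (z : 'I_(M * wd)) : (z + j * wd < M * wd)%N = false -> ((z + j * wd) %% (M * wd) = z + j * wd - M * wd)%N.
  move=> /negbT; rewrite -leqNgt => h; rewrite -{1}(subnK h) modnDr modn_small //.
  by rewrite ltn_subLR // -addnS leq_add // ltnW.
rewrite !wrap //; have xy' : (x + j * wd < y + j * wd)%N by rewrite ltn_add2r.
by apply: ltn_sub2r => //; apply: leq_ltn_trans xy'; rewrite leqNgt hx.
Qed.

End Rotations.

(** * From contraction to expansion of sets *)

Section Support.
Local Open Scope ring_scope.
Variable R : realType.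

Lemma sum_indicator (T : finType) (S : {set T}) : \sum_x (x \in S)%:R = #|S|%:R :> R.
Proof.
by rewrite -sum1_card natr_sum [RHS]big_mkcond; apply: eq_bigr => x _; case: ifP.
Qed.

(** The averaged indicator of [E] still has sum p = #|E| and lives on [S], so by Cauchy-Schwarz p^2
    is at most #|S| times its squared norm. Density at most 3/5 bounds that norm by (7/8 + 3/40) p =
    19/20 p, and 20/19 >= 21/20. *)
Lemma spectral_expansion d N (phi : 'I_d -> 'I_N -> 'I_N) (E : {set 'I_N})
    (f := fun x : nat => (if insub x is Some y then (y \in E)%:R else 0) - #|E|%:R / N%:R : R) :
  (0 < d)%N -> (forall i, injective (phi i)) -> (5 * #|E| <= 3 * N)%N ->
  \sum_x avg_op phi (fun y : 'I_N => f y) x ^+ 2 <= 7 / 8 * \sum_(x < N) f x ^+ 2 ->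
  21 / 20 * #|E|%:R <= #|[set x | [exists i, phi i x \in E]]|%:R :> R.
Proof.
move=> d0 inj E35 hspec.
set S := [set x | _].
have [N0|N0] := posnP N.
  have -> : #|E| = 0%N by apply/eqP; rewrite -leqn0; apply: leq_trans (max_card _) _; rewrite card_ord N0.
  by rewrite mulr0 ler0n.
have Nr : 0 < N%:R :> R by rewrite ltr0n.
have dr : 0 < d%:R :> R by rewrite ltr0n.
set p := #|E|%:R in f hspec *.
have fE (y : 'I_N) : f y = (y \in E)%:R - p / N%:R by rewrite /f valK.
have sumE : \sum_(y < N) (y \in E)%:R = p by exact: sum_indicator.
have sumf2 : \sum_(x < N) f x ^+ 2 = p - p ^+ 2 / N%:R.
  rewrite (eq_bigr (fun y : 'I_N => (y \in E)%:R - 2 * (p / N%:R) * (y \in E)%:R + (p / N%:R) ^+ 2)); last first.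
    by move=> y _; rewrite fE; case: (y \in E) => /=; ring.
  rewrite big_split sumrB /= sumE sum_const_natl card_ord -mulr_sumr sumE; field; rewrite gt_eqF //.
pose g x := avg_op phi (fun y : 'I_N => (y \in E)%:R : R) x.
have gE x : g x = avg_op phi (fun y : 'I_N => f y) x + p / N%:R.
  rewrite /g /avg_op (eq_bigr (fun i => f (phi i x) + p / N%:R)); last by move=> i _; rewrite fE subrK.
  by rewrite big_split /= sum_const_natl card_ord mulrDr; congr (_ + _); rewrite mulrA mulVf ?mul1r ?gt_eqF.
have sumg : \sum_x g x = p.
  rewrite /g /avg_op -mulr_sumr exchange_big /= (eq_bigr (fun=> p)); last first.
    by move=> i _; rewrite -[RHS]sumE [RHS](reindex_inj (@inj i)).
  by rewrite sum_const_natl card_ord mulrA mulVf ?mul1r ?gt_eqF.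
have sumPf : \sum_x avg_op phi (fun y : 'I_N => f y) x = 0.
  rewrite (eq_bigr (fun x => g x - p / N%:R)); last by move=> x _; rewrite gE addrK.
  by rewrite sumrB sumg sum_const_natl card_ord; field; rewrite gt_eqF.
have sumg2 : \sum_x g x ^+ 2 = \sum_x avg_op phi (fun y : 'I_N => f y) x ^+ 2 + p ^+ 2 / N%:R.
  rewrite (eq_bigr (fun x => avg_op phi (fun y : 'I_N => f y) x ^+ 2 + 2 * (p / N%:R) * avg_op phi (fun y : 'I_N => f y) x + (p / N%:R) ^+ 2)); last first.
    by move=> x _; rewrite gE; ring.
  by rewrite !big_split /= -mulr_sumr sumPf mulr0 addr0 sum_const_natl card_ord; congr (_ + _); field; rewrite gt_eqF.
have supp x : x \notin S -> g x = 0.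
  rewrite inE => /existsPn h; rewrite /g /avg_op big1 ?mulr0 // => i _.
  by rewrite (negbTE (h i)).
have cs : p ^+ 2 <= #|S|%:R * \sum_x g x ^+ 2.
  rewrite -sumg.
  have h0 : 0 <= \sum_x (#|S|%:R * g x - (x \in S)%:R * p) ^+ 2.
    by apply: sumr_ge0 => x _; exact: sqr_ge0.
  have e : \sum_x (#|S|%:R * g x - (x \in S)%:R * p) ^+ 2 = #|S|%:R * (#|S|%:R * \sum_x g x ^+ 2 - p ^+ 2).
    rewrite (eq_bigr (fun x => #|S|%:R ^+ 2 * g x ^+ 2 - 2 * #|S|%:R * p * g x + p ^+ 2 * (x \in S)%:R)); last first.
      move=> x _; case: (boolP (x \in S)) => [_|/supp ->] /=; ring.
    have sumS : \sum_(y < N) (y \in S)%:R = #|S|%:R :> R by exact: sum_indicator.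
    have a1 : \sum_x #|S|%:R ^+ 2 * g x ^+ 2 = #|S|%:R ^+ 2 * \sum_x g x ^+ 2 by rewrite mulr_sumr.
    have a2 : \sum_x 2 * #|S|%:R * p * g x = 2 * #|S|%:R * p * p by rewrite -[in RHS]sumg mulr_sumr sumg.
    have a3 : \sum_(x < N) p ^+ 2 * (x \in S)%:R = p ^+ 2 * #|S|%:R by rewrite -sumS mulr_sumr.
    by rewrite big_split sumrB /= a1 a2 a3; ring.
  rewrite sumg; move: h0; rewrite e; have [S0|S0] := posnP #|S|.
    move=> _; have : p = 0.
      rewrite -sumg big1 // => x _; apply: supp.
      by apply/negP => xS; move/eqP: S0; rewrite cards_eq0 => /eqP S0; rewrite S0 inE in xS.
    by move=> ->; rewrite expr0n S0 mul0r.
  by rewrite pmulr_rge0 ?ltr0n // subr_ge0.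
have q35 : p / N%:R <= 3 / 5.
  rewrite ler_pdivrMr //; have : (5 * #|E|)%:R <= (3 * N)%:R :> R by rewrite ler_nat.
  by rewrite !natrM -/p; lra.
have p0 : 0 <= p by rewrite ler0n.
have [pz|pnz] := eqVneq p 0; first by rewrite pz mulr0 ler0n.
have pp : 0 < p by rewrite lt_def pnz p0.
rewrite sumf2 in hspec.
have tot : \sum_x g x ^+ 2 <= 19 / 20 * p.
  rewrite sumg2; have : p ^+ 2 / N%:R <= 3 / 5 * p.
    by rewrite expr2 -mulrA mulrC; apply: ler_wpM2r.
  by move: hspec; set U := \sum_x _; set V := p ^+ 2 / _; lra.
have S0 : 0 <= #|S|%:R :> R by rewrite ler0n.
have := le_trans cs (ler_wpM2l S0 tot); rewrite expr2 mulrA ler_pM2r // => h; lra.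
Qed.

End Support.

(** * Two towers and the rotations combined *)

Section MonotoneExpander.
Local Open Scope ring_scope.
Variable R : realType.
Variables (B Q D Qm w : nat).
Hypothesis B_big : (31 <= B)%N.
Hypothesis Q_big : 2 * 512 ^+ 2 <= Q%:R :> R.
Hypothesis DE : D = (Q * B)%N.
Hypothesis Qm_big : 1024 * 1024 <= Qm%:R :> R.
Hypothesis Qm_le : (Qm <= 2 ^ D)%N.
Hypothesis w_big : (12 * Q + 5 <= w)%N.
Hypothesis tail : D%:R ^+ 2 * expR (- (D%:R * (1 / 512) ^+ 4 / 32)) <= (1 / 2) ^+ w :> R.
Hypothesis loss : 1600 * D%:R * eta0 R D Qm <= 1.

Definition map_index := ('I_D + 'I_D + 'I_(2 ^ (6 * D)) * bool)%type.

(* The windows 4 D 2 ^ u .. 5 D 2 ^ u and 6 D 2 ^ u .. 7 D 2 ^ u of the towers with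
   c = 4 and c = 6 are disjoint, so a function cannot escape both of them. *)
Lemma energies_disjoint (ev : nat -> R) (J S : nat) : J = (8 * (D * 2 ^ S))%N ->
  (forall b b', (b <= b' <= J)%N -> ev b <= ev b') ->
  \sum_(u < S.+1) (ev (5 * (D * 2 ^ u))%N - ev (4 * (D * 2 ^ u))%N) +
  (\sum_(u < S) (ev (7 * (D * 2 ^ u))%N - ev (6 * (D * 2 ^ u))%N) + (ev J - ev (6 * (D * 2 ^ S))%N))
  <= ev J - ev (4 * D)%N.
Proof.
move=> JE mono; rewrite big_ord_recr /=.
suff H s : (s <= S)%N -> \sum_(u < s) (ev (5 * (D * 2 ^ u))%N - ev (4 * (D * 2 ^ u))%N) +
    \sum_(u < s) (ev (7 * (D * 2 ^ u))%N - ev (6 * (D * 2 ^ u))%N) <= ev (4 * (D * 2 ^ s))%N - ev (4 * D)%N.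
  have h := H S (leqnn S).
  have h56 : ev (5 * (D * 2 ^ S))%N <= ev (6 * (D * 2 ^ S))%N.
    by apply: mono; rewrite JE !leq_mul2r !orbT.
  lra.
elim: s => [|s IH] sS; first by rewrite !big_ord0 expn0 muln1 addr0 subrr.
rewrite !big_ord_recr /=; have h := IH (ltnW sS).
have sJ : (8 * (D * 2 ^ s) <= J)%N by rewrite JE leq_mul2l leq_mul2l leq_exp2l // (ltnW sS) !orbT.
have E : (4 * (D * 2 ^ s.+1) = 8 * (D * 2 ^ s))%N by rewrite expnS (mulnCA D) mulnA.
have h56 : ev (5 * (D * 2 ^ s))%N <= ev (6 * (D * 2 ^ s))%N.
  by apply: mono; rewrite (leq_trans _ sJ) ?leq_mul2r !orbT.
have h78 : ev (7 * (D * 2 ^ s))%N <= ev (8 * (D * 2 ^ s))%N.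
  by apply: mono; rewrite sJ ?leq_mul2r !orbT.
rewrite E; lra.
Qed.

Lemma card_setD_bigcup_le (T I : finType) (S S' : {set T}) (H : I -> {set T}) (q : nat) :
  S \subset S' :|: \bigcup_i H i -> (forall i, #|H i| <= q)%N -> (#|S| <= #|S'| + #|I| * q)%N.
Proof.
move=> /subset_leq_card h Hq; apply: leq_trans h _; apply: leq_trans (leq_card_setU _ _) _.
rewrite leq_add2l -sum_nat_const; apply: (@leq_trans (\sum_(i : I) #|H i|)%N); last first.
  by apply: leq_sum => i _; exact: Hq.
elim/big_rec2: _ => [|i n A _ hA]; first by rewrite cards0.
by apply: leq_trans (leq_card_setU _ _) _; rewrite leq_add2l.
Qed.

(** If the leading 6 D digits hold an eighth of the energy, the rotations contract. Otherwise one
    tower has at most half of the energy in its windows, and 1/8 + 1/12 + 81/128 < 7/8. *)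
Lemma monotone_family S : exists N (sigma : map_index -> 'I_N -> 'I_N) (G : map_index -> {set 'I_N}),
  [/\ N = (2 ^ (8 * (D * 2 ^ S)))%N,
      forall i, increasing_on (sigma i) (G i) &
      forall E : {set 'I_N}, (N <= 20 * #|E|)%N -> (5 * #|E| <= 3 * N)%N ->
        (41 * #|E| <= 40 * #|[set x | [exists i, (x \in G i) && (sigma i x \in E)]]|)%N].
Proof.
have Q_gt0 : (0 < Q)%N.
  by rewrite -(ltr0n R); apply: lt_le_trans Q_big; rewrite mulr_gt0 // exprn_gt0.
have D_gt0 : (0 < D)%N by rewrite DE muln_gt0 Q_gt0 (leq_trans _ B_big).
have Dr : 0 < D%:R :> R by rewrite ltr0n.
have [J JE] : exists J, J = (8 * (D * 2 ^ S))%N by eexists.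
have J6 : (6 * D <= J)%N by rewrite JE leq_mul // leq_pmulr // expn_gt0.
have [M ME] : exists M, M = (2 ^ (6 * D))%N by eexists.
have [wd wdE] : exists wd, wd = (2 ^ (J - 6 * D))%N by eexists.
have M0 : (0 < M)%N by rewrite ME expn_gt0.
have wd0 : (0 < wd)%N by rewrite wdE expn_gt0.
have NJ : (M * wd = 2 ^ J)%N by rewrite ME wdE -expnD subnKC.
have four : (4 <= 4 <= 6)%N by []. have six : (4 <= 6 <= 6)%N by [].
(* Common size: S + 1 steps with c = 4 give 8 D 2^S digits; S steps with c = 6 give 6 D 2^S, to
   which 2 D 2^S passive digits are added. *)
have [N1 [phi1 lev1]] := tower_exists B_big Q_big DE Qm_big Qm_le w_big tail four S.+1.
have [N2 [phi2 lev2]] := tower_exists B_big Q_big DE Qm_big Qm_le w_big tail six S.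
have [NA [pA [eA injA incA specA]]] := tower_passive B_big Q_big DE four 0 lev1.
have [NB [pB [eB injB incB specB]]] := tower_passive B_big Q_big DE six (2 * (D * 2 ^ S)) lev2.
have JA : (4 * (D * 2 ^ S.+1) + 0 = J)%N by rewrite addn0 JE expnS (mulnCA D) mulnA.
have JB : (6 * (D * 2 ^ S) + 2 * (D * 2 ^ S) = J)%N by rewrite JE -mulnDl.
rewrite JA in eA specA; rewrite JB in eB specB.
have {}eA : NA = (M * wd)%N by rewrite NJ.
have {}eB : NB = (M * wd)%N by rewrite NJ.
subst NA NB.
pose GA i := projT1 (cid2 (incA i)); pose GB i := projT1 (cid2 (incB i)).
have GAP i : increasing_on (pA i) (GA i) /\ #|~: GA i|%:R <= 2 * eta0 R D Qm * (M * wd)%:R :> R.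
  by rewrite /GA; case: cid2.
have GBP i : increasing_on (pB i) (GB i) /\ #|~: GB i|%:R <= 2 * eta0 R D Qm * (M * wd)%:R :> R.
  by rewrite /GB; case: cid2.
rewrite /map_index -ME.
pose sigma (t : 'I_D + 'I_D + 'I_M * bool) : 'I_(M * wd) -> 'I_(M * wd) :=
  match t with inl (inl i) => pA i | inl (inr i) => pB i | inr (j, _) => rotation (wd := wd) j end.
pose G (t : 'I_D + 'I_D + 'I_M * bool) : {set 'I_(M * wd)} :=
  match t with inl (inl i) => GA i | inl (inr i) => GB i
  | inr (j, b) => [set y : 'I_(M * wd) | (y + j * wd < M * wd)%N == b] end.
exists (M * wd)%N, sigma, G; split.
- by rewrite NJ JE.
- by move=> [[i|i]|[j b]] /=; [case: (GAP i)|case: (GBP i)|exact: rotation_increasing].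
move=> E E20 E35; set T := [set x | _].
pose f := fun x : nat => (if insub x is Some y then ((y : 'I_(M * wd)) \in E)%:R else 0) - #|E|%:R / (M * wd)%:R : R.
have Nr : 0 < (M * wd)%:R :> R by rewrite ltr0n muln_gt0 M0.
have f_sum : \sum_(x < M * wd) f x = 0.
  rewrite (eq_bigr (fun y : 'I_(M * wd) => (y \in E)%:R - #|E|%:R / (M * wd)%:R)); last first.
    by move=> y _; rewrite /f valK.
  by rewrite sumrB sum_indicator sum_const_natl card_ord mulrC divfK ?subrr // gt_eqF.
have rot := rotation_average M0 wd0 f_sum.
set U := \sum_(x < M * wd) f x ^+ 2 in rot specA specB.
pose ev := dyadic_energy J f.
have evJ : ev J = U by rewrite /ev dyadic_energy_full -NJ.
have evM : ev (6 * D)%N = energy M wd f by rewrite /ev /dyadic_energy -ME -wdE.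
have U0 : 0 <= U by apply: sumr_ge0 => x _; exact: sqr_ge0.
have mono b b' : (b <= b' <= J)%N -> ev b <= ev b' by exact: dyadic_energy_mono.
have disj := energies_disjoint JE mono.
have ev0 b : 0 <= ev b by exact: energy_ge0.
have ev46 : ev (4 * D)%N <= ev (6 * D)%N by apply: mono; rewrite J6 leq_mul2r orbT.
have sA := specA f; have sB := specB f.
rewrite -!/(ev _) in sA sB.
have J8 : (4 * (D * 2 ^ S.+1) = J)%N by rewrite -JA addn0.
rewrite J8 subrr addr0 in sA.
rewrite -/U in sA; rewrite -/U evJ in sB.
(* Exceptional points cost at most N / 800, that is #|E| / 40, which lowers the factor 21/20 to
   41/40. *)
have fin (d : nat) (psi : 'I_d -> 'I_(M * wd) -> 'I_(M * wd)) (H : 'I_d -> {set 'I_(M * wd)}) (q : nat) :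
    (0 < d)%N -> (forall i, injective (psi i)) ->
    (forall x i, psi i x \in E -> x \in T :|: H i) ->
    (forall i, #|H i| <= q)%N -> 800 * (d%:R * q%:R) <= (M * wd)%:R :> R ->
    \sum_x avg_op psi (fun y : 'I_(M * wd) => f y) x ^+ 2 <= 7 / 8 * U ->
    (41 * #|E| <= 40 * #|T|)%N.
  move=> d0 psi_inj cover Hq lossq spec.
  have h := spectral_expansion d0 psi_inj E35 spec.
  have sub : [set x | [exists i, psi i x \in E]] \subset T :|: \bigcup_i H i.
    apply/subsetP => x; rewrite inE => /existsP [i /cover].
    rewrite !inE => /orP[->//|xH]; apply/orP; right; by apply/bigcupP; exists i.
  have := card_setD_bigcup_le sub Hq; rewrite card_ord -(ler_nat R) natrD natrM => h2.
  rewrite -(ler_nat R) !natrM.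
  have : (M * wd)%:R <= 20 * #|E|%:R :> R by rewrite -natrM ler_nat.
  lra.
have loss1 (H : 'I_D -> {set 'I_(M * wd)}) : (forall i, #|H i|%:R <= 2 * eta0 R D Qm * (M * wd)%:R) ->
    exists q : nat, (forall i, #|H i| <= q)%N /\ 800 * (D%:R * q%:R) <= (M * wd)%:R :> R.
  move=> Hb; pose q := Num.truncn (2 * eta0 R D Qm * (M * wd)%:R).
  have b0 : 0 <= 2 * eta0 R D Qm * (M * wd)%:R by apply: le_trans (Hb (Ordinal D_gt0)).
  exists q; split; first by move=> i; rewrite truncn_ge_nat.
  have qb : q%:R <= 2 * eta0 R D Qm * (M * wd)%:R by rewrite truncn_le.
  have d1 := ler_wpM2l (ltW Dr) qb; have d2 := ler_wpM2r (ltW Nr) loss; lra.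
have [big|small] := lerP (U / 8) (ev (6 * D)%N).
  apply: (fin M (rotation (wd := wd)) (fun=> set0) 0) => //.
  - by move=> j; exact: rotation_inj.
  - move=> x j xE; rewrite inE; apply/orP; left; rewrite inE; apply/existsP.
    by exists (inr (j, (x + j * wd < M * wd)%N)); rewrite /= inE eqxx.
  - by move=> i; rewrite cards0.
  - by rewrite mulr0 mulr0 ltW.
  - by apply: le_trans rot _; rewrite -evM; lra.
rewrite evJ in disj.
move: disj sA sB; set XA := \sum_(u < S.+1) _; set XB := \sum_(u < S) _ + _ => disj sA sB.
have [XA_small|XB_small] := lerP XA (U / 2).
  have [q [qH ql]] := loss1 (fun i => ~: GA i) (fun i => (GAP i).2).
  apply: (fin D pA (fun i => ~: GA i) q) => //.
    move=> x i xE; rewrite !inE; case: (boolP (x \in GA i)) => [xG|_]; last by rewrite orbT.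
    by rewrite orbF; apply/existsP; exists (inl (inl i)); rewrite /= xG.
  by apply: le_trans sA _; lra.
have [q [qH ql]] := loss1 (fun i => ~: GB i) (fun i => (GBP i).2).
apply: (fin D pB (fun i => ~: GB i) q) => //.
  move=> x i xE; rewrite !inE; case: (boolP (x \in GB i)) => [xG|_]; last by rewrite orbT.
  by rewrite orbF; apply/existsP; exists (inl (inr i)); rewrite /= xG.
by have := ev0 (4 * D)%N; move=> *; apply: le_trans sB _; lra.
Qed.

End MonotoneExpander.

(** * Choice of the constants *)

Section Calibration.
Local Open Scope ring_scope.
Variable R : realType.

Lemma sqr_le_exp2 n : (4 <= n)%N -> (n * n <= 2 ^ n)%N.
Proof.
elim: n => // n IH; rewrite leq_eqVlt => /orP[/eqP <- //|n4].
have := IH n4; rewrite expnS; nia.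
Qed.

(** The rate [w] is fixed by [Q] before [B] is chosen, so D = Q B can be enlarged freely: x^3 / 3!
    <= e^x beats D^2 2^w, and D^2 <= 2^D absorbs the exceptional points. *)
Lemma parameters (Q Qm w lam : nat) (C : R) : (0 < Q)%N -> (0 < lam)%N -> 0 < C ->
  exists B : nat, [/\ (31 <= B)%N, (Qm <= 2 ^ (Q * B))%N,
    (Q * B)%:R ^+ 2 * expR (- ((Q * B)%:R / C)) <= (1 / 2) ^+ w :> R &
    lam%:R * (Q * B)%:R * eta0 R (Q * B) Qm <= 1].
Proof.
move=> Q0 lam_gt0 C0.
pose b := Num.bound (6 * C ^+ 3 * 2 ^+ w).
exists (31 + lam * 2 * Qm + b)%N; set B := (_ + _)%N; set D := (Q * B)%N.
have BD : (B <= D)%N by rewrite leq_pmull.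
have D31 : (31 <= D)%N by apply: leq_trans BD; rewrite /B -!addnA leq_addr.
have D0 : 0 < D%:R :> R by rewrite ltr0n (leq_trans _ D31).
have DQm : (lam * 2 * Qm <= D)%N by apply: leq_trans BD; rewrite /B addnAC leq_addl.
have bD : 6 * C ^+ 3 * 2 ^+ w <= D%:R.
  apply: (@le_trans _ _ b%:R); last by rewrite ler_nat (leq_trans _ BD) // leq_addl.
  by apply/ltW/archi_boundP; rewrite !mulr_ge0 ?exprn_ge0 // ltW.
have D2 : (D * D <= 2 ^ D)%N by apply: sqr_le_exp2; apply: leq_trans D31.
split.
- by rewrite /B -!addnA leq_addr.
- apply: leq_trans D2; apply: (@leq_trans D); last by rewrite leq_pmulr // (leq_trans _ D31).
  by apply: leq_trans DQm; rewrite leq_pmull // muln_gt0 lam_gt0.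
- have x0 : 0 <= D%:R / C by rewrite divr_ge0 // ltW.
  have h := expR_ge1Dxn 2 x0.
  rewrite expRN ler_pdivrMr ?expR_gt0 //.
  have w0 : 0 < 2 ^+ w :> R by rewrite exprn_gt0.
  apply: (@le_trans _ _ ((1 / 2) ^+ w * ((D%:R / C) ^+ 3 / 3`!%:R))); last first.
    apply: ler_wpM2l; first by rewrite exprn_ge0 // divr_ge0.
    by apply: le_trans h; rewrite lerDr.
  have -> : (1 / 2) ^+ w * ((D%:R / C) ^+ 3 / 3`!%:R) = D%:R ^+ 2 * (D%:R / (6 * C ^+ 3 * 2 ^+ w)) :> R.
    have -> : 3`!%:R = 6 :> R by [].
    by rewrite div1r exprVn; field; rewrite !gt_eqF.
  rewrite ler_pMr ?exprn_gt0 // ler_pdivlMr ?mul1r //.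
  by rewrite !mulr_gt0 ?exprn_gt0.
- have p : 0 < 2 ^+ D :> R by rewrite exprn_gt0.
  have -> : lam%:R * D%:R * eta0 R D Qm = (D%:R * (lam * 2 * Qm)%:R) / 2 ^+ D.
    have e : (lam * 2 * Qm)%:R = lam%:R * 2 * Qm%:R :> R by rewrite !natrM.
    by rewrite /eta0 e; field; rewrite gt_eqF.
  rewrite ler_pdivrMr // mul1r -natrM -natrX ler_nat; apply: leq_trans D2.
  by rewrite leq_mul2l DQm orbT.
Qed.

Theorem monotone_expander : exists I : finType, (0 < #|I|)%N /\
  forall n : nat, exists N (sigma : I -> 'I_N -> 'I_N) (G : I -> {set 'I_N}),
  [/\ (n <= N)%N, forall i, increasing_on (sigma i) (G i) &
      forall E : {set 'I_N}, (N <= 20 * #|E|)%N -> (5 * #|E| <= 3 * N)%N ->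
        (41 * #|E| <= 40 * #|[set x | [exists i, (x \in G i) && (sigma i x \in E)]]|)%N].
Proof.
pose C : R := 512 ^+ 4 * 32.
have C0 : 0 < C by rewrite mulr_gt0 ?exprn_gt0.
have bound (x : R) : 0 <= x -> exists2 k : nat, (0 < k)%N & x <= k%:R.
  by move=> x0; exists (Num.bound x); [|exact/ltW/archi_boundP].
have [Q Q0 Qbig] : exists2 Q : nat, (0 < Q)%N & 2 * 512 ^+ 2 <= Q%:R :> R.
  by apply: bound; rewrite mulr_ge0 ?exprn_ge0.
have [Qm _ Qmbig] : exists2 Qm : nat, (0 < Qm)%N & 1024 * 1024 <= Qm%:R :> R.
  by apply: bound; rewrite mulr_ge0.
have [lam lam0 lam1600] : exists2 lam : nat, (0 < lam)%N & 1600 <= lam%:R :> R.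
  exact: bound.
have [B [B31 Qm_le tail loss]] := parameters Qm (12 * Q + 5) Q0 lam0 C0.
have [D DE] : exists D, D = (Q * B)%N by eexists.
rewrite -DE in Qm_le tail loss.
have tail' : D%:R ^+ 2 * expR (- (D%:R * (1 / 512) ^+ 4 / 32)) <= (1 / 2) ^+ (12 * Q + 5) :> R.
  have <- : D%:R / C = D%:R * (1 / 512) ^+ 4 / 32 by rewrite /C invfM div1r exprVn mulrA.
  exact: tail.
have loss' : 1600 * D%:R * eta0 R D Qm <= 1.
  apply: le_trans loss; rewrite -!mulrA; apply: ler_wpM2r => //.
  by apply: mulr_ge0; rewrite ?ler0n // /eta0 divr_ge0 ?exprn_ge0 // mulr_ge0.
exists (map_index D); split.
  by apply/card_gt0P; exists (inr (Ordinal (expn_gt0 2 (6 * D)), true)) => //.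
move=> n.
have [N [sigma [G [NE inc ex]]]] := monotone_family B31 Qbig DE Qmbig Qm_le (leqnn _) tail' loss' n.
exists N, sigma, G; split=> //; rewrite NE.
have D0 : (0 < D)%N by rewrite DE muln_gt0 Q0 (leq_trans _ B31).
apply: ltnW; apply: leq_trans (ltn_expl n (ltnSn 1)) _; rewrite leq_exp2l //.
apply: (@leq_trans (2 ^ n)); first by apply: ltnW; exact: ltn_expl.
by rewrite mulnA leq_pmull // muln_gt0.
Qed.

End Calibration.

(** * Ranks as positions, and deletion of a bad set *)

Section Pushdown.
Local Open Scope nat_scope.

(** Crossings depend only on the order of the positions, so an injective labelling by natural
    numbers may be replaced by ranks. *)
Lemma pushdown_of_injection (A B : finType) (adj : A -> B -> bool) k
    (p : vtx A B -> nat) (page : A -> B -> 'I_k) :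
  injective p ->
  (forall a1 b1 a2 b2, adj a1 b1 -> adj a2 b2 -> page a1 b1 = page a2 b2 ->
    ~ [/\ lo p a1 b1 < lo p a2 b2, lo p a2 b2 < hi p a1 b1 & hi p a1 b1 < hi p a2 b2]) ->
  (forall a1 b1 a2 b2, adj a1 b1 -> adj a2 b2 -> page a1 b1 = page a2 b2 ->
    (a1, b1) <> (a2, b2) -> a1 <> a2 /\ b1 <> b2) ->
  has_pushdown adj k.
Proof.
move=> p_inj nocross matching.
pose below v := [set u | p u < p v].
have below_lt v : #|below v| < #|vtx A B|.
  rewrite -cardsT; apply: proper_card; rewrite properEneq subsetT andbT.
  by apply/eqP => /setP /(_ v); rewrite !inE ltnn.
pose r v := Ordinal (below_lt v).
have rP u v : (r u < r v) = (p u < p v).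
  apply/idP/idP => /= [|uv].
    apply: contraTT; rewrite -!leqNgt => vu; apply: subset_leq_card; apply/subsetP => x.
    by rewrite !inE => /leq_trans; apply.
  apply: proper_card; apply/properP; split.
    by apply/subsetP => x; rewrite !inE => /ltn_trans; apply.
  by exists u; rewrite !inE ?ltnn.
exists r, page; split; last exact: matching.
split.
  move=> u v /(congr1 val) /= e; apply: p_inj; apply/eqP.
  by rewrite eqn_leq (leqNgt (p u)) (leqNgt (p v)) -!rP /= e ltnn.
move=> a1 b1 a2 b2 e1 e2 ep; have := nocross _ _ _ _ e1 e2 ep.
rewrite /lo /hi !(leq_min, gtn_min, leq_max, gtn_max) => h [h1 h2 h3]; apply: h.
by move: h1 h2 h3; rewrite !rP.
Qed.

Lemma subset_of_card (T : finType) (X : {set T}) k : k <= #|X| ->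
  exists2 Y : {set T}, Y \subset X & #|Y| = k.
Proof.
move=> kX; exists [set x in take k (enum X)].
  by apply/subsetP => x; rewrite inE => /mem_take; rewrite mem_enum.
rewrite cardsE (card_uniqP _) ?take_uniq ?enum_uniq // size_takel // -cardE //.
Qed.

Section Prune.
Variables (A B : finType) (adj : A -> B -> bool) (q : nat).
Hypothesis card_AB : #|A| = #|B|.
Hypothesis q_gt0 : 0 < q.
Hypothesis grow : forall S : {set A}, #|S| <= #|nbhd adj S|.
Hypothesis expand : forall S : {set A}, #|A| <= 10 * #|S| -> 5 * #|S| <= 3 * #|A| ->
  q.+1 * #|S| <= q * #|nbhd adj S|.

(* A largest small set violating the expansion is deleted with its neighbourhood:
   any further violation could be added to it. *)
Lemma prune : exists (A' : {set A}) (B' : {set B}),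
  [/\ #|A'| = #|B'|, #|A| <= 2 * #|A'| &
      forall S : {set A}, S \subset A' -> 2 * #|S| <= #|A'| ->
        q.+1 * #|S| <= q * #|nbhd adj S :&: B'|].
Proof.
pose P (S : {set A}) := (10 * #|S| <= #|A|) && (q * #|nbhd adj S| <= q.+1 * #|S|).
have nbhd0 : nbhd adj set0 = set0.
  by apply/setP => b; rewrite !inE; apply/existsP => -[a]; rewrite inE.
have P0 : P set0 by rewrite /P nbhd0 !cards0 !muln0.
have [X] : exists X, P X /\ forall Y, P Y -> #|Y| <= #|X|.
  by case: (arg_maxnP (fun S : {set A} => #|S|) P0) => X PX maxX; exists X; split.
case=> /andP[X10 Xbad] maxX.
have NX : #|nbhd adj X| <= 2 * #|X|.
  rewrite -(leq_pmul2l q_gt0); apply: leq_trans Xbad _.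
  by rewrite mulnA leq_mul2r muln2 -addnn -[q.+1]addn1 leq_add2l q_gt0 orbT.
(* By [grow] at least as many vertices lie outside [X] as outside its neighbourhood, so the first
   side can be trimmed to the size of the second. *)
have [|A' A'X cA'] := @subset_of_card _ (~: X) #|~: nbhd adj X|.
  have := cardsC X; have := cardsC (nbhd adj X); have := grow X; rewrite card_AB; lia.
exists A', (~: nbhd adj X); split=> //.
  by rewrite cA'; have := cardsC (nbhd adj X); rewrite card_AB in X10 *; lia.
move=> S SA S2.
have [->|S0] := eqVneq #|S| 0; first by rewrite muln0.
have SX : S :&: X = set0.
  apply/setP => x; rewrite !inE; apply/andP => -[xS xX].
  by have := subsetP A'X _ (subsetP SA _ xS); rewrite inE xX.
have cU : #|S :|: X| = #|S| + #|X| by rewrite cardsU SX cards0 subn0.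
have nU : #|nbhd adj (S :|: X)| <= #|nbhd adj S :&: ~: nbhd adj X| + #|nbhd adj X|.
  apply: leq_trans (leq_card_setU _ _); apply: subset_leq_card; apply/subsetP => b.
  rewrite !inE => /existsP [a /andP[]]; rewrite inE => /orP[aS|aX] ab.
    case: (boolP [exists a0 in X, adj a0 b]) => h; rewrite ?orbT // orbF andbT.
    by apply/existsP; exists a; rewrite aS.
  by apply/orP; right; apply/existsP; exists a; rewrite aX.
(* A small union cannot violate expansion, by maximality of [X]; a larger one has at most (1/2 +
   1/10) #|A| elements, where [expand] applies. *)
have main : q.+1 * #|S :|: X| <= q * #|nbhd adj (S :|: X)|.
  have [small|big] := leqP (10 * #|S :|: X|) #|A|.
    rewrite leqNgt; apply/negP => bad.
    have : P (S :|: X) by rewrite /P small ltnW.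
    by move=> /maxX; rewrite cU; move: S0; rewrite -lt0n; lia.
  apply: expand; first exact: ltnW.
  have : #|A'| <= #|A| by exact: max_card.
  by rewrite cU; lia.
have main2 : q * #|nbhd adj (S :|: X)| <= q * #|nbhd adj S :&: ~: nbhd adj X| + q * #|nbhd adj X|.
  by rewrite -mulnDr leq_mul2l nU orbT.
rewrite cU mulnDr in main.
have := leq_trans main main2; lia.
Qed.

Variables (k : nat) (p : vtx A B -> nat) (page : A -> B -> 'I_k).
Hypothesis p_inj : injective p.
Hypothesis nocross : forall a1 b1 a2 b2, adj a1 b1 -> adj a2 b2 -> page a1 b1 = page a2 b2 ->
    ~ [/\ lo p a1 b1 < lo p a2 b2, lo p a2 b2 < hi p a1 b1 & hi p a1 b1 < hi p a2 b2].
Hypothesis matching : forall a1 b1 a2 b2, adj a1 b1 -> adj a2 b2 -> page a1 b1 = page a2 b2 ->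
    (a1, b1) <> (a2, b2) -> a1 <> a2 /\ b1 <> b2.

Lemma pruned_pushdown_expander : exists (A' B' : finType) (adj' : A' -> B' -> bool),
  [/\ #|A| <= #|A'| + #|B'|, bip_expander adj' (q%:R^-1)%R & has_pushdown adj' k].
Proof.
have [X [Y [cXY X2 ex]]] := prune.
exists {x | x \in X}, {y | y \in Y}, (fun a b => adj (val a) (val b)).
have cX : #|{: {x | x \in X}}| = #|X| by rewrite card_sig; apply: eq_card => x; rewrite inE.
have cY : #|{: {y | y \in Y}}| = #|Y| by rewrite card_sig; apply: eq_card => x; rewrite inE.
split.
- by rewrite cX cY -cXY addnn -mul2n.
- split; first by rewrite cX cY.
  move=> S; rewrite cX => S2.
  have q0 : (0 < q%:R :> rat)%R by rewrite ltr0n.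
  have sX : val @: S \subset X by apply/subsetP => _ /imsetP[a _ ->]; exact: valP.
  have cS : #|val @: S| = #|S| by rewrite card_imset //; exact: val_inj.
  have S2' : 2 * #|val @: S| <= #|X|.
    rewrite cS -(ler_nat rat) natrM; move: S2; rewrite ler_pdivlMr //.
    by rewrite mulrC.
  have := ex _ sX S2'; rewrite cS.
  have -> : nbhd adj (val @: S) :&: Y = val @: nbhd (fun (a : {x | x \in X}) (b : {y | y \in Y}) => adj (val a) (val b)) S.
    apply/setP => b; apply/setIP/imsetP => [[]|[b' + ->]].
      rewrite inE => /existsP [_ /andP[/imsetP[a aS ->] ab]] bY.
      by exists (Sub b bY); rewrite ?SubK // inE; apply/existsP; exists a; rewrite aS SubK.
    rewrite inE => /existsP [a /andP[aS ab]]; split; last exact: valP.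
    by rewrite inE; apply/existsP; exists (val a); rewrite imset_f.
  rewrite (card_imset _ val_inj) -(ler_nat rat) !natrM -natr1 => h.
  rewrite -(ler_pM2l q0) mulrA mulrDr mulr1 divff ?gt_eqF //.
- apply: (@pushdown_of_injection _ _ _ _
     (fun v => p (match v with inl a => inl (val a) | inr b => inr (val b) end))
     (fun a b => page (val a) (val b))).
  + by move=> [a|b] [a'|b'] /p_inj // [] /val_inj ->.
  + by move=> a1 b1 a2 b2 e1 e2 ep; exact: (nocross e1 e2 ep).
  + move=> a1 b1 a2 b2 e1 e2 ep ne.
    have [|h1 h2] := matching e1 e2 ep.
      by move=> [/val_inj E1 /val_inj E2]; apply: ne; rewrite E1 E2.
    by split=> E; [apply: h1; rewrite E|apply: h2; rewrite E].
Qed.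

End Prune.
End Pushdown.

(** * The layered graph: embedding and expansion *)

Section Layers.
Local Open Scope nat_scope.
Variables (d N : nat) (sigma : 'I_d -> 'I_N -> 'I_N) (G : 'I_d -> {set 'I_N}).
Hypothesis sigma_inc : forall i, increasing_on (sigma i) (G i).

Let V := ('I_d * 'I_N)%type.

(** Each of the three relations is a partial matching, whence one page each. A layer carries the
    slants of a single map, so the number of maps affects the number of layers and not the
    degree. *)
Definition rung (a b : V) := a == b.
Definition shelf (a b : V) := (ordS a.1 == b.1) && (a.2 == b.2).
Definition slant (a b : V) := [&& a.1 == b.1, b.2 \in G b.1 & sigma b.1 b.2 == a.2].

Definition layered (a b : V) := [|| rung a b, shelf a b | slant a b].
(** Priorities are needed because an edge may be of several kinds, as a slant at a fixed point is a
    rung. *)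
Definition layer_page (a b : V) : 'I_3 :=
  if rung a b then ord0 else if shelf a b then @Ordinal 3 1 isT else ord_max.

(* Block [i] lists the left copy of the [i]th layer increasingly and then its
   right copy decreasingly, so that the edges inside a block nest, and so do the
   shelves between two consecutive blocks. *)
Definition layer_pos (v : vtx V V) : nat :=
  match v with
  | inl a => a.1 * (2 * N) + (2 * N - 1 - a.2)
  | inr b => b.1 * (2 * N) + b.2
  end.

Lemma layer_pos_inj : injective layer_pos.
Proof.
have eqP' i j u v : u < 2 * N -> v < 2 * N -> i * (2 * N) + u = j * (2 * N) + v -> i = j /\ u = v.
  move=> uN vN; case: (ltngtP i j) => [ij|ij|->]; last by move/addnI.
    by have := leq_mul ij (leqnn (2 * N)); rewrite mulSn; lia.
  by have := leq_mul ij (leqnn (2 * N)); rewrite mulSn; lia.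
case=> [[i x]|[i x]] [[j y]|[j y]]; have := ltn_ord x; have := ltn_ord y => yN xN /=
  /eqP' [||/val_inj -> xy]; try lia.
  by congr (inl (_, _)); apply: val_inj => /=; lia.
by congr (inr (_, _)); apply: val_inj => /=; lia.
Qed.

Lemma layer_page_val a b : layered a b ->
  [\/ layer_page a b = 0 :> nat /\ rung a b, layer_page a b = 1 :> nat /\ shelf a b
    | layer_page a b = 2 :> nat /\ slant a b].
Proof.
rewrite /layered /layer_page; case: ifP => r /=; first by move=> _; constructor 1.
by case: ifP => s /=; [constructor 2 | constructor 3].
Qed.

(** Serves rungs and slants together: an arc runs from [y] to the mirror image of [x], so when [x]
    increases with [y], a later start means an earlier end. *)
Lemma nested_blocks (i1 i2 x1 x2 y1 y2 : nat) :
  x1 < N -> x2 < N -> y1 < N -> y2 < N -> (i1 = i2 -> y1 < y2 -> x1 < x2) ->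
  ~ [/\ i1 * (2 * N) + y1 < i2 * (2 * N) + y2,
        i2 * (2 * N) + y2 < i1 * (2 * N) + (2 * N - 1 - x1) &
        i1 * (2 * N) + (2 * N - 1 - x1) < i2 * (2 * N) + (2 * N - 1 - x2)].
Proof.
move=> x1N x2N y1N y2N mono; case: (ltngtP i1 i2) => [ij|ij|e].
- by case; have := leq_mul ij (leqnn (2 * N)); rewrite mulSn; lia.
- by case; have := leq_mul ij (leqnn (2 * N)); rewrite mulSn; lia.
- by rewrite e; case=> + _ +; rewrite ltn_add2l => /(mono e); lia.
Qed.

Lemma lo_block (i : 'I_d) (x y : 'I_N) : lo layer_pos (i, x) (i, y) = i * (2 * N) + y.
Proof. by rewrite /lo /=; have := ltn_ord x; have := ltn_ord y; lia. Qed.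

Lemma hi_block (i : 'I_d) (x y : 'I_N) :
  hi layer_pos (i, x) (i, y) = i * (2 * N) + (2 * N - 1 - x).
Proof. by rewrite /hi /=; have := ltn_ord x; have := ltn_ord y; lia. Qed.

Lemma shelf_ends (i : 'I_d) (x : 'I_N) :
  (i.+1 < d /\ lo layer_pos (i, x) (ordS i, x) + x.+1 = i.+1 * (2 * N) /\
   hi layer_pos (i, x) (ordS i, x) = i.+1 * (2 * N) + x) \/
  (i.+1 = d /\ lo layer_pos (i, x) (ordS i, x) = x /\
   hi layer_pos (i, x) (ordS i, x) + x.+1 = d * (2 * N)).
Proof.
have xN := ltn_ord x; rewrite /lo /hi /=.
have [e|ne] := eqVneq i.+1 d.
  have dN : i.+1 * (2 * N) = d * (2 * N) by congr (_ * _).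
  by right; rewrite e modnn -dN mulSn; lia.
have lt : i.+1 < d by rewrite ltn_neqAle ne ltn_ord.
by left; rewrite modn_small ?mulSn //; lia.
Qed.

Lemma layers_nocross a1 b1 a2 b2 : layered a1 b1 -> layered a2 b2 ->
  layer_page a1 b1 = layer_page a2 b2 ->
  ~ [/\ lo layer_pos a1 b1 < lo layer_pos a2 b2, lo layer_pos a2 b2 < hi layer_pos a1 b1
      & hi layer_pos a1 b1 < hi layer_pos a2 b2].
Proof.
move=> /layer_page_val h1 /layer_page_val h2 /(congr1 val) /= e.
move: h1 h2; rewrite e.
case: a1 b1 a2 b2 {e} => [i1 x1] [j1 y1] [i2 x2] [j2 y2].
case=> -[-> +] [] [] // _ +.
- by move=> /eqP [<- <-] /eqP [<- <-]; rewrite !lo_block !hi_block; exact: nested_blocks.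
- move=> /andP[/eqP /= <- /eqP /= <-] /andP[/eqP /= <- /eqP /= <-].
  have := ltn_ord x1; have := ltn_ord x2; move=> x2N x1N [c1 c2 c3].
  case: (shelf_ends i1 x1) => [[d1 [l1 h1]]|[e1 [l1 h1]]];
    case: (shelf_ends i2 x2) => [[d2 [l2 h2]]|[e2 [l2 h2]]].
  + case: (ltngtP i1 i2) => [ij|ij|e]; last by rewrite e in l1 h1; lia.
      by have := leq_mul ij (leqnn (2 * N)); rewrite (mulSn i2) in h2 l2; lia.
    by have := leq_mul ij (leqnn (2 * N)); rewrite (mulSn i1) in h1 l1; lia.
  + by have := leq_mul (ltn0Sn i1) (leqnn (2 * N)); lia.
  + by have := leq_mul d2 (leqnn (2 * N)); rewrite (mulSn i2.+1); lia.
  + by lia.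
- move=> /and3P[/= /eqP <- g1 /eqP s1] /and3P[/= /eqP <- g2 /eqP s2].
  rewrite !lo_block !hi_block; apply: nested_blocks => // /val_inj e y12; subst i2.
  by rewrite -s1 -s2; apply: sigma_inc.
Qed.

Lemma layers_matching a1 b1 a2 b2 : layered a1 b1 -> layered a2 b2 ->
  layer_page a1 b1 = layer_page a2 b2 -> (a1, b1) <> (a2, b2) -> a1 <> a2 /\ b1 <> b2.
Proof.
move=> /layer_page_val h1 /layer_page_val h2 /(congr1 val) /= e ne.
suff iffP : a1 = a2 <-> b1 = b2.
  by split=> E; apply: ne; have E' := E; [move/iffP: E'|move/iffP: E'] => E'; rewrite E E'.
move: h1 h2; rewrite e.
case: a1 b1 a2 b2 {e ne} => [i1 x1] [j1 y1] [i2 x2] [j2 y2].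
case=> -[-> +] [] [] // _ +.
- by move=> /eqP -> /eqP ->.
- move=> /andP[/eqP /= <- /eqP /= <-] /andP[/eqP /= <- /eqP /= <-].
  by split=> /eqP; rewrite xpair_eqE => /andP[/eqP + /eqP ->]; [move=> -> | move=> /ordS_inj ->].
- move=> /and3P[/= /eqP <- g1 /eqP s1] /and3P[/= /eqP <- g2 /eqP s2].
  split=> -[E E'].
    subst i2; congr (_, _); apply: val_inj => /=; case: (ltngtP y1 y2) => // lt.
      by have := sigma_inc g1 g2 lt; rewrite s1 s2 E' ltnn.
    by have := sigma_inc g2 g1 lt; rewrite s1 s2 E' ltnn.
  by rewrite -s1 -s2 E E'.
Qed.

Definition slice (S : {set V}) (i : 'I_d) : {set 'I_N} := [set x | (i, x) \in S].

Lemma card_slices (S : {set V}) : #|S| = \sum_i #|slice S i|.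
Proof.
rewrite -sum1_card (partition_big fst predT) //=; apply: eq_bigr => i _.
rewrite sum1_card -(card_imset (slice S i) (f := pair i)); last by move=> x y [].
apply: eq_card => -[j x]; apply/andP/imsetP => [[/= xS /eqP ji]|[y + [-> ->]]].
  by exists x; rewrite ?inE -?ji.
by rewrite inE /= eqxx.
Qed.

Lemma subset_layered (S : {set V}) : S \subset nbhd layered S.
Proof.
apply/subsetP => a aS; rewrite inE; apply/existsP; exists a.
by rewrite aS /layered /rung eqxx.
Qed.

Lemma slice_shelf (S : {set V}) i : slice S i \subset slice (nbhd layered S) (ordS i).
Proof.
apply/subsetP => x; rewrite !inE => xS; apply/existsP; exists (i, x).
by rewrite xS /layered /shelf !eqxx orbT.
Qed.

Lemma slice_slant (S : {set V}) i :
  [set y | (y \in G i) && (sigma i y \in slice S i)] \subset slice (nbhd layered S) i.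
Proof.
apply/subsetP => y; rewrite !inE => /andP[yG sS]; apply/existsP; exists (i, sigma i y).
by rewrite sS /layered /slant !eqxx yG !orbT.
Qed.

Lemma slice_sub (S T : {set V}) i : S \subset T -> slice S i \subset slice T i.
Proof. by move=> ST; apply/subsetP => x; rewrite !inE => /(subsetP ST). Qed.

Lemma card_slant_fiber i (E : {set 'I_N}) : #|[set y | (y \in G i) && (sigma i y \in E)]| <= #|E|.
Proof.
rewrite -(card_in_imset (f := sigma i)).
  by apply: subset_leq_card; apply/subsetP => _ /imsetP[y + ->]; rewrite inE => /andP[].
move=> y1 y2; rewrite !inE => /andP[g1 _] /andP[g2 _] e.
apply: val_inj => /=; case: (ltngtP y1 y2) => // lt.
  by have := sigma_inc g1 g2 lt; rewrite e ltnn.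
by have := sigma_inc g2 g1 lt; rewrite e ltnn.
Qed.

Lemma iter_ordS (i j : 'I_d) : exists2 k, k < d & iter k (@ordS d) i = j.
Proof.
have val_iter k : iter k (@ordS d) i = (i + k) %% d :> nat.
  elim: k => [|k IH] /=; first by rewrite addn0 modn_small.
  by rewrite IH -addn1 modnDml addn1 addnS.
have := ltn_ord i; have := ltn_ord j => jd id.
have [ij|ji] := leqP i j.
  exists (j - i); first by lia.
  by apply: val_inj; rewrite /= val_iter subnKC // modn_small.
exists (d + j - i); first by lia.
by apply: val_inj; rewrite /= val_iter subnKC ?modnDl ?modn_small //; lia.
Qed.

Lemma card_bigcup_leq (T : finType) (X : 'I_d -> {set T}) :
  #|\bigcup_i X i| <= \sum_i #|X i|.
Proof.
elim/big_rec2: _ => [|i m Y _ IH]; first by rewrite cards0.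
by apply: leq_trans (leq_card_setU _ _) _; rewrite leq_add2l.
Qed.

Hypothesis d_gt0 : 0 < d.
Hypothesis sigma_expand : forall E : {set 'I_N}, N <= 20 * #|E| -> 5 * #|E| <= 3 * N ->
  41 * #|E| <= 40 * #|[set x | [exists i, (x \in G i) && (sigma i x \in E)]]|.

(** Let [g] be the number of new vertices. Shelves make any two slices differ by at most d g points,
    so all maps can be compared on the smallest slice [E]. If [E] is dense enough for
    [sigma_expand], the slants give #|E| <= 40 (2 d^2 + 1) g, and #|S| <= d (#|E| + d g) explains
    [q]. *)
Lemma layered_expand (S : {set V}) (q := d * (40 * (2 * (d * d) + 1) + d)) :
  #|{: V}| <= 10 * #|S| -> 5 * #|S| <= 3 * #|{: V}| ->
  q.+1 * #|S| <= q * #|nbhd layered S|.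
Proof.
rewrite card_prod !card_ord => S10 S5.
set T := nbhd layered S.
pose t i := #|slice T i :\: slice S i|; pose g := \sum_i t i.
have cT : #|T| = #|S| + g.
  rewrite !card_slices -big_split; apply: eq_bigr => i _ /=.
  by rewrite -(cardsID (slice S i) (slice T i)) (setIidPr _) // slice_sub // subset_layered.
have tg i : t i <= g by rewrite /g (bigD1 i) //= leq_addr.
have step i : #|slice S i :\: slice S (ordS i)| <= g.
  by apply: leq_trans (tg (ordS i)); apply/subset_leq_card/setSD/slice_shelf.
have near i j : #|slice S i :\: slice S j| <= d * g.
  have [k kd <-] := iter_ordS i j; apply: leq_trans (leq_mul (ltnW kd) (leqnn g)).
  elim: k {kd} => [|k IH] /=; first by rewrite setDv cards0.
  rewrite mulSn addnC; apply: leq_trans (leq_add IH (step (iter k (@ordS d) i))).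
  apply: leq_trans (leq_card_setU _ _); apply: subset_leq_card; apply/subsetP => x.
  by rewrite !inE => /andP[-> ->]; rewrite !andbT orNb.
have sumd c : \sum_(i < d) c = d * c by rewrite sum_nat_const card_ord.
have [i0 _ min0] := arg_minnP (fun i => #|slice S i|) (isT : predT (Ordinal d_gt0)).
pose E := slice S i0.
have S_ge : d * #|E| <= #|S|.
  by rewrite card_slices -sumd; apply: leq_sum => i _; exact: min0.
have S_le : #|S| <= d * (#|E| + d * g).
  rewrite card_slices -sumd; apply: leq_sum => i _.
  rewrite -(cardsID E (slice S i)) leq_add ?near //.
  by apply/subset_leq_card/subsetIr.
suff Sq : #|S| <= q * g by rewrite cT mulSn mulnDr; lia.
have [E20|E20] := leqP N (20 * #|E|).
  have E5 : 5 * #|E| <= 3 * N.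
    by rewrite -(leq_pmul2l d_gt0); lia.
  have := sigma_expand E20 E5.
  set F := [set x | _] => FE.
  pose F' i := [set x | (x \in G i) && (sigma i x \in E)].
  have F_le : #|F| <= #|E| + \sum_i #|F' i :\: E|.
    apply: leq_trans (leq_add (leqnn _) (card_bigcup_leq _)).
    apply: leq_trans (leq_card_setU _ _); apply: subset_leq_card; apply/subsetP => x.
    rewrite inE => /existsP[i xi]; rewrite !inE; case: (boolP ((i0, x) \in S)) => //= xE.
    by apply/bigcupP; exists i => //; rewrite !inE xE; move: xi; rewrite inE.
  (* A point of [F' i] outside [E] is new in layer [i], or lies in [slice S i] but not in [E], or is
     mapped into [E] outside [slice S i]. *)
  have F'_le i : #|F' i :\: E| <= t i + d * g + d * g.
    apply: leq_trans (leq_add (leq_add (leqnn _) (near i i0))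
      (leq_trans (card_slant_fiber i (E :\: slice S i)) (near i0 i))).
    apply: leq_trans (leq_add (leq_card_setU _ _) (leqnn _)).
    apply: leq_trans (leq_card_setU _ _); apply: subset_leq_card; apply/subsetP => x.
    have := subsetP (slice_slant S i) x; rewrite !inE.
    case: ((i0, x) \in S) => //=; case: (x \in G i) => //=.
    by case: ((i0, _) \in S) => //=; case: ((i, sigma i x) \in S) => /=;
      [move=> -> //; rewrite andbT orbF orNb | rewrite !orbT].
  have : \sum_i #|F' i :\: E| <= g + d * (2 * (d * g)).
    rewrite -sumd -big_split; apply: leq_sum => i _ /=.
    by apply: leq_trans (F'_le i) _; lia.
  move=> sumF; have Eg : #|E| <= 40 * (g + d * (2 * (d * g))) by lia.
  apply: leq_trans S_le _.
  have := leq_mul (leqnn d) Eg; rewrite /q; lia.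
(* Here d #|E| is less than half of #|S|, so the variation d (d g) between slices accounts for the
   other half. *)
have : N * d <= 10 * #|S| by rewrite mulnC.
have := leq_mul E20 (leqnn d).
rewrite /q; nia.
Qed.

End Layers.

Theorem theorem3 :
  exists eps : rat, (0 < eps)%R /\ (eps <= 1)%R /\
    forall n : nat, exists (A B : finType) (adj : A -> B -> bool),
      (n <= #|A| + #|B|)%N /\ bip_expander adj eps /\ has_pushdown adj 3.
Proof.
have [I [I0 mono]] := monotone_expander Rdefinitions.R.
(* The number of maps does not depend on [n], so [1 / q] serves for all sizes. *)
pose d := #|I|; pose q := (d * (40 * (2 * (d * d) + 1) + d))%N.
have q0 : (0 < q)%N by rewrite !muln_gt0 addn_gt0 I0 orbT.
exists (q%:R^-1)%R; rewrite invr_gt0 ltr0n q0 invf_le1 ?ltr0n // ler1n q0.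
do 2![split=> //] => n; have [N [sigma [G [nN inc ex]]]] := mono n.
pose s (i : 'I_d) := sigma (enum_val i); pose H (i : 'I_d) := G (enum_val i).
have s_inc i : increasing_on (s i) (H i) by exact: inc.
have s_ex (E : {set 'I_N}) : (N <= 20 * #|E|)%N -> (5 * #|E| <= 3 * N)%N ->
    (41 * #|E| <= 40 * #|[set x | [exists i, (x \in H i) && (s i x \in E)]]|)%N.
  move=> E1 E2; apply: leq_trans (ex _ E1 E2) _; rewrite leq_mul2l /=.
  apply: subset_leq_card; apply/subsetP => x; rewrite !inE => /existsP[i xi].
  by apply/existsP; exists (enum_rank i); rewrite /s /H enum_rankK.
have [|A' [B' [adj' [card_le expa pages]]]] := pruned_pushdown_expander (erefl _) q0 _
  (layered_expand s_inc I0 s_ex) (@layer_pos_inj d N) (layers_nocross s_inc)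
  (layers_matching s_inc).
  by move=> S; exact/subset_leq_card/subset_layered.
exists A', B', adj'; split=> //; apply: leq_trans card_le.
by rewrite card_prod !card_ord (leq_trans nN) // leq_pmull.
Qed.
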